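(* Let $G$ be a minimally $1$-tough $(K_1\cup P_4)$-free graph. Then $G$ is (isomorphic to) $C_4$, $C_5$ or $C_6$.
   Context: All graphs are simple and finite. $P_n$ and $C_n$ denote the path and the cycle on $n$ vertices, and $K_1$ is the one-vertex graph. $H_1\cup H_2$ denotes the union of two vertex-disjoint graphs $H_1$ and $H_2$ (with no edges between them), so $K_1\cup P_4$ is the disjoint union of an isolated vertex and a path on four vertices. A graph $G$ is $H$-free if it contains no induced subgraph isomorphic to $H$. Let $\omega(G)$ denote the number of components of $G$. A vertex subset $S$ of $G$ is a vertex cut if $G-S$ is disconnected. For a real number $t\ge 0$, $G$ is $t$-tough if $|S|\ge t\cdot\omega(G-S)$ for every vertex cut $S$ of $G$. The toughness $\tau(G)$ is the maximum $t$ such that $G$ is $t$-tough if $G$ is non-complete, and $\tau(G)=+\infty$ if $G$ is complete. For a positive real number $t$, $G$ is minimally $t$-tough if $\tau(G)=t$ and $\tau(G-e)<t$ for each edge $e$ of $G$, where $G-e$ is $G$ with the edge $e$ deleted. *)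

(* Defs.v *)
From HB Require Import structures.
From mathcomp Require Import all_boot all_order all_algebra.
From mathcomp Require Import all_classical all_reals.

Set Implicit Arguments.
Unset Strict Implicit.
Unset Printing Implicit Defensive.

Import Order.TTheory GRing.Theory Num.Theory.
Local Open Scope ring_scope.

Record sgraph := SGraph {
  vertex :> finType;
  edge : rel vertex;
  edge_sym : symmetric edge;
  edge_irr : irreflexive edge
}.

Definition isomorphic (G H : sgraph) : Prop :=
  exists f : G -> H, bijective f /\ forall x y : G, edge (f x) (f y) = edge x y.

Section Induced.
Variables (G : sgraph) (A : {set G}).
Let V : finType := {x : G | x \in A}.
Let r : rel V := [rel u v | edge (val u) (val v)].
Let r_sym : symmetric r. Proof. by move=> u v; apply: edge_sym. Qed.
Let r_irr : irreflexive r. Proof. by move=> u; apply: edge_irr. Qed.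
Definition induced : sgraph := SGraph r_sym r_irr.
End Induced.

Section DelEdge.
Variables (G : sgraph) (x y : G).
Let r : rel G := [rel u v | edge u v && ([set u; v]%SET != [set x; y]%SET)].
Let r_sym : symmetric r.
Proof. by move=> u v; rewrite /r /= edge_sym finset.setUC. Qed.
Let r_irr : irreflexive r. Proof. by move=> u; rewrite /r /= edge_irr. Qed.
Definition del_edge : sgraph := SGraph r_sym r_irr.
End DelEdge.

Section DisjointUnion.
Variables G H : sgraph.
Let r : rel (G + H)%type := fun u v =>
  match u, v with
  | inl x, inl y => edge x y
  | inr x, inr y => edge x y
  | _, _ => false
  end.
Let r_sym : symmetric r. Proof. by case=> x [] y //=; apply: edge_sym. Qed.
Let r_irr : irreflexive r. Proof. by case=> x /=; apply: edge_irr. Qed.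
Definition disjoint_union : sgraph := SGraph r_sym r_irr.
End DisjointUnion.

Section StandardGraphs.
Variable n : nat.

Let rK : rel 'I_n := [rel i j : 'I_n | i != j].
Let rK_sym : symmetric rK. Proof. by move=> i j; rewrite /rK /= eq_sym. Qed.
Let rK_irr : irreflexive rK. Proof. by move=> i; rewrite /rK /= eqxx. Qed.
Definition complete_graph : sgraph := SGraph rK_sym rK_irr.

Let rP : rel 'I_n := [rel i j : 'I_n | (i.+1 == j)%N || (j.+1 == i)%N].
Let rP_sym : symmetric rP. Proof. by move=> i j; rewrite /rP /= orbC. Qed.
Let rP_irr : irreflexive rP.
Proof. by move=> i; rewrite /rP /= orbb eqn_leq ltnn. Qed.
Definition path_graph : sgraph := SGraph rP_sym rP_irr.

(* This is the cycle on n vertices for 3 <= n; the conjunct i != j only serves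
   to avoid a loop when n = 1. *)
Let rC : rel 'I_n :=
  [rel i j : 'I_n | (i != j) && ((i.+1 %% n == j)%N || (j.+1 %% n == i)%N)].
Let rC_sym : symmetric rC.
Proof. by move=> i j; rewrite /rC /= eq_sym orbC. Qed.
Let rC_irr : irreflexive rC. Proof. by move=> i; rewrite /rC /= eqxx. Qed.
Definition cycle_graph : sgraph := SGraph rC_sym rC_irr.
End StandardGraphs.

Definition induced_free (H G : sgraph) : Prop :=
  ~ exists A : {set G}, isomorphic (induced A) H.

Definition is_complete (G : sgraph) : bool :=
  [forall x : G, forall y : G, (x != y) ==> edge x y].

Definition omega (G : sgraph) : nat := n_comp (@edge G) predT.

Definition disconnected (G : sgraph) : bool := (1 < omega G)%N.

Definition del_vertices (G : sgraph) (S : {set G}) : sgraph :=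
  induced (~: S)%SET.

Definition vertex_cut (G : sgraph) (S : {set G}) : bool :=
  disconnected (del_vertices S).

Definition tough (R : realType) (t : R) (G : sgraph) : Prop :=
  forall S : {set G}, vertex_cut S ->
    t * (omega (del_vertices S))%:R <= #|S|%:R.

(* For a non-complete graph the supremum is a maximum: see toughness_max. *)
Definition toughness (R : realType) (G : sgraph) : \bar R :=
  if is_complete G then +oo%E
  else (sup [set t : R | 0 <= t /\ tough t G]%classic)%:E.

Definition minimally_tough (R : realType) (t : R) (G : sgraph) : Prop :=
  [/\ 0 < t,
      toughness R G = t%:E
    & forall x y : G, edge x y -> (toughness R (del_edge x y) < t%:E)%E].

Lemma noncomplete_vertex_cut (G : sgraph) :
  ~~ is_complete G -> exists S : {set G}, vertex_cut S.
Proof.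
rewrite negb_forall => /existsP[x]; rewrite negb_forall => /existsP[y].
rewrite negb_imply => /andP[xy nexy].
exists (~: [set x; y])%SET; rewrite /vertex_cut /disconnected /omega.
set H := del_vertices _.
have e0 (u v : H) : edge u v = false.
  case: u => u pu; case: v => v pv; rewrite /edge /=.
  move: pu pv; rewrite !inE !negbK => /orP[]/eqP-> /orP[]/eqP->;
    by rewrite ?edge_irr ?(negbTE nexy) // edge_sym (negbTE nexy).
have rootsH (u : H) : u \in roots (@edge H).
  rewrite unfold_in; have /connectP[p] := connect_root (@edge H) u.
  by case: p => [_ -> //|v p /andP[]]; rewrite (e0 u v).
have px : x \in (~: ~: [set x; y])%SET by rewrite !inE negbK eqxx.
have py : y \in (~: ~: [set x; y])%SET by rewrite !inE negbK eqxx orbT.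
pose x' : H := exist _ x px; pose y' : H := exist _ y py.
have <- : #|[set x'; y']%SET| = 2%N by rewrite cards2 -val_eqE /= xy.
apply/subset_leq_card/fintype.subsetP => u _.
by rewrite inE; apply/andP; split=> //; exact: rootsH.
Qed.

Lemma toughness_max (R : realType) (G : sgraph) : ~~ is_complete G ->
  exists t : R, [/\ toughness R G = t%:E, 0 <= t, tough t G
    & forall s : R, 0 <= s -> tough s G -> s <= t].
Proof.
move=> ncG; rewrite /toughness (negbTE ncG).
set A := [set t : R | _]%classic; exists (sup A).
have A0 : A 0 by split=> // S _; rewrite mul0r.
have le_cut (S : {set G}) : vertex_cut S ->
    ubound A (#|S|%:R / (omega (del_vertices S))%:R).
  move=> cutS t [_ /(_ S cutS)]; rewrite ler_pdivlMr // ltr0n.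
  exact: ltn_trans cutS.
have hA : has_sup A.
  split; first by exists 0.
  by have [S cutS] := noncomplete_vertex_cut ncG; eexists; exact: le_cut cutS.
have ubA : ubound A (sup A) by apply: sup_upper_bound.
split=> //; first exact: ubA.
  move=> S cutS; rewrite -ler_pdivlMr; last by rewrite ltr0n; exact: ltn_trans cutS.
  by apply: ge_sup; [exists 0 | exact: le_cut].
by move=> s s0 sG; apply: ubA.
Qed.

(* Main.v *)
Require Import Defs.
From mathcomp Require Import all_boot zify.

(** The toughness hypotheses are used in a purely combinatorial form.
    1-toughness says that a set [T] with [G - T] disconnected leaves at most [|T|]
    components; call [T] tough if it has at least two vertices and leaves exactly
    [|T|]. Minimality says that every edge [xy] is critical: it is a bridge of
    [G - T] for a tough set [T], or of [G - t] for a single vertex [t]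
    ([critical_bridge]). Freeness enters twice. When [G - T] is disconnected, its
    components are [P_4]-free, so a bridge [xy] in one of them joins a leaf to a
    vertex adjacent to the whole component ([bridge_leaf_star]). And an induced
    [P_4] of [G] dominates [G], which restricts the neighbourhoods of the vertices
    of a tough set.

    Fix a tough set [S] of maximum size [k]. Removing a nonempty set
    [Y] from a component of [G - S] leaves at most [|Y|] pieces, since otherwise
    [S :|: Y] would be a larger tough set ([max_tough_part]).

    If [k = 2], all tough sets have two vertices. A component with three vertices
    or more would lead, by moving the cut into it, to a triangle with a noncritical
    edge ([small_comps_le2]). So [G] consists of two vertices [a], [b] and two
    components of size at most two; criticality excludes chords, so these are paths
    from [a] to [b], and [G] is [C_4], [C_5] or [C_6] ([small_cycle]).

    If [k > 2], no vertex of [S] is adjacent to all components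
    ([full_vertex_absurd]): such a vertex is adjacent to all vertices outside [S]
    and one component [H], criticality makes these have degree two, and then its
    edges to [H] lie on too many cycles to be critical. By domination of an induced
    [P_4], each vertex of [S] then sees all or nothing of each component, and
    criticality of these edges forces all components to be single vertices
    ([comps_single]). So [G] is bipartite up to edges inside [S], with sides of the
    same size [k], and 1-toughness gives a strict Hall condition ([Hall_out]). The
    neighbourhoods of the vertices of [S] form a cross-free family ([cross_free]).
    If a vertex [d] outside [S] had three neighbours, criticality of the edges at
    [d] would prevent neighbourhoods of vertices adjacent to [d] from being nested
    ([out_not_nested]) and those with more than two elements from being covered by
    two others ([out_not_covered]), whereas among three members of a cross-free
    family that contain [d] one of the two always occurs ([degree2]). Hence all
    degrees between the sides are two, and the Hall condition with cross-freeness
    leaves only [k = 3] and [C_6] ([large_cycle]). *)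

Set Implicit Arguments.
Unset Strict Implicit.
Unset Printing Implicit Defensive.

Local Notation "u -- v" := (edge u v) (at level 30).

(** * Finite sets *)

Section SetFamilies.
Variable V : finType.
Implicit Types (A B T : {set V}) (P Q : {set {set V}}).

Lemma trivIset_eq P A B x :
  trivIset P -> A \in P -> B \in P -> x \in A -> x \in B -> A = B.
Proof.
move=> tP AP BP xA xB.
by rewrite -(def_pblock tP AP xA) -(def_pblock tP BP xB).
Qed.

Lemma trivIsetI_of P :
  (forall A B x, A \in P -> B \in P -> x \in A -> x \in B -> A = B) ->
  trivIset P.
Proof.
move=> h; apply/trivIsetP => A B AP BP; apply: contraR => /pred0Pn[x /=].
by case/andP=> xA xB; apply/eqP; apply: h xA xB.
Qed.

Lemma card_hit P T : trivIset P -> (forall A, A \in P -> exists2 x, x \in A & x \in T) ->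
  #|P| <= #|T :&: cover P|.
Proof.
move=> tP hit; have sub : P \subset pblock P @: (T :&: cover P).
  apply/subsetP => A AP; have [x xA xT] := hit _ AP.
  apply/imsetP; exists x; last by rewrite (def_pblock tP AP xA).
  by rewrite inE xT; apply/bigcupP; exists A.
exact: leq_trans (subset_leq_card sub) (leq_imset_card _ _).
Qed.

Lemma card_cover_ge P : trivIset P -> (forall A, A \in P -> A != set0) ->
  #|P| <= #|cover P|.
Proof.
move=> tP ne; rewrite -(setTI (cover P)); apply: card_hit => // A AP.
by have /set0Pn[x xA] := ne _ AP; exists x.
Qed.

Lemma card_leD1 A x : #|A| <= #|A :\ x| + 1.
Proof. by rewrite (cardsD1 x A) addnC leq_add2l; case: (x \in A). Qed.

Lemma card_setU_le A B : #|A :|: B| <= #|A| + #|B|.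
Proof. by rewrite cardsU leq_subr. Qed.

Lemma card_gt2 A x y z : x \in A -> y \in A -> z \in A ->
  x != y -> x != z -> y != z -> 2 < #|A|.
Proof.
move=> xA yA zA xy xz yz.
have /subset_leq_card : [set x; y; z] \subset A.
  by rewrite !subUset !sub1set xA yA.
rewrite -setUA cardsU1 cards2 !inE negb_or xy xz yz; lia.
Qed.

Lemma card_le2 A x y : A \subset [set x; y] -> #|A| <= 2.
Proof. by move/subset_leq_card/leq_trans; apply; rewrite cards2; case: eqP. Qed.

Lemma card2_other A x : 1 < #|A| -> exists2 y, y \in A & y != x.
Proof.
move=> A2; have : 0 < #|A :\ x| by move: (cardsD1 x A) A2; case: (x \in A); lia.
by case/card_gt0P => y; rewrite !inE => /andP[yx yA]; exists y.
Qed.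

Lemma card3_other A x y : 2 < #|A| -> exists z, [/\ z \in A, z != x & z != y].
Proof.
move=> A3; have : 1 < #|A :\ x| by move: (cardsD1 x A) A3; case: (x \in A); lia.
by case/(card2_other y)=> z; rewrite !inE => /andP[zx zA] zy; exists z.
Qed.

End SetFamilies.

(** * Components of vertex-deleted subgraphs *)

Section Components.
Variable G : sgraph.
Implicit Types (u v w x y : G) (S T F Z D C O : {set G}) (P Q : {set {set G}}).

Definition avoiding T : rel G := [rel u v | [&& u -- v, u \notin T & v \notin T]].

Definition component T u : {set G} := [set v | connect (avoiding T) u v].

Definition comps T : {set {set G}} := [set component T u | u in ~: T].

(** An island of [T] is a nonempty union of components of [G - T]. *)
Definition island T F :=
  [/\ F != set0, [disjoint F & T]
    & forall u v, u \in F -> u -- v -> (v \in F) || (v \in T)].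

Lemma edge_neq u v : u -- v -> u != v.
Proof. by apply: contraTneq => ->; rewrite edge_irr. Qed.

Lemma avoiding_sym T : symmetric (avoiding T).
Proof. by move=> u v; rewrite /avoiding /= edge_sym [X in _ && X]andbC. Qed.

Lemma component_refl T u : u \in component T u.
Proof. by rewrite inE connect0. Qed.

Lemma component_sym T u v : (v \in component T u) = (u \in component T v).
Proof. by rewrite !inE (sym_connect_sym (avoiding_sym T)). Qed.

Lemma component_eq T u v : v \in component T u -> component T v = component T u.
Proof.
rewrite inE => uv; apply/setP => w; rewrite !inE.
by rewrite (same_connect (sym_connect_sym (avoiding_sym T)) uv).
Qed.

Lemma component_step T u v w : v \in component T u -> v -- w -> v \notin T -> w \notin T ->
  w \in component T u.
Proof.
rewrite !inE => uv vw vT wT; apply: connect_trans uv (connect1 _).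
by rewrite /avoiding /= vw vT.
Qed.

Lemma component_min T u Z : u \in Z ->
  (forall v w, v \in Z -> v -- w -> v \notin T -> w \notin T -> w \in Z) ->
  component T u \subset Z.
Proof.
move=> uZ hZ; apply/subsetP => v; rewrite inE => /connectP[p].
elim: p u uZ => [|w p IH] u uZ /=; first by move=> _ ->.
by case/andP=> /and3P[uw uT wT] /IH; apply; apply: hZ uw uT wT.
Qed.

Lemma component_notin T u v : u \notin T -> v \in component T u -> v \notin T.
Proof.
move=> uT; suff /subsetP/(_ v) : component T u \subset ~: T by rewrite in_setC.
by apply: component_min; rewrite ?inE // => ? w _ _ _ wT; rewrite inE.
Qed.

Lemma mem_comps T u : u \notin T -> component T u \in comps T.
Proof. by move=> uT; apply: imset_f; rewrite inE. Qed.

Lemma compsP T C u : C \in comps T -> u \in C -> u \notin T /\ C = component T u.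
Proof.
case/imsetP=> v; rewrite inE => vT -> uC.
by rewrite (component_eq uC) (component_notin vT uC).
Qed.

Lemma comps_notin T C u : C \in comps T -> u \in C -> u \notin T.
Proof. by move=> CT uC; case: (compsP CT uC). Qed.

Lemma comps_eq T C O u : C \in comps T -> O \in comps T -> u \in C -> u \in O -> C = O.
Proof. by move=> CT OT uC uO; case: (compsP CT uC) (compsP OT uO) => _ -> [_ ->]. Qed.

Lemma comps_trivI T : trivIset (comps T).
Proof. by apply: trivIsetI_of => A B x; apply: comps_eq. Qed.

Lemma sub_trivIset P Q : P \subset Q -> trivIset Q -> trivIset P.
Proof.
move=> /subsetP sPQ tQ; apply: trivIsetI_of => A B x /sPQ AQ /sPQ BQ.
exact: trivIset_eq tQ AQ BQ.
Qed.

Lemma comps_step T C u v : C \in comps T -> u \in C -> u -- v -> v \notin T -> v \in C.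
Proof.
move=> CT uC uv vT; have [uT ->] := compsP CT uC.
exact: component_step (component_refl _ _) uv uT vT.
Qed.

Lemma comps_nonadj T C O u v : C \in comps T -> O \in comps T -> C != O ->
  u \in C -> v \in O -> ~~ (u -- v).
Proof.
move=> CT OT CO uC vO; apply: contraNN CO => uv; apply/eqP.
by apply: (comps_eq CT OT _ vO); apply: comps_step uC uv (comps_notin OT vO).
Qed.

Lemma comps_island T C : C \in comps T -> island T C.
Proof.
move=> CT; split.
- by case/imsetP: CT => u _ ->; apply/set0Pn; exists u; apply: component_refl.
- by apply/pred0P => u /=; apply/andP => -[uC]; rewrite (negPf (comps_notin CT uC)).
move=> u v uC uv; case vT: (v \in T); first by rewrite orbT.
by rewrite (comps_step CT uC uv) // vT.
Qed.

Lemma comps_neq0 T C : C \in comps T -> exists u, u \in C.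
Proof. by case/comps_island=> /set0Pn. Qed.

(** A component is connected, so an edge leaves each of its proper parts. *)
Lemma comps_boundary T C Z x y : C \in comps T -> x \in C -> x \in Z ->
  y \in C -> y \notin Z ->
  exists u v, [/\ u \in C, u \in Z, v \in C, v \notin Z & u -- v].
Proof.
move=> CT xC xZ yC yZ.
suff /exists_inP[u /setIP[uC uZ] /exists_inP[v /setDP[vC vZ] uv]] :
  [exists u in C :&: Z, exists v in C :\: Z, u -- v] by exists u, v.
apply: contraNT yZ => /exists_inPn noe; have [xT eC] := compsP CT xC.
have/subsetP/(_ y) : component T x \subset C :&: Z; last first.
  by rewrite -eC inE => /(_ yC)/andP[].
apply: component_min => [|u v uCZ uv uT vT]; first by rewrite inE xC xZ.
have /exists_inPn/(_ v) := noe u uCZ; rewrite uv => vC.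
have vC' : v \in C by move: uCZ => /setIP[uC _]; apply: comps_step uC uv vT.
by rewrite inE vC' /=; apply: contraTT isT => vZ; apply: vC; rewrite inE vZ vC'.
Qed.

Lemma island_comp T F u : island T F -> u \in F -> component T u \subset F.
Proof.
case=> _ _ hF uF; apply: component_min => // v w vF vw _ wT.
by have := hF v w vF vw; rewrite (negPf wT) orbF.
Qed.

Lemma island_notin T F u : island T F -> u \in F -> u \notin T.
Proof. by case=> _ dF _ uF; rewrite (disjointFr dF uF). Qed.

(** Each island contains a component. *)
Lemma card_islands T P : trivIset P -> (forall F, F \in P -> island T F) ->
  #|P| <= #|comps T|.
Proof.
move=> tP isl.
have sub : P \subset (fun C => odflt set0 [pick F in P | C \subset F]) @: comps T.
  apply/subsetP => F FP; have iF := isl _ FP.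
  have [/set0Pn[u uF] _ _] := iF.
  apply/imsetP; exists (component T u); first exact: mem_comps (island_notin iF uF).
  case: pickP => [F' /andP[F'P /subsetP sF']|/(_ F)] /=; last first.
    by rewrite FP (island_comp iF uF).
  exact: trivIset_eq tP FP F'P uF (sF' _ (component_refl _ _)).
exact: leq_trans (subset_leq_card sub) (leq_imset_card _ _).
Qed.

(** What lies outside [T] and a family of islands is itself an island. *)
Lemma card_islands_rest T P s : trivIset P -> (forall F, F \in P -> island T F) ->
  s \notin T -> s \notin cover P -> #|P| < #|comps T|.
Proof.
move=> tP isl sT sP; pose R := ~: (T :|: cover P).
have sR : s \in R by rewrite !inE negb_or sT.
have RP : R \notin P.
  by apply: contraNN sP => RP; apply/bigcupP; exists R.
have dR F x : F \in P -> x \in F -> x \notin R.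
  move=> FP xF; rewrite !inE negbK; apply/orP; right.
  by apply/bigcupP; exists F.
have -> : #|P|.+1 = #|R |: P| by rewrite cardsU1 RP.
apply: card_islands.
  apply: trivIsetI_of => A B x /setU1P[->|AP] /setU1P[->|BP] // xA xB.
  - by rewrite (negPf (dR _ _ BP xB)) in xA.
  - by rewrite (negPf (dR _ _ AP xA)) in xB.
  - exact: trivIset_eq tP AP BP xA xB.
move=> F /setU1P[->|/isl //]; split; first by apply/set0Pn; exists s.
  by apply/pred0P => x /=; rewrite !inE; case: (x \in T); rewrite ?andbF.
move=> u v; rewrite !inE !negb_or => /andP[uT uP] uv; case vT: (v \in T) => //=.
rewrite orbF; apply: contraNN uP => /bigcupP[F' F'P vF'].
have [_ _ /(_ v u vF')] := isl _ F'P; rewrite edge_sym uv (negPf uT) orbF => /(_ isT) uF'.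
by apply/bigcupP; exists F'.
Qed.

End Components.

(** * Tough sets and bridges *)

Section Toughness.
Variable G : sgraph.
Implicit Types (u v w x y z s t d : G) (S T Y Z F D C O : {set G}) (P : {set {set G}}).

Definition one_tough := forall T, 1 < #|comps T| -> #|comps T| <= #|T|.

Definition tough_set T := (1 < #|T|) && (#|T| <= #|comps T|).

(** No induced [K_1 \cup P_4]; distinctness of the five vertices is implied by
    the adjacencies. *)
Definition K1P4_free := forall p q r t z,
  p -- q -> q -- r -> r -- t -> ~~ (p -- r) -> ~~ (p -- t) -> ~~ (q -- t) ->
  ~~ (z -- p) -> ~~ (z -- q) -> ~~ (z -- r) -> ~~ (z -- t) -> False.

(** [Y] is the side of [y] when the bridge [xy] of [G - T] is cut. *)
Definition bridge T x y Y :=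
  [/\ x \notin Y :|: T, y \in Y, [disjoint Y & T]
    & forall u v, u \in Y -> v \notin Y -> u -- v -> v \in T \/ (u = y /\ v = x)].

(** The shape of a bridge in a [P_4]-free component of [G - T]. *)
Definition leaf_star T x y :=
  (forall v, y -- v -> v \notin T -> v = x) /\
  (forall v, v \in component T x -> v != x -> x -- v).

(** Deleting any edge destroys 1-toughness: the edge is a bridge of [G - T] for
    some tough set [T], or for a single vertex. *)
Definition edges_critical := forall x y, x -- y ->
  exists T Y, bridge T x y Y /\ (#|T| = 1 \/ tough_set T).

Hypothesis G1 : one_tough.
Hypothesis Gfree : K1P4_free.

Lemma tough_card T : tough_set T -> #|comps T| = #|T|.
Proof. by case/andP=> T2 TC; apply/eqP; rewrite eqn_leq TC G1 // (leq_trans T2). Qed.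

Lemma tough_gt1 T : tough_set T -> 1 < #|T|.
Proof. by case/andP. Qed.

(** The form in which 1-toughness is used: the members of [P] and the rest are at
    least two parts of [G - T]. *)
Lemma rest_bound T P s : trivIset P -> (forall F, F \in P -> island T F) ->
  s \notin T -> s \notin cover P -> 0 < #|P| -> #|P| < #|T|.
Proof.
move=> tP isl sT sP P0; have lt := card_islands_rest tP isl sT sP.
exact: leq_trans lt (G1 (leq_ltn_trans P0 lt)).
Qed.

Lemma trivIset1 F : trivIset [set F].
Proof. by apply: trivIsetI_of => A B x /set1P-> /set1P->. Qed.

Lemma rest_bound1 T F s : island T F -> s \notin T -> s \notin F -> 1 < #|T|.
Proof.
move=> iF sT sF; rewrite -(cards1 F); apply: (rest_bound (s := s)) => //.
- exact: trivIset1.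
- by move=> _ /set1P->.
- by apply: contra sF => /bigcupP[_ /set1P->].
- by rewrite cards1.
Qed.

Lemma rest_bound_singles T (W : {set G}) s :
  (forall d, d \in W -> d \notin T) -> (forall d v, d \in W -> d -- v -> v \in T) ->
  s \notin T -> s \notin W -> 0 < #|W| -> #|W| < #|T|.
Proof.
move=> WT Wadj sT sW W0; have inj : injective (fun d : G => [set d]) := set1_inj.
rewrite -(card_imset (mem W) inj); apply: (rest_bound (s := s)) => //.
- apply: trivIsetI_of => A B x /imsetP[a _ ->] /imsetP[b _ ->].
  by move=> /set1P-> /set1P->.
- move=> F /imsetP[d dW ->]; split; first by apply/set0Pn; exists d; rewrite inE.
    by rewrite disjoints1 WT.
  by move=> u v /set1P-> dv; rewrite (Wadj d v dW dv) orbT.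
- by apply: contra sW => /bigcupP[F /imsetP[d dW ->]] /set1P->.
- by rewrite card_imset.
Qed.

Lemma comps_sub_trivI T P : P \subset comps T -> trivIset P.
Proof. by move/sub_trivIset; apply; apply: comps_trivI. Qed.

Lemma cover_compsP T P u : P \subset comps T -> u \in cover P ->
  u \notin T /\ component T u \in P.
Proof.
move=> /subsetP PT /bigcupP[C CP uC]; have [uT eC] := compsP (PT _ CP) uC.
by rewrite -eC.
Qed.

Lemma notin_cover_compsD1 T C u : C \in comps T -> u \in C :|: T ->
  u \notin cover (comps T :\ C).
Proof.
move=> CT uCT; apply/negP => /bigcupP[O /setD1P[OC OT] uO].
case/setUP: uCT => [uC|uT]; last by rewrite (negPf (comps_notin OT uO)) in uT.
by case/eqP: OC; apply: comps_eq OT CT uO uC.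
Qed.

(** Otherwise [T :\ t] would separate too many components. *)
Lemma tough_adj T C t : tough_set T -> t \in T -> C \in comps T ->
  exists v, [/\ v \notin T, v \notin C & t -- v].
Proof.
move=> tT tT' CT.
suff /exists_inP[v] : [exists v in ~: (T :|: C), t -- v].
  by rewrite !inE negb_or => /andP[vT vC] tv; exists v.
apply: contraT => /exists_inPn noadj.
have card1 : #|comps T :\ C| = #|T :\ t|.
  apply/eqP; rewrite -(eqn_add2l 1); move: (cardsD1 C (comps T)) (cardsD1 t T).
  by rewrite CT tT' (tough_card tT) => <- <-.
have : #|comps T :\ C| < #|T :\ t|; last by rewrite card1 ltnn.
apply: (rest_bound (s := t)).
- exact: comps_sub_trivI (subD1set _ _).
- move=> F /setD1P[FC FT]; have [F0 FdT Fout] := comps_island FT; split=> //.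
    by apply: disjointWr FdT; apply: subD1set.
  move=> u v uF uv; case/orP: (Fout u v uF uv) => [-> //|vT].
  rewrite !inE vT andbT; apply/orP; right; apply/eqP => vt; subst v.
  have := noadj u; rewrite !inE negb_or (comps_notin FT uF) [t -- u]edge_sym uv /=.
  case uC: (u \in C) => /=; last by move=> /(_ isT).
  by case/eqP: FC; apply: comps_eq FT CT uF uC.
- by rewrite !inE eqxx.
- by apply: notin_cover_compsD1 => //; rewrite inE tT' orbT.
by rewrite card1; move: (tough_gt1 tT) (cardsD1 t T); rewrite tT'; lia.
Qed.

Lemma tough_other_comp T C : tough_set T -> C \in comps T ->
  exists2 O, O \in comps T & O != C.
Proof. by move=> tT CT; apply: card2_other; rewrite tough_card ?tough_gt1. Qed.

Lemma tough_other T C : tough_set T -> C \in comps T ->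
  exists z, [/\ z \notin T, z \notin C & forall c, c \in C -> ~~ (z -- c)].
Proof.
move=> tT CT; have [O OT OC] := tough_other_comp tT CT.
have [z zO] := comps_neq0 OT; exists z; split; first exact: comps_notin OT zO.
  by apply: contraNN OC => zC; rewrite (comps_eq OT CT zO zC).
by move=> c cC; apply: comps_nonadj OT CT OC zO cC.
Qed.

(** The component of a leaf is [P_4]-free, as some vertex lies in another one;
    so the neighbour of the leaf dominates. *)
Lemma leaf_dominated T x y : tough_set T -> x \notin T -> y \notin T -> x -- y ->
  (forall v, y -- v -> v \notin T -> v = x) -> leaf_star T x y.
Proof.
move=> tT xT yT xy leaf; split=> // v vC vx; apply: contraT => nxv.
have CT := mem_comps xT; have [z [zT _ nz]] := tough_other tT CT.
pose Z := [set u | (u == x) || (x -- u)].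
have [||u [w [uC uZ wC wZ uw]]] := comps_boundary (Z := Z) CT (component_refl T x) _ vC.
- by rewrite inE eqxx.
- by rewrite inE negb_or vx.
move: wZ; rewrite inE negb_or => /andP[wx nxw].
have xu : x -- u.
  by move: uZ; rewrite inE => /orP[/eqP eux|//]; rewrite -eux uw in nxw.
have [uT wT] : u \notin T /\ w \notin T by rewrite !(comps_notin CT).
have nyw : ~~ (y -- w) by apply: contra wx => /leaf/(_ wT)->.
have nyu : ~~ (y -- u).
  by apply: contraTN xu => /leaf/(_ uT)->; rewrite edge_irr.
exfalso; apply: (Gfree (p := y) (q := x) (r := u) (t := w) (z := z)) => //; rewrite ?nz //.
- by rewrite edge_sym.
- exact: component_step (component_refl _ _) xy xT yT.
- exact: component_refl.
Qed.

(** A bridge of a [P_4]-free graph has an end of degree one. *)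
Lemma bridge_leaf_star T x y Y : tough_set T -> x -- y -> bridge T x y Y ->
  leaf_star T x y \/ leaf_star T y x.
Proof.
move=> tT xy [xYT yY dYT out].
have [xY xT] : x \notin Y /\ x \notin T by apply/andP; rewrite -negb_or -in_setU.
have yT : y \notin T by rewrite (disjointFr dYT yY).
have CT := mem_comps xT; have [z [zT _ nz]] := tough_other tT CT.
have xC := component_refl T x; have yC := component_step xC xy xT yT.
case: (boolP [forall v, (y -- v) ==> (v \notin T) ==> (v == x)]) => [/forallP ly|].
  left; apply: leaf_dominated => // v yv vT.
  by apply/eqP; move: (ly v); rewrite yv vT.
rewrite negb_forall => /existsP[w]; rewrite !negb_imply => /and3P[yw wT wx].
right; apply: leaf_dominated => //; first by rewrite edge_sym.
move=> u xu uT; apply/eqP; apply: contraT => uy.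
have wY : w \in Y.
  apply: contraT => wY; case: (out _ _ yY wY yw) => [|[_ /eqP]].
    by rewrite (negPf wT).
  by rewrite (negPf wx).
have uY : u \notin Y.
  apply/negP => uY; have := out _ _ uY xY; rewrite edge_sym xu => /(_ isT).
  by rewrite (negPf xT) => -[//|[/eqP]]; rewrite (negPf uy).
have wy : w != y by rewrite eq_sym edge_neq.
have nuw : ~~ (u -- w).
  apply/negP; rewrite edge_sym => /(out _ _ wY uY).
  by rewrite (negPf uT) => -[//|[/eqP]]; rewrite (negPf wy).
have nuy : ~~ (u -- y).
  apply/negP; rewrite edge_sym => /(out _ _ yY uY).
  rewrite (negPf uT) => -[//|[_ /eqP]].
  by rewrite eq_sym (negPf (edge_neq xu)).
have nxw : ~~ (x -- w).
  apply/negP; rewrite edge_sym => /(out _ _ wY xY).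
  by rewrite (negPf xT) => -[//|[/eqP]]; rewrite (negPf wy).
exfalso; apply: (Gfree (p := u) (q := x) (r := y) (t := w) (z := z)) => //; rewrite ?nz //.
- by rewrite edge_sym.
- exact: component_step xC xu xT uT.
- exact: component_step yC yw yT wT.
Qed.

Hypothesis Gcrit : edges_critical.

Lemma edge_cases x y : x -- y ->
  (exists t Y, bridge [set t] x y Y) \/
  (exists T, [/\ tough_set T, x \notin T, y \notin T
                & leaf_star T x y \/ leaf_star T y x]).
Proof.
move=> xy; have [T [Y [br]]] := Gcrit xy.
case=> [/eqP/cards1P[t eT]|tT]; first by left; exists t, Y; rewrite -eT.
right; exists T; have [xYT yY dYT _] := br.
split=> //; last exact: bridge_leaf_star br.
  by apply: contra xYT => xT; rewrite inE xT orbT.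
by rewrite (disjointFr dYT yY).
Qed.

(** Adding the centre of the star to [T] splits off the leaf and the rest. *)
Lemma leaf_star_extend T x y w : tough_set T -> x \notin T -> y \notin T -> x -- y ->
  leaf_star T x y -> w \in component T x -> w != x -> w != y -> tough_set (x |: T).
Proof.
move=> tT xT yT xy [leaf star] wC wx wy.
have CT := mem_comps xT; set C := component T x in CT wC star.
have cT : #|x |: T| = #|T|.+1 by rewrite cardsU1 xT.
have yC : y \in C by apply: component_step (component_refl _ _) xy xT yT.
apply/andP; split; first by rewrite cT; move: (tough_gt1 tT); lia.
pose P := [set y] |: (comps T :\ C).
have yO O : O \in comps T :\ C -> y \notin O.
  by case/setD1P=> OC OT; apply: contra OC => yO; rewrite (comps_eq OT CT yO yC).
have cP : #|P| = #|T|.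
  have yP : [set y] \notin comps T :\ C by apply/negP => /yO; rewrite inE eqxx.
  by rewrite cardsU1 yP -(tough_card tT) (cardsD1 C (comps T)) CT.
rewrite cT -cP; apply: (card_islands_rest (s := w)).
- apply: trivIsetI_of => A B u /setU1P[->|AP] /setU1P[->|BP] //.
  + by move=> /set1P-> yB; rewrite (negPf (yO _ BP)) in yB.
  + by move=> yA /set1P uy; subst u; rewrite (negPf (yO _ AP)) in yA.
  + move: AP BP => /setD1P[_ AT] /setD1P[_ BT]; exact: (comps_eq AT BT).
- move=> F /setU1P[->|FP].
    split; first by apply/set0Pn; exists y; rewrite inE.
      by rewrite disjoints1 !inE negb_or eq_sym edge_neq.
    move=> u v /set1P-> yv; rewrite !inE.
    by case vT: (v \in T); rewrite ?orbT // (leaf v yv) ?vT // eqxx ?orbT.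
  have xF : x \notin F.
    move: FP => /setD1P[FC FT]; apply: contra FC => xF.
    by rewrite (comps_eq FT CT xF) // component_refl.
  have [F0 dF out] := comps_island (proj2 (setD1P FP)); split=> //.
    by rewrite disjoint_sym disjoints_subset subUset sub1set inE xF -disjoints_subset disjoint_sym.
  by move=> u v uF uv; rewrite !inE; case/orP: (out u v uF uv) => ->; rewrite ?orbT.
- by rewrite !inE negb_or wx (comps_notin CT wC).
apply/bigcupP => -[F /setU1P[->|/setD1P[FC FT]]]; first by rewrite inE (negPf wy).
by move=> wF; case/eqP: FC; apply: comps_eq FT CT wF wC.
Qed.

End Toughness.

(** * Recognizing a cycle *)

Lemma isomorphic_cycle (G : sgraph) (x0 : G) (c : seq G) : 2 < size c -> uniq c ->
  (forall v, v \in c) ->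
  (forall i j, i < j -> j < size c -> nth x0 c i -- nth x0 c j =
     (j == i.+1) || ((i == 0) && (j.+1 == size c))) ->
  isomorphic G (cycle_graph (size c)).
Proof.
move=> c3 uc allc adj.
have idx v : index v c < size c by rewrite index_mem.
exists (fun v => Ordinal (idx v) : cycle_graph _); split.
  exists (fun i : cycle_graph (size c) => nth x0 c i) => [v|i] /=.
    by rewrite nth_index.
  by apply: val_inj; rewrite /= index_uniq.
move=> u v; have [eu ev] := (nth_index x0 (allc u), nth_index x0 (allc v)).
transitivity (nth x0 c (index u c) -- nth x0 c (index v c)); last by rewrite eu ev.
rewrite {1}/edge /= -val_eqE /=; move: (idx u) (idx v).
move: (index u c) (index v c) => i j ic jc; clear allc idx eu ev.
have [n en] : {n | n = size c} by exists (size c).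
rewrite -en in c3 ic jc adj *.
have modS m : m < n -> m.+1 %% n = if m.+1 == n then 0 else m.+1.
  by move=> mc; case: eqP => [->|ne]; rewrite ?modnn // modn_small //; lia.
rewrite !modS //; case: (ltngtP i j) => [ij|ji|->]; last by rewrite edge_irr.
- by rewrite adj //; case: (i.+1 =P n); case: (j.+1 =P n); case: (i =P 0); lia.
- by rewrite edge_sym adj //; case: (i.+1 =P n); case: (j.+1 =P n); case: (j =P 0); lia.
Qed.

(** * Tough sets of maximum size *)

Section MaximumToughSet.
Variable G : sgraph.
Implicit Types (a b u v w x y z s t d : G) (S T Y Z F D C O : {set G}) (P R : {set {set G}}).

Definition max_tough S := tough_set S /\ forall T, tough_set T -> #|T| <= #|S|.

Hypothesis G1 : one_tough G.

(** More pieces would make [S :|: Y] a larger tough set. *)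
Lemma max_tough_part S D Y R : max_tough S -> D \in comps S -> Y \subset D -> Y != set0 ->
  trivIset R -> (forall F, F \in R -> island (S :|: Y) F /\ F \subset D) ->
  #|R| <= #|Y|.
Proof.
move=> [tS maxS] DS YD Y0 tR isl; rewrite leqNgt; apply/negP => ltYR.
have dSY : [disjoint S & Y].
  by rewrite disjoint_sym; apply: disjointWl YD _; have [] := comps_island DS.
have cSY : #|S :|: Y| = #|S| + #|Y|.
  by rewrite cardsU (_ : S :&: Y = set0) ?cards0 ?subn0 //; apply/eqP; rewrite setI_eq0.
pose P := R :|: (comps S :\ D).
have disj F O u : F \in R -> O \in comps S :\ D -> u \in F -> u \notin O.
  move=> FR /setD1P[OD OS] uF; apply: contra OD => uO.
  by rewrite (comps_eq OS DS uO) //; have [_ /subsetP] := isl _ FR; apply.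
have dRP : R :&: (comps S :\ D) = set0.
  apply/setP => F; rewrite !inE; apply/negbTE/negP => /andP[FR FS].
  have [[/set0Pn[u uF] _ _] _] := isl _ FR.
  by have := disj _ F u FR; rewrite !inE uF => /(_ FS isT).
have cP : #|P| = #|R| + #|S|.-1.
  rewrite cardsU dRP cards0 subn0 -(tough_card G1 tS) (cardsD1 D (comps S)) DS.
  by [].
have leP : #|P| <= #|comps (S :|: Y)|.
  apply: card_islands.
    apply: trivIsetI_of => A B u /setUP[AR|AP] /setUP[BR|BP].
    - exact: trivIset_eq tR AR BR.
    - by move=> uA; rewrite (negPf (disj _ _ _ AR BP uA)).
    - by move=> uA uB; rewrite (negPf (disj _ _ _ BR AP uB)) in uA.
    - by move: AP BP => /setD1P[_ AS] /setD1P[_ BS]; exact: (comps_eq AS BS).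
  move=> F /setUP[/isl[]//|/setD1P[FD FS]].
  have [F0 dF out] := comps_island FS; split=> //.
    rewrite -setI_eq0 setIUr setU_eq0 !setI_eq0 dF /=; apply: disjointWr YD _.
    exact: (trivIsetP (comps_trivI S)).
  by move=> u v uF uv; rewrite inE orbA (out u v uF uv).
have S2 := tough_gt1 tS.
have : tough_set (S :|: Y) by apply/andP; split; lia.
move/maxS; rewrite cSY; move: Y0; rewrite -card_gt0; lia.
Qed.

(** A cut vertex [x] of [D] would give two pieces for one new vertex of the cut, so
    [D :\ x] is connected. *)
Lemma max_tough_boundary S D x Z u v : max_tough S -> D \in comps S -> x \in D ->
  u \in D -> u != x -> u \in Z -> v \in D -> v != x -> v \notin Z ->
  exists a b, [/\ a \in D, b \in D, a \in Z, b \notin Z & [/\ a != x, b != x & a -- b]].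
Proof.
move=> mS DS xD uD ux uZ vD vx vZ; set T := S :|: [set x].
have outT w : w \in D -> w != x -> w \notin T.
  by move=> wD wx; rewrite !inE (negPf wx) orbF; apply: comps_notin DS wD.
have subD w : w \in D -> component T w \subset D.
  move=> wD; apply: component_min => // a b aD ab _; rewrite !inE negb_or => /andP[bS _].
  exact: comps_step DS aD ab bS.
have [uT vT] := (outT _ uD ux, outT _ vD vx).
case: (boolP (v \in component T u)) => [vC|vC]; last first.
  have : #|[set component T u; component T v]| <= #|[set x]|.
    apply: (max_tough_part mS DS) => //; first by rewrite sub1set.
    - by apply/set0Pn; exists x; rewrite inE.
    - apply: sub_trivIset (comps_trivI T).
      by rewrite subUset !sub1set !mem_comps.
    move=> F /set2P[]->; split; try exact: subD;
    by apply: comps_island; rewrite mem_comps.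
  rewrite cards1 cards2; case: eqP => // e.
  by rewrite e component_refl in vC.
have CT := mem_comps uT.
have [a [b [aC aZ bC bZ ab]]] := comps_boundary CT (component_refl _ _) uZ vC vZ.
exists a, b; have sD := subsetP (subD _ uD).
by split; rewrite ?sD //; split=> //;
  [move: (comps_notin CT aC) | move: (comps_notin CT bC)]; rewrite !inE negb_or => /andP[].
Qed.

Hypothesis Gfree : K1P4_free G.
Hypothesis Gcrit : edges_critical G.

Lemma bridge_step t x y Y u v : bridge [set t] x y Y -> u \in Y -> u -- v -> v != t ->
  ~~ ((u == y) && (v == x)) -> v \in Y.
Proof.
case=> _ _ _ out uY uv vt; apply: contraNT => vY.
case: (out u v uY vY uv) => [/set1P /eqP|[-> ->]]; last by rewrite !eqxx.
by rewrite (negPf vt).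
Qed.

Lemma bridge_ends t x y Y : bridge [set t] x y Y ->
  [/\ x \notin Y, y \in Y, t \notin Y, x != t & y != t].
Proof.
case=> xYt yY dYt _; move: xYt; rewrite !inE negb_or => /andP[xY xt].
have tY : t \notin Y by rewrite disjoint_sym disjoints1 in dYt.
by split=> //; apply: contraNneq tY => <-.
Qed.

(** A component of [G - T] that misses the bridge and the cut vertex lies on one
    side, and so do its neighbours. *)
Lemma bridge_through T D t x y Y a b a' b' : D \in comps T -> bridge [set t] x y Y ->
  t \notin D -> x \notin D -> y \notin D -> a' \in D -> b' \in D ->
  a' -- a -> b' -- b -> b != t -> a \in Y -> b \in Y.
Proof.
move=> DT br tD xD yD a'D b'D a'a b'b bt aY.
have a'Y : a' \in Y.
  apply: (bridge_step br aY) => //; first by rewrite edge_sym.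
    by apply: contraNneq tD => <-.
  by apply: contra xD => /andP[_ /eqP<-].
have stepD u v : u \in Y -> u \in D -> u -- v -> v != t -> v \in Y.
  move=> uY uD uv vt; apply: (bridge_step br uY uv vt).
  by apply: contra yD => /andP[/eqP<-].
apply: (stepD b') => //; apply: contraT => b'Y.
have [u [v [uD uY vD vY uv]]] := comps_boundary DT a'D a'Y b'D b'Y.
by rewrite (stepD u) // in vY; apply: contraNneq tD => <-.
Qed.

Lemma tough2_nbr T D t : tough_set T -> #|T| = 2 -> D \in comps T -> t \in T ->
  exists2 d, d \in D & t -- d.
Proof.
move=> tT T2 DT tT'; have [O OT OD] := tough_other_comp G1 tT DT.
have [v [vT vO tv]] := tough_adj G1 tT tT' OT; exists v => //.
have cards : comps T = [set D; O].
  apply/esym/eqP; rewrite eqEcard subUset !sub1set DT OT /= (tough_card G1 tT) T2.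
  by rewrite cards2 eq_sym OD.
have := mem_comps vT; rewrite cards => /set2P[<-|e]; first exact: component_refl.
by rewrite -e component_refl in vO.
Qed.

(** ** All tough sets have two vertices *)

Section SmallToughSets.
Hypothesis small : forall T, tough_set T -> #|T| = 2.

Lemma small_max T : tough_set T -> max_tough T.
Proof. by move=> tT; split=> // T' tT'; rewrite !small. Qed.

(** By [leaf_star_extend], a critical edge that is not a bridge of some [G - t]
    is a whole component of [G - T]. *)
Lemma small_edge_cases x y : x -- y ->
  (exists t Y, bridge [set t] x y Y) \/
  (exists T, [/\ tough_set T, x \notin T, y \notin T,
     (forall v, x -- v -> v != y -> v \in T) & (forall v, y -- v -> v != x -> v \in T)]).
Proof.
move=> xy; case: (edge_cases G1 Gfree Gcrit xy) => [|[T [tT xT yT star]]]; first by left.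
right; exists T.
have sides a b : a \notin T -> b \notin T -> a -- b -> leaf_star T a b ->
    (forall v, a -- v -> v != b -> v \in T) /\ (forall v, b -- v -> v != a -> v \in T).
  move=> aT bT ab st; split=> v; last first.
    by move=> bv va; apply: contraNT va => vT; rewrite (st.1 v bv vT).
  move=> av vb; apply: contraT => vT.
  have vC : v \in component T a by apply: component_step (component_refl _ _) av aT vT.
  have va : v != a by rewrite eq_sym edge_neq.
  have /small := leaf_star_extend G1 tT aT bT ab st vC va vb.
  by rewrite cardsU1 aT (small tT).
case: star => st.
  by have [h1 h2] := sides x y xT yT xy st; split.
by have [h1 h2] := sides y x yT xT (etrans (edge_sym y x) xy) st; split.
Qed.

(** One vertex of a 2-vertex cut has a single neighbour in a big component:
    otherwise some edge between them is not critical. *)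
Lemma small_single_nbr T D : tough_set T -> D \in comps T -> 2 < #|D| ->
  exists a b d, [/\ T = [set a; b], a != b, d \in D, a -- d
    & forall w, w \in D -> a -- w -> w = d].
Proof.
move=> tT DT D3; have mT := small_max tT; have T2 := small tT.
have /cards2P[a [b [ab eT]]] : #|T| == 2 by rewrite T2.
have [aT bT] : a \in T /\ b \in T by rewrite eT !inE !eqxx orbT.
have [O OT OD] := tough_other_comp G1 tT DT.
have notinC C u : C \in comps T -> u \in T -> u \notin C.
  by move=> CT; apply: contraL; apply: comps_notin CT.
have [d dD ad] := tough2_nbr tT T2 DT aT.
have dT := comps_notin DT dD.
have [[t [Y br]]|[T' [tT' aT' dT' adjA adjD]]] := small_edge_cases ad; last first.
  have [w1 w1D w1d] := card2_other d (ltnW D3).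
  have [//||_ [n1 [_ /set1P-> n1D n1d dn1]]] := comps_boundary (Z := [set d]) DT dD _ w1D.
  - by rewrite inE.
  - by rewrite inE.
  rewrite inE in n1d; have [w [wD wd wn]] := card3_other d n1 D3.
  have dn : d != n1 by rewrite eq_sym.
  have [||p [q [_ qD /set1P-> qd [_ qn dq]]]] :=
    max_tough_boundary (Z := [set d]) mT DT n1D dD dn _ wD wn.
  - by rewrite inE.
  - by rewrite inE.
  rewrite inE in qd.
  have inT' z : z \in D -> d -- z -> z \in T'.
    move=> zD dz; apply: adjD => //.
    by apply: contraNneq (notinC _ _ DT aT) => <-.
  have eT' : T' = [set n1; q].
    apply/esym/eqP; rewrite eqEcard subUset !sub1set !inT' //= (small tT') cards2.
    by rewrite eq_sym qn.
  have [o oO ao] := tough2_nbr tT T2 OT aT.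
  have oD : o \notin D by apply: contra OD => oD; rewrite (comps_eq OT DT oO oD).
  have : o \in T' by apply: adjA => //; apply: contraNneq oD => ->.
  by rewrite eT' => /set2P[] e; rewrite e ?n1D ?qD in oD.
have [aY dY tY at' dt] := bridge_ends br.
have stepD u v : u \in D -> u \in Y -> u -- v -> v \in D -> v != t -> v \in Y.
  move=> uD uY uv vD vt; apply: (bridge_step br uY uv vt).
  by apply: contraNN (notinC _ _ DT aT) => /andP[_ /eqP<-].
have inY w : w \in D -> w != t -> w \in Y.
  move=> wD wt; apply: contraT => wY; case: (boolP (t \in D)) => tD.
    have [p [q [pD qD pY qY [pt qt pq]]]] :=
      max_tough_boundary mT DT tD dD dt dY wD wt wY.
    by rewrite (stepD p) in qY.
  have [p [q [pD pY qD qY pq]]] := comps_boundary DT dD dY wD wY.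
  by rewrite (stepD p) // in qY; apply: contraNneq tD => <-.
have adjA w : w \in D -> a -- w -> w != t -> w = d.
  move=> wD aw wt; apply/eqP; move: aY; apply: contraNT => wd.
  by apply: (bridge_step br (inY w wD wt)); rewrite ?(negPf wd) // edge_sym.
case: (boolP ((t \in D) && (a -- t))) => [/andP[tD at0]|nat]; last first.
  exists a, b, d; split=> // w wD aw; apply: adjA => //.
  by apply: contraNneq nat => <-; rewrite wD.
exists b, a, t; rewrite setUC eq_sym.
have [o1 o1O ao1] := tough2_nbr tT T2 OT aT.
have [o2 o2O bo2] := tough2_nbr tT T2 OT bT.
have tO : t \notin O by apply: contra OD => tO; rewrite (comps_eq OT DT tO tD).
have dO : d \notin O by apply: contra OD => dO; rewrite (comps_eq OT DT dO dD).
have bY : b \notin Y.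
  apply: contra aY => bY; apply: (bridge_through OT br tO _ dO o2O o1O _ _ at' bY).
  - exact: notinC OT aT.
  - by rewrite edge_sym.
  - by rewrite edge_sym.
have onlyt w : w \in D -> b -- w -> w = t.
  move=> wD bw; apply/eqP; apply: contraNT bY => wt.
  apply: (bridge_step br (inY w wD wt)); first by rewrite edge_sym.
    by apply: contraNneq (notinC _ _ DT bT) => ->.
  by rewrite [b == a]eq_sym (negPf ab) andbF.
have [w wD bw] := tough2_nbr tT T2 DT bT.
by split=> //; rewrite -(onlyt w wD bw).
Qed.

(** Replacing [a] by its only neighbour in a big component makes the component
    smaller, down to a triangle, and a triangle has a noncritical edge. *)
Lemma small_comps_le2 T D : tough_set T -> D \in comps T -> #|D| <= 2.
Proof.
have [n] := ubnP #|D|; elim: n T D => // n IH T D /ltnSE Dn tT DT.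
rewrite leqNgt; apply/negP => D3; have mT := small_max tT.
have [a [b [d [eT ab dD ad onlyd]]]] := small_single_nbr tT DT D3.
have [aT bT] : a \in T /\ b \in T by rewrite eT !inE !eqxx orbT.
have notinC C u : C \in comps T -> u \in T -> u \notin C.
  by move=> CT; apply: contraL; apply: comps_notin CT.
have [aD bD] := (notinC _ _ DT aT, notinC _ _ DT bT).
have [da db] : d != a /\ d != b by split; [apply: contraNneq aD | apply: contraNneq bD] => <-.
pose T1 := [set d; b]; pose D1 := D :\ d.
have cD1 : #|D| = #|D1|.+1 by rewrite (cardsD1 d) dD.
have outD1 u v : u \in D1 -> u -- v -> v \notin D1 -> v = d \/ v = b.
  move=> /setD1P[ud uD] uv vD1; case: (boolP (v \in D)) => vD.
    by left; apply/eqP; apply: contraNT vD1 => vd; rewrite !inE vd.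
  have : v \in T by apply: contraNT vD; apply: comps_step DT uD uv.
  rewrite eT => /set2P[e|]; last by right.
  by case/eqP: ud; apply: onlyd; rewrite // -e edge_sym.
have [x xD xd] := card2_other d (ltnW D3).
have isl1 : island T1 D1.
  split; first by apply/set0Pn; exists x; rewrite !inE xd.
    rewrite disjoint_sym disjoints_subset subUset !sub1set !inE eqxx /=.
    by rewrite (negPf bD) andbF.
  move=> u v uD1 uv; apply/orP; case: (boolP (v \in D1)) => vD1; [by left|right].
  by case: (outD1 u v uD1 uv vD1) => ->; rewrite !inE eqxx ?orbT.
have aT1 : a \notin T1 by rewrite !inE negb_or eq_sym da.
have aD1 : a \notin D1 by rewrite inE negb_and aD orbT.
have cT1 : #|T1| = 2 by rewrite cards2 db.
have tT1 : tough_set T1.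
  rewrite /tough_set cT1 /=; rewrite -(cards1 D1).
  apply: (card_islands_rest (s := a)) => //; first exact: trivIset1.
    by move=> F /set1P->.
  by apply: contra aD1 => /bigcupP[F /set1P->].
have [D4|D3'] := ltnP 3 #|D|.
  have xD1 : x \in D1 by rewrite !inE xd.
  have xT1 := island_notin isl1 xD1.
  have eD1 : component T1 x = D1.
    apply/eqP; rewrite eqEsubset (island_comp isl1 xD1) /=.
    apply/subsetP => v /setD1P[vd vD]; apply: contraT => vC.
    have [p [q [pD qD pC qC [pd qd pq]]]] :=
      max_tough_boundary mT DT dD xD xd (component_refl T1 x) vD vd vC.
    have outT1 w : w \in D -> w != d -> w \notin T1.
      by move=> wD wd; rewrite !inE negb_or wd; apply: contraNneq bD => <-.
    by rewrite (component_step pC pq) ?outT1 in qC.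
  have D1T1 : D1 \in comps T1 by rewrite -eD1 mem_comps.
  have D1n : #|D1| < n by rewrite -cD1.
  by have := IH T1 D1 D1n tT1 D1T1; rewrite leqNgt -ltnS -cD1 D4.
have cD : #|D| = 3 by apply/eqP; rewrite eqn_leq D3 D3'.
clear IH Dn x xD xd.
have [x [xD xd bx]] : exists x, [/\ x \in D, x != d & b -- x].
  suff /exists_inP[x /setD1P[xd xD] bx] : [exists x in D1, b -- x] by exists x.
  apply: contraT => /exists_inPn nb.
  have isl2 : island [set d] D1.
    case: isl1 => D10 _ _; split=> //; first by rewrite disjoint_sym disjoints1 !inE eqxx.
    move=> u v uD1 uv; apply/orP; case: (boolP (v \in D1)) => vD1; [by left|right].
    case: (outD1 u v uD1 uv vD1) => e; first by rewrite e inE.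
    by have := nb u uD1; rewrite edge_sym -e uv.
  have := rest_bound1 G1 (s := a) isl2; rewrite cards1 => /(_ _ aD1).
  by rewrite inE eq_sym da => /(_ isT).
have [y [yD yd yx]] := card3_other d x D3.
have eD w : w \in D -> [|| w == d, w == x | w == y].
  apply: contraLR; rewrite !negb_or => /and3P[wd wx wy]; apply/negP => wD.
  have : #|[set w; d; x; y]| <= #|D| by apply/subset_leq_card; rewrite !subUset !sub1set wD dD xD.
  rewrite cD -!setUA !cardsU1 cards1 !inE !negb_or wd wx wy.
  by rewrite [d == x]eq_sym xd [d == y]eq_sym yd eq_sym yx.
have tri z p q : z \in D -> p \in D -> q \in D -> z != p -> z != q -> p != q ->
    (forall w, w \in D -> [|| w == z, w == p | w == q]) -> p -- q.
  move=> zD pD qD zp zq pq all3.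
  have [pz pZ qz qZ] : [/\ p != z, p \in [set p], q != z & q \notin [set p]].
    by rewrite !inE eqxx ![_ == z]eq_sym [q == p]eq_sym.
  have [u [v [uD vD]]] := max_tough_boundary mT DT zD pD pz pZ qD qz qZ.
  rewrite !inE => /eqP-> vp [_ vz pv].
  by move: (all3 v vD); rewrite (negPf vp) (negPf vz) => /eqP <-.
have perm3 w : w \in D -> [|| w == y, w == d | w == x].
  by move/eD => /or3P[]->; rewrite ?orbT.
have perm3' w : w \in D -> [|| w == x, w == d | w == y].
  by move/eD => /or3P[]->; rewrite ?orbT.
have dx : d -- x by apply: (tri y); rewrite // eq_sym.
have dy : d -- y by apply: (tri x) => //; rewrite eq_sym.
have xy : x -- y by apply: (tri d) => //; rewrite eq_sym.
have [O OT OD] := tough_other_comp G1 tT DT.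
have notO z : z \in D -> z \notin O.
  by move=> zD; apply: contra OD => zO; rewrite (comps_eq OT DT zO zD).
have [o1 o1O ao1] := tough2_nbr tT (small tT) OT aT.
have [o2 o2O bo2] := tough2_nbr tT (small tT) OT bT.
have [[t [Y br]]|[T' [tT' _ _ adjd adjx]]] := small_edge_cases dx; last first.
  have : 2 < #|T'|; last by rewrite small.
  apply: (card_gt2 (x := a) (y := b) (z := y)) => //.
  - by apply: adjd; rewrite 1?edge_sym //; apply: contraNneq aD => ->.
  - by apply: adjx; rewrite 1?edge_sym // eq_sym.
  - exact: adjd.
  - by apply: contraNneq aD => ->.
  - by apply: contraNneq bD => ->.
have [dY xY tY dt xt] := bridge_ends br.
have et : t = y.
  apply/eqP; apply: contraNT dY => ty; have yt : y != t by rewrite eq_sym.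
  have yY : y \in Y by apply: (bridge_step br xY xy yt); rewrite (negPf yd) andbF.
  by apply: (bridge_step br yY) => //; rewrite 1?edge_sym // (negPf yx).
subst t; have [ay by'] : a != y /\ b != y.
  by split; [apply: contraNneq aD | apply: contraNneq bD] => ->.
have bY : b \in Y.
  by apply: (bridge_step br xY _ by'); rewrite 1?edge_sym // [b == d]eq_sym (negPf db) andbF.
have aY : a \in Y.
  apply: (bridge_through OT br _ _ _ o2O o1O _ _ ay bY); rewrite ?notO //;
  by rewrite edge_sym.
case/negP: dY; apply: (bridge_step br aY) => //.
by apply: contraNN aD => /andP[/eqP->].
Qed.

(** The edge lies on a cycle through either component, so it is no bridge of some
    [G - t]. If it formed a component of [G - T'], a vertex [v] behind the vertex
    [d] of [T'] would be cut off by [d] alone. *)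
Lemma small_nonadj a b : tough_set [set a; b] -> ~~ (a -- b).
Proof.
set T := [set a; b] => tT; apply/negP => ab; have T2 := small tT.
have [aT bT] : a \in T /\ b \in T by rewrite !inE !eqxx orbT.
have [C1 C1T] : exists C, C \in comps T.
  by apply/set0Pn; rewrite -card_gt0 (tough_card G1 tT) T2.
have [C2 C2T C21] := tough_other_comp G1 tT C1T.
have notinC C u : C \in comps T -> u \in T -> u \notin C.
  by move=> CT; apply: contraL; apply: comps_notin CT.
case: (small_edge_cases ab) => [[t [Y br]]|[T' [tT' aT' bT' adja adjb]]].
  have [aY bY _ at' _] := bridge_ends br.
  have [C CT tC] : exists2 C, C \in comps T & t \notin C.
    case: (boolP (t \in C1)) => tC; last by exists C1.
    by exists C2 => //; apply: contra C21 => tC2; rewrite (comps_eq C2T C1T tC2 tC).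
  have [a' a'C aa'] := tough2_nbr tT T2 CT aT.
  have [b' b'C bb'] := tough2_nbr tT T2 CT bT.
  case/negP: aY; apply: (bridge_through CT br tC _ _ b'C a'C _ _ at' bY);
    by rewrite ?(notinC _ _ CT) // edge_sym.
have [d dC1 ad] := tough2_nbr tT T2 C1T aT.
have db : d != b by apply: contraNneq (notinC _ _ C1T bT) => <-.
have dT' : d \in T' := adja d ad db.
have [v [vT' vC dv]] := tough_adj G1 tT' dT' (mem_comps aT').
have va : v != a by apply: contraNneq vC => ->; apply: component_refl.
have vb : v != b.
  by apply: contraNneq vC => ->; apply: component_step (component_refl _ _) ab aT' bT'.
have vT : v \notin T by rewrite !inE negb_or va.
have vC1 : v \in C1 := comps_step C1T dC1 dv vT.
have eC1 : C1 = [set d; v].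
  apply/esym/eqP; rewrite eqEcard subUset !sub1set dC1 vC1 cards2 (edge_neq dv).
  exact: small_comps_le2 tT C1T.
have isl : island [set d] [set v].
  split; first by apply/set0Pn; exists v; rewrite inE.
    by rewrite disjoints1 inE eq_sym (edge_neq dv).
  move=> u w /set1P-> vw; rewrite orbC; apply/orP; left.
  case: (boolP (w \in T)) => [/set2P[]ew|wT].
  - by case/negP: vT'; apply: adja => //; rewrite edge_sym -ew.
  - by case/negP: vT'; apply: adjb => //; rewrite edge_sym -ew.
  have := comps_step C1T vC1 vw wT; rewrite eC1 => /set2P[]ew; first by rewrite ew inE.
  by rewrite ew edge_irr in vw.
have da : a \notin [set d] by rewrite inE edge_neq.
by have := rest_bound1 G1 isl da; rewrite cards1 inE eq_sym va => /(_ isT).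
Qed.

(** As [x] is on a triangle with [ay], it would be the cut vertex or in the tough
    set. The path from [y] to [a] through [b] and the other component excludes the
    first case; in the second the tough set has three vertices. *)
Lemma small_path_ends a b D x y : tough_set [set a; b] -> D \in comps [set a; b] ->
  D = [set x; y] -> x -- y -> a -- x -> b -- y -> ~~ (a -- y).
Proof.
set T := [set a; b] => tT DT eD xy ax by'; apply/negP => ay; have T2 := small tT.
have [aT bT] : a \in T /\ b \in T by rewrite !inE !eqxx orbT.
have ab : a != b by move: T2; rewrite cards2; case: eqP.
have [O OT OD] := tough_other_comp G1 tT DT.
have notinC C u : C \in comps T -> u \in T -> u \notin C.
  by move=> CT; apply: contraL; apply: comps_notin CT.
have notO z : z \in D -> z \notin O.
  by move=> zD; apply: contra OD => zO; rewrite (comps_eq OT DT zO zD).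
have [xD yD] : x \in D /\ y \in D by rewrite eD !inE !eqxx orbT.
have [o1 o1O ao1] := tough2_nbr tT T2 OT aT.
have [o2 o2O bo2] := tough2_nbr tT T2 OT bT.
have neqD u v : u \in D -> v \in T -> u != v.
  by move=> uD; apply: contraTneq => <-; apply: comps_notin DT uD.
case: (small_edge_cases ay) => [[t [Y br]]|[T' [tT' _ _ adja adjy]]]; last first.
  have o1y : o1 != y by apply: contraTneq o1O => ->; apply: notO.
  have : 2 < #|T'|; last by rewrite small.
  apply: (card_gt2 (x := x) (y := b) (z := o1)).
  - by apply: adja => //; apply: edge_neq.
  - by apply: adjy; rewrite 1?edge_sym // eq_sym.
  - exact: adja.
  - exact: neqD.
  - by apply: contraTneq o1O => <-; apply: notO.
  - by apply: contraTneq o1O => <-; apply: notinC OT bT.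
have [aY yY tY at' yt] := bridge_ends br.
have et : t = x.
  apply/eqP; apply: contraNT aY => tx.
  have xY : x \in Y.
    apply: (bridge_step br yY); rewrite 1?edge_sym // 1?eq_sym //.
    by rewrite eqxx eq_sym neqD.
  by apply: (bridge_step br xY) => //; rewrite 1?edge_sym // (negPf (edge_neq xy)).
subst t; have bY : b \in Y.
  have nba : ~~ ((y == y) && (b == a)) by rewrite [b == a]eq_sym (negPf ab) andbF.
  by apply: (bridge_step br yY _ _ nba); [rewrite edge_sym | rewrite eq_sym neqD].
have [xO yO aO] : [/\ x \notin O, y \notin O & a \notin O].
  by split; [apply: notO | apply: notO | apply: notinC OT aT].
case/negP: aY; apply: (bridge_through OT br xO aO yO o2O o1O _ _ at' bY);
  by rewrite edge_sym.
Qed.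

(** Any other way to attach two vertices has a chord excluded by
    [small_path_ends], or a cut vertex. *)
Lemma small_piece a b D : tough_set [set a; b] -> D \in comps [set a; b] ->
  (exists d, [/\ D = [set d], a -- d & b -- d]) \/
  (exists x y, [/\ D = [set x; y], x -- y, a -- x, b -- y & ~~ (a -- y) /\ ~~ (b -- x)]).
Proof.
set T := [set a; b] => tT DT; have T2 := small tT.
have [aT bT] : a \in T /\ b \in T by rewrite !inE !eqxx orbT.
have [x xD ax] := tough2_nbr tT T2 DT aT.
have [w wD bw] := tough2_nbr tT T2 DT bT.
have [D2|D1] := ltnP 1 #|D|; last first.
  left; exists x; have eD : D = [set x].
    by apply/esym/eqP; rewrite eqEcard sub1set xD cards1.
  by split=> //; move: wD; rewrite eD => /set1P <-.
right; have [y yD yx] := card2_other x D2.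
have eD : D = [set x; y].
  apply/esym/eqP; rewrite eqEcard subUset !sub1set xD yD cards2 eq_sym yx.
  exact: small_comps_le2 tT DT.
have xy : x -- y.
  have [||u [v [_ /set1P-> vD vx]]] := comps_boundary (Z := [set x]) DT xD _ yD.
  - by rewrite inE.
  - by rewrite inE.
  by move: vD vx; rewrite eD !inE => /orP[->|/eqP->].
have finish x' y' : D = [set x'; y'] -> x' -- y' -> a -- x' -> b -- y' ->
    exists x y, [/\ D = [set x; y], x -- y, a -- x, b -- y & ~~ (a -- y) /\ ~~ (b -- x)].
  move=> eD' xy' ax' by'; exists x', y'; split=> //; split.
    exact: small_path_ends tT DT eD' xy' ax' by'.
  have eT : T = [set b; a] by rewrite /T setUC.
  rewrite eT in tT DT; apply: (small_path_ends tT DT (x := y')) => //.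
    by rewrite setUC.
  by rewrite edge_sym.
case: (boolP (b -- y)) => [by'|nby]; first exact: finish eD xy ax by'.
have bx : b -- x by move: wD bw; rewrite eD => /set2P[]-> //; rewrite (negPf nby).
apply: (finish y x); rewrite ?[y -- x]edge_sym //; first by rewrite setUC.
apply: contraT => nay.
have isl : island [set x] [set y].
  split; first by apply/set0Pn; exists y; rewrite inE.
    by rewrite disjoints1 inE.
  move=> u z /set1P-> yz; rewrite orbC; apply/orP; left.
  case: (boolP (z \in T)) => [/set2P[]ez|zT].
  - by rewrite -ez edge_sym yz in nay.
  - by rewrite -ez edge_sym yz in nby.
  have := comps_step DT yD yz zT; rewrite eD => /set2P[]ez; first by rewrite ez inE.
  by rewrite ez edge_irr in yz.
have ax' : a \notin [set x] by rewrite inE edge_neq.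
have ay : a \notin [set y].
  by rewrite inE; apply: contraTneq aT => ->; apply: comps_notin DT yD.
by have := rest_bound1 G1 isl ax' ay; rewrite cards1.
Qed.

Lemma small_cycle T : tough_set T -> isomorphic G (cycle_graph 4) \/
  isomorphic G (cycle_graph 5) \/ isomorphic G (cycle_graph 6).
Proof.
move=> tT; have T2 := small tT.
have /cards2P[a [b [ab eT]]] : #|T| == 2 by rewrite T2.
subst T; set T := [set a; b] in tT T2 *.
have [aT bT] : a \in T /\ b \in T by rewrite !inE !eqxx orbT.
have [D DT] : exists C, C \in comps T.
  by apply/set0Pn; rewrite -card_gt0 (tough_card G1 tT) T2.
have [O OT OD] := tough_other_comp G1 tT DT.
have allG v : [|| v == a, v == b, v \in D | v \in O].
  case: (boolP (v \in T)) => [/set2P[]->|vT]; rewrite ?eqxx ?orbT //.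
  have cT : comps T = [set D; O].
    apply/esym/eqP; rewrite eqEcard subUset !sub1set DT OT /= (tough_card G1 tT) T2.
    by rewrite cards2 eq_sym OD.
  by have := mem_comps vT; rewrite cT => /set2P[]<-; rewrite component_refl ?orbT.
have nab := small_nonadj tT.
have neqT u v C : C \in comps T -> u \in C -> v \in T -> u != v.
  by move=> CT uC; apply: contraTneq => <-; apply: comps_notin CT uC.
have neqC u v : u \in D -> v \in O -> u != v.
  move=> uD vO; apply: contraNneq OD => uv; rewrite uv in uD.
  by rewrite (comps_eq OT DT vO uD).
have nadj u v : u \in D -> v \in O -> ~~ (u -- v).
  by move=> uD vO; apply: (comps_nonadj DT OT) => //; rewrite eq_sym.
have distinct u v : [|| (u \in D) && (v \in O), (u \in D) && (v \in T),
    (u \in T) && (v \in D) | (u \in T) && (v \in O)] -> u != v.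
  case/or4P=> /andP[h1 h2]; first exact: neqC.
  - exact: neqT DT h1 h2.
  - by rewrite eq_sym; apply: neqT DT h2 h1.
  - by rewrite eq_sym; apply: neqT OT h2 h1.
case: (small_piece tT DT) => [[d [eD ad bd]]|[x [y [eD xy ax by' [nay nbx]]]]];
case: (small_piece tT OT) => [[e [eO ae be]]|[z [w [eO zw az bw [naw nbz]]]]];
  rewrite eD eO in allG.
- left; pose c := [:: a; d; b; e].
  have [dD eO'] : d \in D /\ e \in O by rewrite eD eO !inE !eqxx.
  apply: (isomorphic_cycle (x0 := a) (c := c)) => //.
  + by rewrite uniq_pairwise /= ?ab ?andbT //;
      do ?(apply/andP; split=> //); apply: distinct; rewrite ?aT ?bT ?dD ?eO' ?orbT.
  + by move=> v; move: (allG v); rewrite !inE => /or4P[]->; rewrite ?orbT.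
  + move=> [|[|[|[|i]]]] [|[|[|[|j]]]] //= _ _; try by [rewrite edge_sym];
    by apply/negbTE; try by [apply: nadj].
- right; left; pose c := [:: a; d; b; w; z].
  have [dD zO wO] : [/\ d \in D, z \in O & w \in O] by rewrite eD eO !inE !eqxx orbT.
  have wz : w != z by rewrite eq_sym edge_neq.
  apply: (isomorphic_cycle (x0 := a) (c := c)) => //.
  + by rewrite uniq_pairwise /= ?ab ?wz ?andbT //;
      do ?(apply/andP; split=> //); apply: distinct; rewrite ?aT ?bT ?dD ?zO ?wO ?orbT.
  + move=> v; move: (allG v); rewrite !inE.
    by case/or4P=> [->|->|->|/orP[]->]; rewrite ?orbT.
  + move=> [|[|[|[|[|i]]]]] [|[|[|[|[|j]]]]] //= _ _; try by [rewrite edge_sym];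
    by apply/negbTE; try by [apply: nadj].
- right; left; pose c := [:: a; x; y; b; e].
  have [eO' xD yD] : [/\ e \in O, x \in D & y \in D] by rewrite eD eO !inE !eqxx orbT.
  have xy' := edge_neq xy.
  apply: (isomorphic_cycle (x0 := a) (c := c)) => //.
  + by rewrite uniq_pairwise /= ?ab ?xy' ?andbT //;
      do ?(apply/andP; split=> //); apply: distinct; rewrite ?aT ?bT ?xD ?yD ?eO' ?orbT.
  + move=> v; move: (allG v); rewrite !inE.
    by case/or4P=> [->|->|/orP[]->|->]; rewrite ?orbT.
  + move=> [|[|[|[|[|i]]]]] [|[|[|[|[|j]]]]] //= _ _; try by [rewrite edge_sym];
    by apply/negbTE => //; try by [apply: nadj]; rewrite edge_sym.
- right; right; pose c := [:: a; x; y; b; w; z].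
  have [xD yD] : x \in D /\ y \in D by rewrite eD !inE !eqxx orbT.
  have [zO wO] : z \in O /\ w \in O by rewrite eO !inE !eqxx orbT.
  have [xy' wz] : x != y /\ w != z by rewrite eq_sym !edge_neq // edge_sym.
  apply: (isomorphic_cycle (x0 := a) (c := c)) => //.
  + by rewrite uniq_pairwise /= ?ab ?xy' ?wz ?andbT //;
      do ?(apply/andP; split=> //); apply: distinct;
      rewrite ?aT ?bT ?xD ?yD ?zO ?wO ?orbT.
  + move=> v; move: (allG v); rewrite !inE.
    by case/or4P=> [->|->|/orP[]->|/orP[]->]; rewrite ?orbT.
  + move=> [|[|[|[|[|[|i]]]]]] [|[|[|[|[|[|j]]]]]] //= _ _; try by [rewrite edge_sym];
    by apply/negbTE => //; try by [apply: nadj]; rewrite edge_sym.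
Qed.

End SmallToughSets.
End MaximumToughSet.

(** * A maximum tough set of at least three vertices *)

Section LargeToughSet.
Variable G : sgraph.
Implicit Types (a b u v w x y z s t d h : G) (T X Y Z F D C O H : {set G}).
Implicit Types (P R : {set {set G}}).

Hypothesis G1 : one_tough G.
Hypothesis Gfree : K1P4_free G.
Hypothesis Gcrit : edges_critical G.
Variable S : {set G}.
Hypothesis mS : max_tough S.
Hypothesis S3 : 2 < #|S|.

Let tS : tough_set S := mS.1.
Let cS : #|comps S| = #|S| := tough_card G1 tS.

Definition nbrs d := [set v | d -- v].

Definition nbr_comps X := [set D in comps S | [exists x in X, exists d in D, x -- d]].

Lemma nbr_compsP X D : reflect
  (exists x d, [/\ D \in comps S, x \in X, d \in D & x -- d]) (D \in nbr_comps X).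
Proof.
rewrite inE; apply: (iffP andP) => [[DS /exists_inP[x xX /exists_inP[d dD xd]]]|].
  by exists x, d.
case=> x [d [DS xX dD xd]]; split=> //.
by apply/exists_inP; exists x => //; apply/exists_inP; exists d.
Qed.

(** Components that do not meet the neighbourhood of [X] stay components when
    [X] is put back. *)
Lemma Hall X : X \subset S -> X != set0 -> X != S -> #|X| < #|nbr_comps X|.
Proof.
move=> XS X0 XnS; have cX : #|S :\: X| + #|X| = #|S|.
  by rewrite cardsD (setIidPr XS) subnK // subset_leq_card.
have ltXS : #|X| < #|S| by apply: proper_card; rewrite properEneq XnS.
pose P := comps S :\: nbr_comps X.
have cP : #|P| + #|nbr_comps X| = #|S|.
  rewrite cardsD (setIidPr _) ?cS ?subnK //.
    by rewrite -cS subset_leq_card //; apply/subsetP => D; rewrite inE => /andP[].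
  by apply/subsetP => D; rewrite inE => /andP[].
have [P0|P0] := posnP #|P|; first by move: cP; rewrite P0; lia.
have [x xX] := set0Pn _ X0; have xS := subsetP XS _ xX.
rewrite -(ltn_add2l #|P|) cP -cX ltn_add2r.
apply: (rest_bound G1 (s := x)) => //.
- exact: comps_sub_trivI (subsetDl _ _).
- move=> D /setDP[DS nD]; have [D0 dD out] := comps_island DS; split=> //.
    by apply: disjointWr dD; apply: subsetDl.
  move=> u v uD uv; case/orP: (out u v uD uv) => [-> //|vS].
  rewrite inE vS andbT; apply/orP; right; apply: contra nD => vX.
  by apply/nbr_compsP; exists v, u; rewrite edge_sym.
- by rewrite inE xX.
apply/negP => /(cover_compsP (subsetDl _ _))[].
by rewrite xS.
Qed.

(** Otherwise [s] is a cut vertex. *)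
Lemma not_only_nbr D s : D \in comps S -> s \in S ->
  exists s' d, [/\ s' \in S, s' != s, d \in D & s' -- d].
Proof.
move=> DS sS; suff /exists_inP[s' /setD1P[s's s'S] /exists_inP[d dD s'd]] :
    [exists s' in S :\ s, exists d in D, s' -- d] by exists s', d.
apply: contraT => /exists_inPn nadj.
have isl : island [set s] D.
  have [D0 dD out] := comps_island DS; split=> //.
    by apply: disjointWr dD; rewrite sub1set.
  move=> u v uD uv; case/orP: (out u v uD uv) => [-> //|vS]; rewrite inE.
  apply/orP; right; apply: contraT => vs.
  have /nadj/exists_inPn/(_ u uD) : v \in S :\ s by rewrite !inE vs.
  by rewrite edge_sym uv.
have [z [zS zD _]] := tough_other G1 tS DS.
have zs : z \notin [set s] by rewrite inE; apply: contraNneq zS => ->.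
by have := rest_bound1 G1 isl zs zD; rewrite cards1.
Qed.

Lemma third_comp D O : exists C, [/\ C \in comps S, C != D & C != O].
Proof. by apply: card3_other; rewrite cS. Qed.

(** Some edge [pq] of [D] has [s] adjacent to [p] only; then [q], [p], [s] and a
    neighbour [a] of [s] in another component form an induced [P_4], which must
    dominate. A third component removes the restriction that [v] lies outside the
    component of [a]. *)
Lemma partial_full s D x y v : s \in S -> D \in comps S -> x \in D -> y \in D ->
  s -- x -> ~~ (s -- y) -> v \notin S -> v \notin D -> s -- v.
Proof.
move=> sS DS xD yD sx nsy vS vD; apply: contraT => nsv.
have [||p [q [pD sp qD nsq pq]]] := comps_boundary (Z := nbrs s) DS xD _ yD.
- by rewrite inE.
- by rewrite inE.
rewrite !inE in sp nsq.
have path_dominates a z : a \notin S -> a \notin D -> s -- a -> z \notin S -> z \notin D ->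
    z \notin component S a -> s -- z.
  move=> aS aD sa zS zD za; apply: contraT => nsz; exfalso.
  have [AS ZS] := (mem_comps aS, mem_comps zS).
  have nD w : w \in D -> w \notin S -> forall u, u \notin S -> u \notin D -> ~~ (u -- w).
    move=> wD wS u uS uD; apply: (comps_nonadj (mem_comps uS) DS) => //.
      by apply: contraNneq uD => <-; apply: component_refl.
    exact: component_refl.
  have [pS qS] := (comps_notin DS pD, comps_notin DS qD).
  apply: (Gfree (p := a) (q := s) (r := p) (t := q) (z := z)) => //; rewrite ?(nD p) ?(nD q) //.
  - by rewrite edge_sym.
  - apply: (comps_nonadj ZS AS); rewrite ?component_refl //.
    by apply: contraNneq za => <-; apply: component_refl.
  - by rewrite edge_sym.
have [a [aS aD sa]] := tough_adj G1 tS sS DS; case/negP: nsv.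
case: (boolP (v \in component S a)) => va; last exact: path_dominates aS aD sa vS vD va.
have [C [CS CD Ca]] := third_comp D (component S a).
have [w wC] := comps_neq0 CS; have wS := comps_notin CS wC.
have wD : w \notin D by apply: contra CD => wD; rewrite (comps_eq CS DS wC wD).
have wa : w \notin component S a.
  by apply: contra Ca => wa; rewrite (comps_eq CS (mem_comps aS) wC wa).
apply: (path_dominates w) => //; first exact: path_dominates aS aD sa wS wD wa.
apply: contra wa => vw; rewrite component_sym in vw.
by rewrite -(component_eq va).
Qed.

(** Pieces of [H - T] in different components of [G - T] are bounded by the part
    of [T] in [H], as [S] is maximum. *)
Lemma pieces_bound T H P : H \in comps S -> P \subset comps T -> T :&: H != set0 ->
  (forall O, O \in P -> exists2 v, v \in O & v \in H) -> #|P| <= #|T :&: H|.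
Proof.
move=> HS /subsetP PT TH0 hit; pose f O := O :&: H.
have -> : #|P| = #|f @: P|.
  rewrite card_in_imset // => O O' OP O'P eO.
  have [v vO vH] := hit O OP; apply: (comps_eq (PT _ OP) (PT _ O'P) vO).
  have : v \in f O by rewrite inE vO.
  by rewrite eO inE => /andP[].
apply: (max_tough_part G1 mS HS) => //; first exact: subsetIr.
  apply: trivIsetI_of => A B v /imsetP[O OP ->] /imsetP[O' O'P ->].
  move=> /setIP[vO _] /setIP[vO' _].
  by rewrite (comps_eq (PT _ OP) (PT _ O'P) vO vO').
move=> F /imsetP[O OP ->]; split; last exact: subsetIr.
split.
- by have [v vO vH] := hit O OP; apply/set0Pn; exists v; rewrite inE vO.
- apply/pred0P => v /=; apply/negbTE/negP => /andP[/setIP[vO vH] /setUP[vS|/setIP[vT _]]].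
    by rewrite (negPf (comps_notin HS vH)) in vS.
  by rewrite (negPf (comps_notin (PT _ OP) vO)) in vT.
move=> u v /setIP[uO uH] uv; rewrite !inE.
case: (boolP (v \in S)) => vS; first by rewrite orbT.
rewrite (comps_step HS uH uv vS) !andbT /=.
by case: (boolP (v \in T)) => vT; rewrite ?orbT // (comps_step (PT _ OP) uO uv vT).
Qed.

(** ** No vertex of [S] is adjacent to all components *)

(** By [partial_full], a vertex of [S] adjacent to all components is adjacent to
    all vertices outside [S], except perhaps in a single component [H]. *)
Section FullVertex.
Variables (s : G) (H : {set G}).
Hypothesis sS : s \in S.
Hypothesis HS : H \in comps S.
Hypothesis sfull : forall v, v \notin S -> v \notin H -> s -- v.
Hypothesis sH : exists2 h, h \in H & s -- h.

Definition outer T := T :\: (S :|: H).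
Definition other_comps T := comps T :\ component T s.
Definition S_comps T := [set O in other_comps T | O \subset S].
Definition H_comps T := other_comps T :\: S_comps T.

(** All vertices outside [S] and [H] are adjacent to [s], so the other components
    of [G - T] lie in [S :|: H]. *)
Lemma in_H_comps T O : s \notin T -> O \in H_comps T ->
  [/\ O \in comps T, O != component T s, O \subset S :|: H & exists2 v, v \in O & v \in H].
Proof.
move=> sT /setDP[OT OS].
have {OS} OS : ~~ (O \subset S) by apply: contra OS => OS; rewrite inE OT OS.
case/setD1P: OT => OC OT.
have sub v : v \in O -> (v \in S) || (v \in H).
  move=> vO; apply: contraT; rewrite negb_or => /andP[vS vH].
  case/eqP: OC; apply: (comps_eq OT (mem_comps sT) vO).
  exact: component_step (component_refl _ _) (sfull vS vH) sT (comps_notin OT vO).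
split=> //; first by apply/subsetP => v /sub; rewrite inE.
case/subsetPn: OS => v vO vS; exists v => //.
by move: (sub v vO); rewrite (negPf vS).
Qed.

Lemma in_S_comps T O : O \in S_comps T ->
  [/\ O \in comps T, O != component T s & O \subset S].
Proof. by rewrite inE => /andP[/setD1P[OC OT] OS]. Qed.

Lemma S_comps_sub T : S_comps T \subset comps T.
Proof. by apply/subsetP => O /in_S_comps[]. Qed.

Lemma card_comps_split T : tough_set T -> s \notin T ->
  #|T| = #|S_comps T| + #|H_comps T| + 1.
Proof.
move=> tT sT; rewrite -(tough_card G1 tT) (cardsD1 (component T s)) mem_comps //.
have sub : S_comps T \subset other_comps T.
  by apply/subsetP => O; rewrite {1}/S_comps inE => /andP[].
rewrite -/(other_comps T) -[in LHS](setID (other_comps T) (S_comps T)) -/(H_comps T).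
rewrite (setIidPr sub) cardsU (_ : _ :&: _ = set0) ?cards0; first by rewrite subn0 addnC.
by apply/setP => O; rewrite in_setI in_setD in_set0; case: (O \in S_comps T).
Qed.

Lemma card_set_split T : #|T| = #|T :&: S| + #|T :&: H| + #|outer T|.
Proof.
rewrite -(cardsID (S :|: H) T) setIUr cardsU; congr (_ + _).
rewrite (_ : _ :&: _ :&: _ = set0) ?cards0 ?subn0 //.
apply/setP => v; rewrite !inE; apply/negbTE/negP => /andP[/andP[_ vS] /andP[_ vH]].
by rewrite (negPf (comps_notin HS vH)) in vS.
Qed.

Lemma card_H_comps T : s \notin T -> #|H_comps T| <= #|T :&: H|.
Proof.
move=> sT; have [TH0|TH0] := eqVneq (T :&: H) set0; last first.
  apply: pieces_bound => //; last by move=> O /(in_H_comps sT)[].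
  by apply/subsetP => O /(in_H_comps sT)[].
suff -> : H_comps T = set0 by rewrite cards0.
apply/eqP; apply: contraT => /set0Pn[O /(in_H_comps sT)[OT OC _ [v vO vH]]].
have noT w : w \in H -> w \notin T.
  by move=> wH; apply/negP => wT; have := in_set0 w; rewrite -TH0 inE wT wH.
have [h hH sh] := sH; have hO : h \notin O.
  apply: contra OC => hO; apply/eqP/(comps_eq OT (mem_comps sT) hO).
  exact: component_step (component_refl _ _) sh sT (noT h hH).
have [p [q [pH pO qH qO pq]]] := comps_boundary HS vH vO hH hO.
by rewrite (comps_step OT pO pq (noT q qH)) in qO.
Qed.

(** Strict when the component of [s] also contains a piece of [H]. *)
Lemma card_H_comps_lt T h : s \notin T -> h \in H -> h \in component T s ->
  H_comps T != set0 -> #|H_comps T| < #|T :&: H|.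
Proof.
move=> sT hH hC; rewrite -card_gt0 => H0.
have TH0 : T :&: H != set0 by rewrite -card_gt0; apply: leq_trans H0 (card_H_comps sT).
have CH : component T s \notin H_comps T.
  by apply/negP => /(in_H_comps sT)[_ /eqP].
have -> : (#|H_comps T|).+1 = #|component T s |: H_comps T| by rewrite cardsU1 CH.
apply: pieces_bound => //.
  apply/subsetP => O /setU1P[->|/(in_H_comps sT)[]//]; exact: mem_comps.
by move=> O /setU1P[->|/(in_H_comps sT)[]//]; exists h.
Qed.

Lemma S_comps_nbr T D : s \notin T -> D \in nbr_comps (cover (S_comps T)) -> D != H ->
  exists2 x, x \in D & x \in T.
Proof.
move=> sT /nbr_compsP[x [d [DS /bigcupP[O /in_S_comps[OT OC OS] xO] dD xd]]] DH.
exists d => //; apply: contraT => dT; case/eqP: OC.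
have dO := comps_step OT xO xd dT; apply: (comps_eq OT (mem_comps sT) dO).
apply: component_step (component_refl _ _) _ sT dT; apply: sfull (comps_notin DS dD) _.
by apply: contra DH => dH; rewrite (comps_eq DS HS dD dH).
Qed.

Lemma cover_S_comps T : s \notin T ->
  [/\ cover (S_comps T) \subset S, cover (S_comps T) \subset S :\ s
    & [disjoint cover (S_comps T) & T]].
Proof.
move=> sT; have sub : cover (S_comps T) \subset S :\ s.
  apply/bigcupsP => O /in_S_comps[OT OC OS]; apply/subsetP => v vO.
  rewrite !inE (subsetP OS) // andbT; apply: contraNneq OC => vs; apply/eqP.
  by apply: (comps_eq OT (mem_comps sT) vO); rewrite vs component_refl.
split=> //; first exact: subset_trans sub (subD1set _ _).
apply/pred0P => v /=; apply/negbTE/negP => /andP[/(cover_compsP (S_comps_sub _))[]].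
by move/negP.
Qed.

Lemma card_cover_S_comps T : #|S_comps T| <= #|cover (S_comps T)|.
Proof.
apply: card_cover_ge; first exact: comps_sub_trivI (S_comps_sub _).
by move=> O /in_S_comps[/comps_island[]].
Qed.

(** [T] meets each component next to the [S_comps], and by [Hall] there are many
    of them. *)
Lemma outer_bound T D : s \notin T -> D \in comps S -> D != H ->
  #|T :&: D| + #|S_comps T| <= #|outer T| + 1 /\ #|S_comps T| <= #|outer T|.
Proof.
move=> sT DS DH; have subD (C : {set G}) : C \in comps S -> C != H -> T :&: C \subset outer T.
  move=> CS CH; apply/subsetP => v /setIP[vT vC]; rewrite !inE vT andbT negb_or.
  rewrite (comps_notin CS vC) /=; apply: contra CH => vH.
  by rewrite (comps_eq CS HS vC vH).
have [e|ne] := eqVneq (S_comps T) set0.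
  by rewrite e cards0 addn0; have := subset_leq_card (subD D DS DH); split; lia.
have [XS XSs _] := cover_S_comps sT; have X0 : cover (S_comps T) != set0.
  by rewrite -card_gt0; apply: leq_trans (card_cover_S_comps T); rewrite card_gt0.
have XnS : cover (S_comps T) != S.
  by apply: contraTneq sS => <-; apply/negP => /(subsetP XSs); rewrite !inE eqxx.
have hall := leq_ltn_trans (card_cover_S_comps T) (Hall XS X0 XnS).
pose N := nbr_comps (cover (S_comps T)) :\ H.
have inN C : C \in N -> [/\ C \in comps S, C != H & exists2 x, x \in C & x \in T].
  case/setD1P=> CH CN; split=> //; last exact: S_comps_nbr sT CN CH.
  by case/nbr_compsP: CN => x [d []].
have tN P : P \subset N -> trivIset P.
  move=> PN; apply: (comps_sub_trivI (T := S)); apply: subset_trans PN _.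
  by apply/subsetP => C /inN[].
have hitN P : P \subset N -> #|P| <= #|T :&: cover P|.
  move=> PN; apply: card_hit (tN P PN) _ => C /(subsetP PN)/inN[_ _ //].
have coverN P : P \subset N -> T :&: cover P \subset outer T.
  move=> PN; apply/subsetP => v /setIP[vT /bigcupP[C /(subsetP PN)/inN[CS CH _] vC]].
  by apply: (subsetP (subD C CS CH)); rewrite inE vT.
have cN : #|S_comps T| <= #|N|.
  by rewrite -ltnS; apply: leq_trans hall _; rewrite -addn1; apply: card_leD1.
have N0 : #|S_comps T| <= #|outer T|.
  apply: leq_trans cN (leq_trans (hitN _ (subxx N)) _).
  exact: subset_leq_card (coverN _ (subxx N)).
split=> //; have ND : N :\ D \subset N := subD1set _ _.
have cND : #|N| <= #|N :\ D| + 1 by apply: card_leD1.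
have dis : (T :&: D) :&: (T :&: cover (N :\ D)) = set0.
  apply/setP => v; rewrite !inE; apply/negbTE/negP => /andP[/andP[_ vD] /andP[_ vN]].
  case/bigcupP: vN => C /setD1P[CD /inN[CS _ _]] vC; case/eqP: CD.
  exact: comps_eq CS DS vC vD.
have : #|(T :&: D) :|: (T :&: cover (N :\ D))| <= #|outer T|.
  by apply: subset_leq_card; rewrite subUset subD //= coverN.
rewrite cardsU dis cards0 subn0 => le.
apply: leq_trans (leq_add (leqnn _) (leq_trans cN cND)) _.
by rewrite addnA leq_add2r; apply: leq_trans le; rewrite leq_add2l; apply: hitN.
Qed.

Section OuterVertex.
Variable d : G.
Hypotheses (dS : d \notin S) (dH : d \notin H).
Let D := component S d.
Let DS : D \in comps S := mem_comps dS.
Let sd : s -- d := sfull dS dH.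

Lemma outer_comp_neq : D != H.
Proof. by apply: contraNneq dH => <-; apply: component_refl. Qed.

Lemma outer_nbrs v : d -- v -> v \notin S -> v \in D /\ v \notin H.
Proof.
move=> dv vS; have vD : v \in D := comps_step DS (component_refl _ _) dv vS.
by split=> //; apply: contra outer_comp_neq => vH; rewrite (comps_eq DS HS vD vH).
Qed.

(** The side of [d] contains at most one vertex of [S], since such vertices are
    adjacent only to the components of [d] and of [t]. *)
Lemma outer_bridge_degree t Y : bridge [set t] s d Y -> #|nbrs d| <= 2.
Proof.
move=> br; have [sY dY tY st dt] := bridge_ends br.
have step u v : u \in Y -> u -- v -> v != t -> u != d -> v \in Y.
  by move=> uY uv vt ud; apply: (bridge_step br uY uv vt); rewrite (negPf ud).
have Yout v : v \in Y -> v \notin S -> v \notin H -> v = d.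
  move=> vY vS vH; apply/eqP; apply: contraNT sY => vd.
  by apply: (step v); rewrite // edge_sym sfull.
have YH h : h \in Y -> h \in H -> t \in H.
  move=> hY hH; apply: contraT => tH; have [h0 h0H sh0] := sH.
  have neqd v : v \in H -> v != d by apply: contraTneq => ->.
  have h0Y : h0 \notin Y.
    by apply: contra sY => h0Y; apply: (step h0); rewrite 1?edge_sym ?neqd.
  have [p [q [pH pY qH qY pq]]] := comps_boundary HS hH hY h0H h0Y.
  case/negP: qY; apply: (step p); rewrite ?neqd //.
  by apply: contraNneq tH => <-.
have nbrY v : d -- v -> v != s -> v != t -> v \in Y.
  by move=> dv vs vt; apply: (bridge_step br dY dv vt); rewrite eqxx.
have nbrS v : d -- v -> v != s -> v != t -> v \in S :&: Y.
  move=> dv vs vt; rewrite inE nbrY // andbT; apply: contraT => vS.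
  have [vD vH] := outer_nbrs dv vS; case/eqP: (edge_neq dv); apply/esym.
  exact: Yout (nbrY v dv vs vt) vS vH.
have [SY0|/set0Pn[s1 s1SY]] := eqVneq (S :&: Y) set0.
  apply: (card_le2 (x := s) (y := t)); apply/subsetP => v; rewrite !inE => dv.
  apply: contraT; rewrite negb_or => /andP[vs vt].
  by have := nbrS v dv vs vt; rewrite SY0 inE.
have nbrD u C : u \in S :&: Y -> C \in nbr_comps [set u] ->
    C = D \/ (t \notin S /\ C = component S t).
  move=> /setIP[uS uY] /nbr_compsP[_ [x [CS /set1P-> xC ux]]].
  have [xS eC] := compsP CS xC; have ud : u != d by apply: contraNneq dS => <-.
  have [ext|xt] := eqVneq x t; first by right; rewrite -ext.
  have xY := step _ _ uY ux xt ud; case: (boolP (x \in H)) => xH; last first.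
    by left; rewrite eC (Yout x xY xS xH).
  have tH := YH x xY xH; right; split; first exact: comps_notin HS tH.
  by rewrite (comps_eq CS HS xC xH); case: (compsP HS tH).
have NB U C : C \in nbr_comps U -> exists2 w, w \in U & C \in nbr_comps [set w].
  case/nbr_compsP=> w [x [CS wu xC wx]]; exists w => //.
  by apply/nbr_compsP; exists w, x; rewrite inE.
have notall X : X \subset S :&: Y -> X != S.
  move=> XS; apply: contraTneq sS => <-; apply/negP => /(subsetP XS)/setIP[_].
  by rewrite (negPf sY).
have hallY X : X \subset S :&: Y -> X != set0 ->
    #|X| < #|[set C in [set D; component S t] | (C == D) || (t \notin S)]|.
  move=> XS X0; apply: leq_trans (Hall _ X0 (notall _ XS)) (subset_leq_card _).
    exact: subset_trans XS (subsetIl _ _).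
  apply/subsetP => C /NB[w wX /(nbrD w _ (subsetP XS _ wX))]; rewrite !inE.
  by case=> [->|[-> ->]]; rewrite ?eqxx ?orbT.
have uniqY s2 : s2 \in S :&: Y -> s2 = s1.
  move=> s2SY; apply/eqP; apply: contraT => s21.
  have := hallY [set s2; s1]; rewrite subUset !sub1set s1SY s2SY cards2 s21.
  move=> /(_ isT); rewrite -card_gt0 cards2 s21 => /(_ isT).
  rewrite ltnNge (card_le2 (x := D) (y := component S t)) //.
  by apply/subsetP => C; rewrite inE => /andP[].
have : 1 < #|[set C in [set D; component S t] | (C == D) || (t \notin S)]|.
  by have := hallY [set s1]; rewrite sub1set s1SY -card_gt0 cards1; apply.
move=> two; have tSD : (t \notin S) && (component S t != D).
  move: two; rewrite ltnNge; apply: contraR; rewrite negb_and negbK => h.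
  rewrite -(cards1 D); apply/subset_leq_card/subsetP => C; rewrite !inE.
  by case/orP: h => [->|/negbNE/eqP->]; rewrite ?orbb ?orbF => /andP[].
have ndt : ~~ (d -- t).
  case/andP: tSD => tS'; apply: contra => dt'.
  by have [tD _] := outer_nbrs dt' tS'; rewrite (component_eq tD).
apply: (card_le2 (x := s) (y := s1)); apply/subsetP => v; rewrite !inE => dv.
have [//|vs] := eqVneq v s; have vt : v != t by apply: contraNneq ndt => <-.
by rewrite (uniqY v (nbrS v dv vs vt)) eqxx.
Qed.

(** If [s] is the leaf, then [T] contains the rest of all components other than
    [H]; as [d] has few neighbours outside [S], a third neighbour would force the
    [H_comps] to be separated by [T :&: H] alone. *)
Lemma outer_center_degree T : tough_set T -> s \notin T -> d \notin T ->
  leaf_star T d s -> #|nbrs d| <= 2.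
Proof.
move=> tT sT dT [leaf star]; have DH := outer_comp_neq.
have eC : component T d = component T s.
  by apply: component_eq; apply: component_step (component_refl _ _) sd sT dT.
rewrite eC in star; set C := component T s in star.
have CT : C \in comps T := mem_comps sT.
have CH v : v \in C -> v \notin H.
  move=> vC; apply/negP => vH; have vd : v != d by apply: contraTneq vH => ->.
  by have [_] := outer_nbrs (star v vC vd) (comps_notin HS vH); rewrite vH.
have outT v : v \notin S -> v \notin H -> v != d -> v \in T.
  by move=> vS vH vd; apply: contraNT vd => vT; apply/eqP/leaf; rewrite ?sfull.
have [XS _ dXT] := cover_S_comps sT; set X := cover (S_comps T) in XS dXT.
have dCX u : u \in C -> u \notin X.
  move=> uC; apply/negP => /bigcupP[O /in_S_comps[OT OC _] uO].
  by case/eqP: OC; apply: comps_eq OT CT uO uC.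
have dCT u : u \in C -> u \notin T := comps_notin CT.
have dTX : (T :&: S) :&: X = set0.
  apply/setP => v; rewrite !inE; apply/negbTE/negP => /andP[/andP[vT _] vX].
  by rewrite (disjointFr dXT vX) in vT.
have dC : (C :&: S) :&: ((T :&: S) :|: X) = set0.
  apply/setP => v; rewrite in_setI in_set0; apply/negbTE/negP => /andP[/setIP[vC _]].
  by rewrite !in_setU in_setI (negPf (dCT v vC)) (negPf (dCX v vC)).
have leS : #|C :&: S| + (#|T :&: S| + #|X|) <= #|S|.
  rewrite -[#|T :&: S| + _]subn0 -(cards0 G) -dTX -cardsU -[_ + _]subn0 -(cards0 G) -dC -cardsU.
  by apply: subset_leq_card; rewrite !subUset !subsetIr XS.
have deg : #|nbrs d| <= #|C :&: S| + #|T :&: S| + #|D :\ d|.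
  apply: leq_trans (leq_add (card_setU_le _ _) (leqnn _)).
  apply: leq_trans (card_setU_le _ _); apply/subset_leq_card/subsetP => v.
  rewrite inE => dv; rewrite !in_setU !in_setI in_setD1 eq_sym (edge_neq dv) /=.
  case: (boolP (v \in S)) => vS; last by have [-> _] := outer_nbrs dv vS; rewrite orbT.
  case: (boolP (v \in T)) => vT; rewrite ?orbT // andbT orbF; apply/orP; left.
  by rewrite /C -eC; apply: component_step (component_refl _ _) dv dT vT.
pose P := comps S :\ H :\ D.
have PS : P \subset comps S := subset_trans (subD1set _ _) (subD1set _ _).
have cP : #|S| <= #|P| + 2.
  have := leq_trans (card_leD1 (comps S) H) (leq_add (card_leD1 _ D) (leqnn 1)).
  by rewrite cS -addnA.
have inP O v : O \in P -> v \in O -> [/\ v \notin S, v \notin H, v \notin D & v \in T].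
  move=> /setD1P[OD /setD1P[OH OS]] vO; have vS := comps_notin OS vO.
  have vH : v \notin H by apply: contra OH => vH; rewrite (comps_eq OS HS vO vH).
  have vD : v \notin D by apply: contra OD => vD; rewrite (comps_eq OS DS vO vD).
  by split=> //; apply: outT => //; apply: contraNneq vD => ->; apply: component_refl.
have leo : #|P| + #|D :\ d| <= #|outer T|.
  have hitP : #|P| <= #|T :&: cover P|.
    apply: card_hit (comps_sub_trivI PS) _ => O OP.
    have [v vO] := comps_neq0 (subsetP PS _ OP); exists v => //.
    by have [] := inP O v OP vO.
  apply: leq_trans (leq_add hitP (leqnn _)) _.
  have dis : (T :&: cover P) :&: (D :\ d) = set0.
    apply/setP => v; rewrite in_setI in_set0; apply/negbTE/negP.
    case/andP=> [/setIP[_ /bigcupP[O OP vO]] /setD1P[_ vD]].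
    by have [_ _ /negP] := inP O v OP vO.
  rewrite -[_ + _]subn0 -(cards0 G) -dis -cardsU; apply/subset_leq_card.
  rewrite subUset; apply/andP; split; apply/subsetP => v.
    case/setIP=> vT /bigcupP[O OP vO]; have [vS vH _ _] := inP O v OP vO.
    by rewrite !inE negb_or vS vH.
  case/setD1P=> vd vD; have vS := comps_notin DS vD.
  have vH : v \notin H by apply: contra DH => vH; rewrite (comps_eq DS HS vD vH).
  by rewrite !inE negb_or vS vH outT.
have cT := card_comps_split tT sT; rewrite (card_set_split T) in cT.
have cH := card_H_comps sT; have cX := card_cover_S_comps T; rewrite -/X in cX.
rewrite leqNgt; apply/negP => deg3.
(* A third neighbour of [d] makes all the estimates above tight. *)
have [tS0 gH lS] : [/\ #|T :&: S| = 0, #|H_comps T| = #|T :&: H|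
    & #|S| <= #|C :&: S| + #|X|].
  clear - leS deg cP leo cT cH cX deg3.
  move: #|C :&: S| #|T :&: S| #|X| #|S| #|nbrs d| #|D :\ d| #|P| #|outer T|
    #|S_comps T| #|H_comps T| #|T :&: H| leS deg cP leo cT cH cX deg3.
  by move=> c t x k q e p o a g i *; split; lia.
have eS : S = (C :&: S) :|: X.
  apply/eqP; rewrite eq_sym eqEcard subUset subsetIr XS /= cardsU.
  rewrite (_ : _ :&: X = set0) ?cards0 ?subn0 //; apply/setP => v.
  by rewrite in_setI in_set0; apply/negbTE/negP => /andP[/setIP[/dCX/negP]].
have [h hH sh] := sH.
have hT : h \in T.
  by apply: contraT => hT; case/negP: dH; rewrite -(leaf h sh hT).
have gt0 : 0 < #|H_comps T|.
  by rewrite gH card_gt0; apply/set0Pn; exists h; rewrite inE hT.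
have : #|H_comps T| < #|T :&: H|; last by rewrite gH ltnn.
apply: (rest_bound G1 (s := s)) => //.
- by apply: (comps_sub_trivI (T := T)); apply/subsetP => O /(in_H_comps sT)[].
- move=> O OH; have [OT OC OSH [w wO wH]] := in_H_comps sT OH.
  have [O0 dO out] := comps_island OT; split=> //.
    by apply: disjointWr dO; apply: subsetIl.
  move=> u v uO uv; case/orP: (out u v uO uv) => [-> //|vT]; rewrite !inE vT /=.
  have vS : v \notin S.
    by apply/negP => vS; have := in_set0 v; rewrite -(cards0_eq tS0) inE vT vS.
  have uH : u \in H.
    move: (subsetP OSH u uO); rewrite inE => /orP[|//]; rewrite eS => /setUP[/setIP[uC _]|].
      by case/eqP: OC; apply: comps_eq OT CT uO uC.
    case/(cover_compsP (S_comps_sub T)) => _; have [_ <-] := compsP OT uO.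
    by move: OH => /setDP[_ /negP].
  by rewrite (comps_step HS uH uv vS) orbT.
- by rewrite inE (negPf sT).
apply/negP => /bigcupP[O /(in_H_comps sT)[OT /eqP OC _ _] sO].
by apply: OC; apply: comps_eq OT CT sO (component_refl _ _).
Qed.

(** All other neighbours of the leaf [d] lie in [T], and comparing [T] with the
    components of [G - T] leaves room for few of them. *)
Lemma outer_leaf_nbrs T : tough_set T -> s \notin T -> d \notin T -> leaf_star T s d ->
  [\/ #|nbrs d| <= 2, (forall v, v \in S -> d -- v -> v = s) |
    exists t d', [/\ t \in T :&: S, T :&: S = [set t], d' \in T :&: D,
      nbrs d \subset [set s; t; d']
      & forall O, O \in comps S -> O != H -> #|T :&: O| <= 1]].
Proof.
move=> tT sT dT [leaf _]; have DH := outer_comp_neq.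
have sub : nbrs d \subset s |: ((T :&: S) :|: (T :&: D)).
  apply/subsetP => v; rewrite inE => dv; rewrite !in_setU !in_setI in_set1.
  case: (boolP (v \in T)) => vT; last by rewrite (leaf v dv vT) eqxx.
  by case: (boolP (v \in S)) => vS; rewrite ?orbT //= (proj1 (outer_nbrs dv vS)) !orbT.
have cT := card_comps_split tT sT; rewrite (card_set_split T) in cT.
have cH := card_H_comps sT.
have [TS0|] := eqVneq (T :&: S) set0.
  constructor 2 => v vS dv; apply: leaf => //; apply/negP => vT.
  by have := in_set0 v; rewrite -TS0 inE vT vS.
rewrite -card_gt0 => TS1.
have small O : O \in comps S -> O != H -> #|T :&: O| <= 1 /\ #|T :&: S| = 1.
  move=> OS OH; have [b1 b2] := outer_bound sT OS OH.
  clear - b1 b2 TS1 cT cH.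
  move: #|T :&: O| #|S_comps T| #|outer T| #|T :&: S| #|T :&: H| #|H_comps T|
     b1 b2 TS1 cT cH => x a o t h g *; split; lia.
have [TD1 /eqP/cards1P[t eTS]] := small D DS DH.
have [TD0|/set0Pn[d' d'TD]] := eqVneq (T :&: D) set0.
  constructor 1; apply: (card_le2 (x := s) (y := t)); apply: subset_trans sub _.
  by rewrite eTS TD0 setU0.
have eTD : T :&: D = [set d'].
  by apply/esym/eqP; rewrite eqEcard sub1set d'TD cards1.
constructor 3; exists t, d'; split=> //.
- by rewrite eTS inE.
- by apply: subset_trans sub _; rewrite eTS eTD setUA.
by move=> O OS OH; have [] := small O OS OH.
Qed.

End OuterVertex.

Lemma outer_cases d : d \notin S -> d \notin H ->
  [\/ #|nbrs d| <= 2, (forall v, v \in S -> d -- v -> v = s) |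
    exists T t d', [/\ tough_set T, s \notin T, d \notin T, t \in T :&: S &
      [/\ d' \in T :&: component S d, nbrs d \subset [set s; t; d']
        & forall O, O \in comps S -> O != H -> #|T :&: O| <= 1]]].
Proof.
move=> dS dH; have sd := sfull dS dH.
case: (edge_cases G1 Gfree Gcrit sd) => [[t [Y br]]|[T [tT sT dT [st|st]]]].
- by constructor 1; apply: outer_bridge_degree br.
- case: (outer_leaf_nbrs dS dH tT sT dT st) => [||[t [d' [tTS _ d'T sub le1]]]].
  + by constructor 1.
  + by constructor 2.
  + by constructor 3; exists T, t, d'.
- by constructor 1; apply: outer_center_degree st.
Qed.

(** In the third case of [outer_cases] the component of [d] is an edge, and both
    [d] and [d'] have a partial neighbour in [S]; these see all of a third
    component, whose vertices fit none of the three cases. *)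
Lemma outer_degree d : d \notin S -> d \notin H ->
  #|nbrs d| <= 2 \/ (forall v, v \in S -> d -- v -> v = s).
Proof.
move=> dS dH; have DS := mem_comps dS; have sd := sfull dS dH.
case: (outer_cases dS dH) => [|| [T [t [d' [tT sT dT]]]]]; [by left|by right|].
move=> /setIP[tT' tS'] [/setIP[d'T d'D] sub le1]; set D := component S d in DS d'D.
have dD : d \in D := component_refl _ _.
have nd v : d -- v -> [|| v == s, v == t | v == d'].
  by move=> dv; have := subsetP sub v; rewrite !inE -orbA; apply.
case: (boolP (d -- t)) => [dt|ndt]; last first.
  left; apply: (card_le2 (x := s) (y := d')); apply/subsetP => v; rewrite !inE => dv.
  case/or3P: (nd v dv) => [->//|/eqP e|->]; last by rewrite orbT.
  by rewrite -e dv in ndt.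
have notS v u : v \in D -> u \in S -> v != u.
  by move=> vD; apply: contraTneq => <-; apply: comps_notin DS vD.
have d'd : d' != d by apply: contraNneq dT => <-.
have nbD v : d -- v -> v \in D -> v = d'.
  move=> dv vD; move: (nd v dv).
  by rewrite (negPf (notS _ _ vD sS)) (negPf (notS _ _ vD tS')) => /eqP.
have onlyD v : v \in D -> v != d -> v = d'.
  move=> vD vd; apply/eqP; apply: contraT => vd'.
  have [|||p [q [_ qD /set1P-> _ [_ qd' dq]]]] :=
    max_tough_boundary (Z := [set d]) G1 mS DS d'D dD _ _ vD vd'.
  - by rewrite eq_sym.
  - by rewrite inE.
  - by rewrite inE.
  by rewrite (nbD q dq qD) eqxx in qd'.
have dd' : d -- d'.
  have [||p [q [_ /set1P-> qD qd dq]]] := comps_boundary (Z := [set d]) DS dD _ d'D.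
  - by rewrite inE.
  - by rewrite inE.
  by rewrite -(nbD q dq qD).
have d'S := comps_notin DS d'D.
have DH : D != H by apply: contraNneq dH => <-.
have d'H : d' \notin H by apply: contra DH => d'H; rewrite (comps_eq DS HS d'D d'H).
have sd' := sfull d'S d'H; have CT := mem_comps sT.
have sC := component_refl T s; have dC := component_step sC sd sT dT.
have [t' [t'T t'C d't']] := tough_adj G1 tT d'T CT.
have t's : t' != s by apply: contraNneq t'C => ->.
have t'd : t' != d by apply: contraNneq t'C => ->.
have t'S : t' \in S.
  apply: contraT => t'S; have t'D := comps_step DS d'D d't' t'S.
  by rewrite (onlyD t' t'D t'd) d'T in t'T.
have nd' v : d' -- v -> [|| v == s, v == t' | v == d].
  case: (outer_cases d'S d'H) => [le2|onlys|].
  - have := card_gt2 (A := nbrs d') (x := s) (y := t') (z := d).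
    rewrite !inE ![d' -- _]edge_sym sd' [t' -- _]edge_sym d't' dd' ltnNge le2.
    rewrite [s == t']eq_sym t's [s == d]eq_sym (notS d s dD sS) t'd.
    by move=> /(_ isT isT isT isT isT isT).
  - by rewrite (onlys t' t'S d't') eqxx in t's.
  case=> T2 [t2 [d2 [_ _ d'T2 /setIP[_ t2S] [/setIP[d2T2 d2D] sub2 _]]]] d'v.
  have nd2 w : d' -- w -> [|| w == s, w == t2 | w == d2].
    by move=> dw; have := subsetP sub2 w; rewrite !inE -orbA; apply.
  rewrite (component_eq d'D) -/D in d2D.
  have ed2 : d2 = d.
    apply/eqP; apply: contraT => d2d; have e := onlyD _ d2D d2d.
    by rewrite -e d2T2 in d'T2.
  have et2 : t2 = t'.
    have := nd2 t' d't'; rewrite (negPf t's) ed2 (negPf t'd) orbF => /eqP->//.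
  by have := nd2 v d'v; rewrite ed2 et2.
have tt' : t != t' by apply: contraNneq t'T => <-.
have ts : t != s by apply: contraNneq sT => <-.
have nt'd : ~~ (t' -- d).
  apply/negP; rewrite edge_sym => /nd; rewrite (negPf t's) [t' == t]eq_sym (negPf tt').
  by move/eqP=> e; rewrite -e t'S in d'S.
have ntd' : ~~ (t -- d').
  apply/negP; rewrite edge_sym => /nd'; rewrite (negPf ts) (negPf tt').
  by rewrite eq_sym (negPf (notS d t dD tS')).
have [C [CS CD CH]] := third_comp D H; have [w wC] := comps_neq0 CS.
have outC v : v \in C -> [/\ v \notin S, v \notin D & v \notin H].
  move=> vC; split; first exact: comps_notin CS vC.
    by apply: contra CD => vD; rewrite (comps_eq CS DS vC vD).
  by apply: contra CH => vH; rewrite (comps_eq CS HS vC vH).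
have t'full v : v \in C -> t' -- v.
  case/outC=> vS vD _; apply: (partial_full t'S DS d'D dD) => //; by rewrite edge_sym.
have tfull v : v \in C -> t -- v.
  case/outC=> vS vD _; apply: (partial_full tS' DS dD d'D) => //; by rewrite edge_sym.
have CsubT v : v \in C -> v \in T.
  move=> vC; have [vS _ vH] := outC v vC; apply: contraT => vT; case/negP: t'C.
  apply: component_step (component_step sC (sfull vS vH) sT vT) _ vT t'T.
  by rewrite edge_sym t'full.
have C1 v : v \in C -> v = w.
  move=> vC; have := le1 C CS CH; rewrite (setIidPr _); last by apply/subsetP.
  by move/card_le1_eqP; apply.
have [wS _ wH] := outC w wC; have sw := sfull wS wH.
case: (outer_cases wS wH) => [le2|onlys|].
- have := card_gt2 (A := nbrs w) (x := s) (y := t) (z := t').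
  rewrite !inE ![w -- _]edge_sym sw tfull // t'full // ltnNge le2.
  by rewrite eq_sym ts eq_sym t's tt' => /(_ isT isT isT isT isT isT).
- by have := onlys t tS'; rewrite edge_sym tfull // => /(_ isT) e; rewrite e eqxx in ts.
case=> T2 [t2 [d2 [_ _ wT2 _ [/setIP[d2T2 d2C] _ _]]]].
have [_ eC] := compsP CS wC; rewrite -eC in d2C.
by rewrite -(C1 d2 d2C) d2T2 in wT2.
Qed.

(** With two vertices in [D], each of them has [s] as its only neighbour in [S] by
    [outer_degree], against [not_only_nbr]. *)
Lemma outer_single D : D \in comps S -> D != H ->
  exists d w, [/\ D = [set d], w \in S, w != s, w -- d & nbrs d \subset [set s; w]].
Proof.
move=> DS DH; have out d : d \in D -> [/\ d \notin S, d \notin H & s -- d].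
  move=> dD; have dS := comps_notin DS dD.
  have dH : d \notin H by apply: contra DH => dH; rewrite (comps_eq DS HS dD dH).
  by split=> //; apply: sfull.
have [w [d [wS ws dD wd]]] := not_only_nbr DS sS.
have deg d1 w1 : d1 \in D -> w1 \in S -> w1 != s -> w1 -- d1 -> nbrs d1 \subset [set s; w1].
  move=> d1D w1S w1s wd1; have [d1S d1H sd1] := out d1 d1D.
  case: (outer_degree d1S d1H) => [le2|onlys]; last first.
    by have := onlys w1 w1S; rewrite edge_sym wd1 => /(_ isT) e; rewrite e eqxx in w1s.
  apply/subsetP => v vd1; rewrite !inE; apply: contraT; rewrite negb_or => /andP[vs vw].
  have := card_gt2 (A := nbrs d1) (x := s) (y := w1) (z := v).
  rewrite vd1 !inE ![d1 -- _]edge_sym sd1 wd1 ltnNge le2.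
  by rewrite ![s == _]eq_sym w1s vs [w1 == v]eq_sym vw => /(_ isT isT isT isT isT isT).
exists d, w; split=> //; last exact: deg.
apply/eqP; rewrite eq_sym eqEsubset sub1set dD /=; apply/subsetP => v vD; rewrite inE.
apply: contraT => vd; have [||p [q [_ /set1P-> qD qd dq]]] :=
  comps_boundary (Z := [set d]) DS dD _ vD.
- by rewrite inE.
- by rewrite inE.
have := subsetP (deg d w dD wS ws wd) q; rewrite !inE => /(_ dq).
by case/orP=> /eqP e; move: (comps_notin DS qD); rewrite e ?sS ?wS.
Qed.

Lemma inner_outer w : w \in S -> w != s ->
  exists d, [/\ d \notin S, d \notin H, w -- d & nbrs d \subset [set s; w]].
Proof.
move=> wS ws; have X0 : [set w] != set0 by apply/set0Pn; exists w; rewrite inE.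
have XnS : [set w] != S by apply: contraTneq S3 => <-; rewrite cards1.
have XS : [set w] \subset S by rewrite sub1set.
have := Hall XS X0 XnS; rewrite cards1 => /(card2_other H)[D].
case/nbr_compsP=> _ [d [DS /set1P-> dD wd]] DH.
have [d1 [w1 [eD w1S w1s w1d sub]]] := outer_single DS DH.
have ed : d1 = d by move: dD; rewrite eD => /set1P.
have ew : w1 = w.
  have := subsetP sub w; rewrite ed !inE edge_sym wd (negPf ws) => /(_ isT).
  by move/eqP.
exists d; rewrite -ed -ew; split=> //; rewrite ed ?ew //; first exact: comps_notin DS dD.
by apply: contra DH => dH; rewrite (comps_eq DS HS dD dH).
Qed.

(** A vertex [w] adjacent to only a part of [H] is adjacent to the degree two
    vertex next to some other [w2]; a vertex [w] with no neighbour in [H] violates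
    [Hall], applied to [S] without [s] and [w]. *)
Lemma inner_full w h : w \in S -> w != s -> h \in H -> w -- h.
Proof.
move=> wS ws hH; have [w2 [w2S w2s w2w]] : exists w2, [/\ w2 \in S, w2 != s & w2 != w].
  exact: card3_other.
have outw2 d : d \notin S -> d \notin H -> w2 -- d -> ~~ (w -- d).
  move=> dS dH w2d; have dD := component_refl S d.
  have DH : component S d != H by apply: contraNneq dH => <-.
  have [d1 [w1 [eD w1S w1s w1d sub]]] := outer_single (mem_comps dS) DH.
  have ed : d1 = d by move: dD; rewrite eD => /set1P.
  have inw u : u -- d -> u != s -> u = w1.
    move=> ud us; have := subsetP sub u; rewrite ed !inE edge_sym ud (negPf us).
    by move=> /(_ isT)/eqP.
  by apply: contra w2w => wd; rewrite (inw w wd ws) (inw w2 w2d w2s).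
apply: contraT => nwh.
have [d2 [d2S d2H w2d2 _]] := inner_outer w2S w2s.
have null x : x \in H -> ~~ (w -- x).
  move=> xH; apply: contra (outw2 d2 d2S d2H w2d2) => wx.
  exact: partial_full wS HS xH hH wx nwh d2S d2H.
pose X := S :\ s :\ w.
have XS : X \subset S := subset_trans (subD1set _ _) (subD1set _ _).
have cX : #|X| + 2 = #|S|.
  by rewrite (cardsD1 s S) sS (cardsD1 w (S :\ s)) !inE ws wS -/X addnC.
have X0 : X != set0 by rewrite -card_gt0; move: cX S3; clear; lia.
have XnS : X != S by apply: contraTneq sS => <-; rewrite !inE eqxx andbF.
have w0 : [set w] != set0 by apply/set0Pn; exists w; rewrite inE.
have wnS : [set w] != S by apply: contraTneq S3 => <-; rewrite cards1.
have wSub : [set w] \subset S by rewrite sub1set.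
have := Hall wSub w0 wnS; have := Hall XS X0 XnS; rewrite cards1.
suff dis : nbr_comps X :&: nbr_comps [set w] = set0.
  have : #|nbr_comps X :|: nbr_comps [set w]| <= #|comps S|.
    by apply/subset_leq_card; rewrite subUset; apply/andP; split;
      apply/subsetP => C /nbr_compsP[x [d []]].
  rewrite cardsU dis cards0 subn0 cS -cX; clear; lia.
apply/setP => D; rewrite in_setI in_set0; apply/negbTE/negP => /andP[].
case/nbr_compsP=> u [x [DS uX xD ux]] /nbr_compsP[_ [y [_ /set1P-> yD wy]]].
have DH : D != H by apply: contraTneq yD => ->; apply/negP => /null; rewrite wy.
move: uX; rewrite !inE => /and3P[uw us uS].
have [d1 [w1 [eD w1S w1s w1d sub]]] := outer_single DS DH.
have inw v z : z \in D -> v -- z -> v != s -> v = w1.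
  rewrite eD => /set1P-> vz vs; have := subsetP sub v; rewrite !inE edge_sym vz (negPf vs).
  by move=> /(_ isT)/eqP.
by rewrite (inw u x xD ux us) (inw w y yD wy ws) eqxx in uw.
Qed.

(** Each [w] in [S :\ s] spans a cycle through [s], the vertex of degree two
    next to both, and [H]; so no edge from [s] to [H] can be critical. *)
Lemma full_vertex_absurd : False.
Proof.
have [h hH sh] := sH; have hS := comps_notin HS hH.
have [w1 w1S w1s] := card2_other s (ltnW S3).
have [w2 [w2S w2s w21]] := card3_other s w1 S3.
case: (edge_cases G1 Gfree Gcrit sh) => [[t [Y br]]|[T [tT sT hT star]]].
  have [sY hY tY st ht] := bridge_ends br.
  have via w d : w \in S -> w != s -> d \notin S -> d \notin H -> w -- d ->
      nbrs d \subset [set s; w] -> t = w \/ t = d.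
    move=> wS ws dS dH wd sub; have [->|tw] := eqVneq t w; first by left.
    right; apply/eqP; apply: contraNT sY => td.
    have wY : w \in Y.
      apply: (bridge_step br hY); rewrite 1?edge_sym ?inner_full // 1?eq_sym //.
      by rewrite [s == w]eq_sym (negPf ws) andbF.
    have dY : d \in Y.
      apply: (bridge_step br wY wd); first by rewrite eq_sym.
      by apply: contraNN dS => /andP[_ /eqP->].
    apply: (bridge_step br dY) => //; first by rewrite edge_sym sfull.
    by apply: contraNN dH => /andP[/eqP->].
  have [d1 [d1S d1H wd1 sub1]] := inner_outer w1S w1s.
  have [d2 [d2S d2H wd2 sub2]] := inner_outer w2S w2s.
  case: (via w1 d1 w1S w1s d1S d1H wd1 sub1); case: (via w2 d2 w2S w2s d2S d2H wd2 sub2).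
  - by move=> -> /eqP; rewrite (negPf w21).
  - by move=> -> e; rewrite e w1S in d2S.
  - by move=> -> e; rewrite -e w2S in d1S.
  move=> -> e; have := subsetP sub2 w1; rewrite e !inE edge_sym wd1 (negPf w1s).
  by move=> /(_ isT)/eqP e1; rewrite e1 eqxx in w21.
have CT := mem_comps sT; have sC := component_refl T s.
have hC := component_step sC sh sT hT.
have ST w : w \in S -> w != s -> w \in T.
  move=> wS ws; apply: contraT => wT; have [d [dS dH wd sub]] := inner_outer wS ws.
  have hw : h -- w by rewrite edge_sym inner_full.
  case: star => -[leaf _]; first by rewrite (leaf w hw wT) eqxx in ws.
  have dT : d \in T.
    apply: contraT => dT; have e := leaf d (sfull dS dH) dT.
    by rewrite e hH in dH.
  have [v [vT vC dv]] := tough_adj G1 tT dT CT.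
  have := subsetP sub v; rewrite !inE dv => /(_ isT)/orP[]/eqP e.
    by rewrite e sC in vC.
  by rewrite e (component_step hC hw hT wT) in vC.
have S0 : #|S_comps T| = 0.
  apply/eqP; rewrite cards_eq0; apply: contraT => /set0Pn[O /in_S_comps[OT OC OS]].
  have [u uO] := comps_neq0 OT; have uT := comps_notin OT uO.
  case/eqP: OC; apply: (comps_eq OT CT uO).
  have [->//|us] := eqVneq u s.
  by rewrite (ST u (subsetP OS u uO) us) in uT.
have cT := card_comps_split tT sT; have T2 := tough_gt1 tT.
have H0 : H_comps T != set0 by rewrite -card_gt0; move: cT T2; rewrite S0; clear; lia.
have lt := card_H_comps_lt sT hH hC H0.
have TS : 0 < #|T :&: S|.
  by rewrite card_gt0; apply/set0Pn; exists w1; rewrite inE w1S (ST w1).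
have := card_set_split T; move: cT lt TS; rewrite S0; clear; lia.
Qed.

End FullVertex.

(** ** The vertices outside [S] are independent *)

Lemma comps_homogeneous D s x y : s \in S -> D \in comps S -> x \in D -> y \in D ->
  s -- x -> s -- y.
Proof.
move=> sS DS xD yD sx; apply: contraT => nsy; exfalso.
apply: (full_vertex_absurd sS DS); last by exists x.
by move=> v vS vD; apply: partial_full sS DS xD yD sx nsy vS vD.
Qed.

Lemma not_full s : s \in S -> exists2 v, v \notin S & ~~ (s -- v).
Proof.
move=> sS; suff /exists_inP[v vS nsv] : [exists v in ~: S, ~~ (s -- v)].
  by exists v; rewrite // -in_setC.
apply: contraT => /exists_inPn all; exfalso.
have sfull v : v \notin S -> s -- v by move=> vS; have := all v; rewrite inE negbK; apply.
have [H [HS _ _]] := third_comp set0 set0; have [h hH] := comps_neq0 HS.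
apply: (full_vertex_absurd sS HS) => [v vS _|]; first exact: sfull.
by exists h; rewrite // sfull // (comps_notin HS hH).
Qed.

(** If [D] had an edge, an edge from [s] to [D] would be critical only by being
    a bridge of [G - t] with [D = {d, t}]; both sides of it then satisfy [Hall],
    which needs too many components. *)
Lemma comps_single D x y : D \in comps S -> x \in D -> y \in D -> x = y.
Proof.
move=> DS xD yD; apply/eqP; apply: contraT => xy.
have /card_gt0P[s0 s0S] : 0 < #|S| by apply: leq_trans S3.
have [s [d [sS _ dD sd]]] := not_only_nbr DS s0S.
have sD v : v \in D -> s -- v by move=> vD; apply: comps_homogeneous sS DS dD vD sd.
have [d1 d1D d1d] : exists2 d1, d1 \in D & d1 != d.
  have [xd|xd] := eqVneq x d; last by exists x.
  by exists y => //; rewrite -xd eq_sym.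
have dS := comps_notin DS dD.
case: (edge_cases G1 Gfree Gcrit sd) => [[t [Y br]]|[T [tT sT dT star]]]; last first.
  have [||p [q [_ /set1P-> qD qd dq]]] := comps_boundary (Z := [set d]) DS dD _ d1D.
  - by rewrite inE.
  - by rewrite inE.
  rewrite inE in qd; have qT : q \in T.
    apply: contraT => qT; case: star => -[leaf _].
      by rewrite -(leaf q dq qT) (negPf (comps_notin DS qD)) in sS.
    by rewrite (leaf q (sD q qD) qT) eqxx in qd.
  have [v [vT vC qv]] := tough_adj G1 tT qT (mem_comps sT).
  have dC := component_step (component_refl T s) sd sT dT.
  case/negP: vC; case: (boolP (v \in S)) => vS.
    apply: component_step dC _ dT vT; rewrite edge_sym.
    by apply: comps_homogeneous vS DS qD dD _; rewrite edge_sym.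
  exact: component_step (component_refl _ _) (sD v (comps_step DS qD qv vS)) sT vT.
have [sY dY tY st dt] := bridge_ends br.
have step u v : u \in Y -> u -- v -> v != t -> u != d -> v \in Y.
  by move=> uY uv vt ud; apply: (bridge_step br uY uv vt); rewrite (negPf ud).
have stepD u v : u \in Y -> u -- v -> v != t -> v \in D -> v \in Y.
  move=> uY uv vt vD; apply: (bridge_step br uY uv vt).
  by apply: contraTN sS => /andP[_ /eqP<-]; apply: comps_notin DS vD.
have Dt w : w \in D -> w != d -> w = t.
  move=> wD wd; apply/eqP; apply: contraNT sY => wt.
  suff wY : w \in Y by apply: (step w); rewrite // edge_sym sD.
  apply: contraT => wY; case: (boolP (t \in D)) => tD.
    have [p [q [pD qD pY qY [pt qt pq]]]] :=
      max_tough_boundary G1 mS DS tD dD dt dY wD wt wY.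
    by rewrite (stepD p) in qY.
  have [p [q [pD pY qD qY pq]]] := comps_boundary DS dD dY wD wY.
  by rewrite (stepD p) // in qY; apply: contraNneq tD => <-.
have tD : t \in D by rewrite -(Dt d1 d1D d1d).
have notD C v : C \in comps S -> C != D -> v \in C -> v != d /\ v != t.
  move=> CS CD vC; have vD : v \notin D.
    by apply: contra CD => vD; rewrite (comps_eq CS DS vC vD).
  by split; apply: contraNneq vD => ->.
have notS u v : u \in S -> v \in D -> u != v.
  by move=> uS; apply: contraTneq => <-; apply: contraTN uS; apply: comps_notin.
have [s' [d' [s'S s's d'D s'd']]] := not_only_nbr DS sS.
have s'Y : s' \in Y.
  apply: (bridge_step br dY); rewrite ?notS //; last by rewrite (negPf s's) andbF.
  by rewrite edge_sym (comps_homogeneous s'S DS d'D dD).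
have hall1 : #|S :\: Y| < #|nbr_comps (S :\: Y)|.
  apply: Hall; first exact: subsetDl.
    by apply/set0Pn; exists s; rewrite inE sY.
  by apply: contraTneq s'S => <-; rewrite inE s'Y.
have hall2 : #|S :&: Y| < #|nbr_comps (S :&: Y)|.
  apply: Hall; first exact: subsetIl.
    by apply/set0Pn; exists s'; rewrite inE s'S.
  by apply: contraTneq sS => <-; rewrite inE (negPf sY) andbF.
have le1 : #|nbr_comps (S :\: Y) :&: nbr_comps (S :&: Y)| <= 1.
  rewrite -(cards1 D); apply/subset_leq_card/subsetP => C; rewrite inE => /andP[].
  case/nbr_compsP=> u [p [CS /setDP[uS uY] pC up]] /nbr_compsP[v [q [_ /setIP[vS vY] qC vq]]].
  rewrite inE; apply: contraT => CD; have nD := notD C _ CS CD.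
  have CY w : w \in C -> w \in Y.
    have qY : q \in Y by apply: step vY vq (proj2 (nD q qC)) (notS _ _ vS dD).
    move=> wC; apply: contraT => wY.
    have [a [b [aC aY bC bY ab]]] := comps_boundary CS qC qY wC wY.
    by case/negP: bY; apply: step aY ab (proj2 (nD b bC)) (proj1 (nD a aC)).
  case/negP: uY; apply: step (CY p pC) _ (notS _ _ uS tD) (proj1 (nD p pC)).
  by rewrite edge_sym.
have le2 : #|nbr_comps (S :\: Y) :|: nbr_comps (S :&: Y)| <= #|S|.
  rewrite -cS; apply/subset_leq_card; rewrite subUset; apply/andP; split;
    by apply/subsetP => C /nbr_compsP[? [? []]].
have := cardsID Y S; have := cardsUI (nbr_comps (S :\: Y)) (nbr_comps (S :&: Y)).
move: #|nbr_comps (S :\: Y) :|: _| #|_ :&: nbr_comps _| le1 le2 hall1 hall2 => i j.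
move: #|nbr_comps _| #|nbr_comps _| #|S :\: Y| #|S :&: Y| #|S|; clear; lia.
Qed.

Lemma outside_indep u v : u \notin S -> v \notin S -> ~~ (u -- v).
Proof.
move=> uS vS; apply/negP => uv; have vC := component_step (component_refl S u) uv uS vS.
have := comps_single (mem_comps uS) (component_refl S u) vC.
by apply/eqP; apply: edge_neq.
Qed.

Lemma card_outside : #|~: S| = #|S|.
Proof.
rewrite -cS card_in_imset // => u v; rewrite !inE => uS vS e.
by apply: (comps_single (mem_comps uS)); rewrite ?component_refl // e component_refl.
Qed.

(** ** Neighbourhoods outside [S] *)

Definition out s := nbrs s :\: S.
Definition outs X := \bigcup_(x in X) out x.

Lemma in_out s d : (d \in out s) = (d \notin S) && (s -- d).
Proof. by rewrite !inE. Qed.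

Lemma nbrs_in_S d : d \notin S -> nbrs d \subset S.
Proof.
move=> dS; apply/subsetP => v; rewrite inE => dv; apply: contraTT dv => vS.
exact: outside_indep.
Qed.

Lemma Hall_out X : X \subset S -> X != set0 -> X != S -> #|X| < #|outs X|.
Proof.
move=> XS X0 XnS; apply: leq_trans (Hall XS X0 XnS) _.
apply: leq_trans (leq_imset_card (component S) _).
apply/subset_leq_card/subsetP => D /nbr_compsP[x [d [DS xX dD xd]]].
have [dS ->] := compsP DS dD; apply: imset_f; apply/bigcupP; exists x => //.
by rewrite in_out dS.
Qed.

Lemma out_ge2 s : s \in S -> 1 < #|out s|.
Proof.
move=> sS; have := Hall_out (X := [set s]); rewrite cards1 sub1set sS /outs big_set1.
apply=> //; first by apply/set0Pn; exists s; rewrite inE.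
by apply: contraTneq S3 => <-; rewrite cards1.
Qed.

Lemma out_neq0 s : s \in S -> exists v, v \in out s.
Proof. by move=> sS; apply/card_gt0P; apply: ltnW (out_ge2 sS). Qed.

Lemma nbrs_ge2 d : d \notin S -> 1 < #|nbrs d|.
Proof.
move=> dS; have DS := mem_comps dS.
have /card_gt0P[s0 s0S] : 0 < #|S| by apply: leq_trans S3.
have dE v : v \in component S d -> v = d.
  by move=> vD; apply: comps_single DS vD (component_refl _ _).
have [s [v [sS _ /dE-> sd]]] := not_only_nbr DS s0S.
have [t [w [t'S ts /dE-> td]]] := not_only_nbr DS sS.
have : #|[set s; t]| <= #|nbrs d|.
  by apply/subset_leq_card; rewrite subUset !sub1set !inE ![d -- _]edge_sym sd td.
by rewrite cards2 eq_sym ts.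
Qed.

(** The neighbourhoods form a cross-free family: a common neighbour, or an edge
    between [s] and [t], closes an induced path [P_4], which must dominate. *)
Lemma cross_free s t :
  [\/ out s \subset out t, out t \subset out s, out s :|: out t = ~: S |
      out s :&: out t = set0 /\ ~~ (s -- t)].
Proof.
case: (boolP (out s \subset out t)) => [|/subsetPn[a]]; first by constructor 1.
rewrite in_out => /andP[aS sa]; rewrite in_out aS /= => nta.
case: (boolP (out t \subset out s)) => [|/subsetPn[b]]; first by constructor 2.
rewrite in_out => /andP[bS tb]; rewrite in_out bS /= => nsb.
have sub : out s :|: out t \subset ~: S.
  by apply/subsetP => v; rewrite in_setU !in_out inE => /orP[]/andP[].
case: (boolP (~: S \subset out s :|: out t)) => [sup|/subsetPn[c]].
  by constructor 3; apply/eqP; rewrite eqEsubset sub.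
rewrite inE => cNS; rewrite in_setU !in_out cNS /= negb_or => /andP[nsc ntc].
have ind := outside_indep; constructor 4.
have nst : ~~ (s -- t).
  apply/negP => st; apply: (Gfree (p := a) (q := s) (r := t) (t := b) (z := c)) => //;
    try by [apply: ind]; by rewrite edge_sym.
split=> //; apply/eqP; apply: contraT => /set0Pn[d].
rewrite in_setI !in_out => /andP[/andP[dS sd] /andP[_ td]]; exfalso.
by apply: (Gfree (p := a) (q := s) (r := d) (t := t) (z := c)) => //;
  try by [apply: ind]; rewrite edge_sym.
Qed.

(** ** Critical edges between [S] and its complement *)

Section CriticalCut.
Variables (s d : G) (T : {set G}).
Hypotheses (sS : s \in S) (dS : d \notin S) (sd : s -- d).
Hypotheses (tT : tough_set T) (sT : s \notin T) (dT : d \notin T).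
Hypothesis star : leaf_star T s d \/ leaf_star T d s.
Hypothesis deg3 : 2 < #|nbrs d|.

Let C := component T s.
Let CT : C \in comps T := mem_comps sT.
Let sC : s \in C := component_refl T s.
Let dC : d \in C := component_step sC sd sT dT.
Let others := comps T :\ C.
Let inner := [set O in others | O \subset S].
Let mixed := [set O in others | ~~ (O \subset S)].

Lemma others_notin O v : O \in others -> v \in O -> v \notin C /\ v \notin T.
Proof.
move=> /setD1P[OC OT] vO; split; last exact: comps_notin OT vO.
by apply: contra OC => vC; rewrite (comps_eq OT CT vO vC).
Qed.

Lemma others_nonadj O u v : O \in others -> u \in O -> v \in C -> ~~ (u -- v).
Proof. by move=> /setD1P[OC OT] uO vC; apply: comps_nonadj OT CT OC uO vC. Qed.

Lemma out_s_in_C v : v \in out s -> v \notin T -> v \in C.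
Proof. by rewrite in_out => /andP[_ sv] vT; apply: component_step sC sv sT vT. Qed.

Lemma card_T_outside : #|T| = #|T :&: S| + #|T :\: S|.
Proof. by rewrite cardsID. Qed.

Lemma card_T_comps : #|T| = #|others| + 1.
Proof. by rewrite -(tough_card G1 tT) (cardsD1 C (comps T)) CT addnC. Qed.

Lemma card_others : #|others| = #|inner| + #|mixed|.
Proof.
rewrite -(cardsID [set O : {set G} | O \subset S] others); congr (_ + _).
  by apply: eq_card => O; rewrite !inE.
by apply: eq_card => O; rewrite !inE andbC.
Qed.

(** [Hall_out] for the union of components of [G - T] that lie in [S]. *)
Lemma family_bound P (U : {set G}) : P \subset others -> (forall O v, O \in P -> v \in O -> v \in S) ->
  (forall v, v \in outs (cover P) -> v \in U) -> P != set0 -> #|P| < #|U|.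
Proof.
move=> /subsetP sub PS PU P0; have PT : P \subset comps T.
  by apply/subsetP => O /sub/setD1P[].
have le : #|P| <= #|cover P|.
  apply: card_cover_ge (comps_sub_trivI PT) _ => O OP.
  by have [] := comps_island (subsetP PT O OP).
have XS : cover P \subset S.
  by apply/bigcupsP => O OP; apply/subsetP => v vO; apply: PS OP vO.
have subU : outs (cover P) \subset U by apply/subsetP.
have X0 : cover P != set0 by rewrite -card_gt0; apply: leq_trans le; rewrite card_gt0.
apply: leq_trans (subset_leq_card subU); apply: leq_ltn_trans le (Hall_out XS X0 _).
apply: contraTneq sS => <-; apply/negP => /bigcupP[O OP sO].
by have [/negP] := others_notin (sub O OP) sO.
Qed.

Lemma inner_outs v : v \in outs (cover inner) -> v \in T :\: S.
Proof.
case/bigcupP=> x /bigcupP[O]; rewrite !inE => /andP[/andP[OC OT] OS] xO.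
case/andP=> vS xv; rewrite vS /=; apply: contraT => vT.
by rewrite (subsetP OS v (comps_step OT xO xv vT)) in vS.
Qed.

Lemma card_inner : inner != set0 -> #|inner| < #|T :\: S|.
Proof.
apply: family_bound; last exact: inner_outs.
  by apply/subsetP => O; rewrite inE => /andP[].
by move=> O v; rewrite inE => /andP[_ /subsetP sub] /sub.
Qed.

Lemma mixed_outside O : O \in mixed ->
  exists v, [/\ v \in O, v \notin S, v \notin T, v \notin C & v \notin out s].
Proof.
rewrite inE => /andP[OT /subsetPn[v vO vS]]; have [vC vT] := others_notin OT vO.
by exists v; split=> //; apply: contra vC => vM; apply: out_s_in_C.
Qed.

Lemma leaf_card_TS : leaf_star T s d -> 1 < #|T :&: S|.
Proof.
case=> leaf _; have : #|nbrs d :\ s| <= #|T :&: S|.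
  apply/subset_leq_card/subsetP => v /setD1P[vs dv]; rewrite inE in dv.
  rewrite inE (subsetP (nbrs_in_S dS)) ?inE // andbT.
  by apply: contraNT vs => vT; apply/eqP/leaf.
by move: deg3 (card_leD1 (nbrs d) s); move: #|nbrs d| #|_ :\ s| #|T :&: S|; clear; lia.
Qed.

(** If [N(r)] covers everything that [s] misses, at most one further component
    leaves [S]; counting then leaves [d] two neighbours. *)
Lemma no_covering r : r \in S -> r \notin T -> r != s -> r \notin C \/ leaf_star T s d ->
  out r :|: out s = ~: S -> out r :&: out s = set0.
Proof.
move=> rS rT rs rC cov; apply/eqP; apply: contraT => /set0Pn[x /setIP[xr xs]]; exfalso.
have tw := card_T_outside; have tc := card_T_comps; rewrite card_others in tc.
have ci : #|inner| = 0 \/ #|inner| < #|T :\: S|.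
  by have [->|/card_inner] := eqVneq inner set0; [left; rewrite cards0 | right].
have missed v : v \notin S -> v \notin out s -> r -- v.
  move=> vS vs; have : v \in out r :|: out s by rewrite cov inE.
  by rewrite inE (negPf vs) orbF in_out => /andP[].
case: (boolP (r \in C)) => rC'.
  case: rC => [|st]; first by rewrite rC'.
  have m0 : #|mixed| = 0.
    apply/eqP; rewrite cards_eq0; apply: contraT => /set0Pn[O OM].
    have [v [vO vS vT vC vs]] := mixed_outside OM; case/negP: vC.
    exact: component_step rC' (missed v vS vs) rT vT.
  have := leaf_card_TS st; move: tw tc ci; rewrite m0; clear.
  move: #|T| #|T :&: S| #|T :\: S| #|inner| => a b c e; lia.
have m1 : #|mixed| <= 1.
  rewrite -(cards1 (component T r)); apply/subset_leq_card/subsetP => O OM; rewrite inE.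
  have [v [vO vS vT vC vs]] := mixed_outside OM; apply/eqP.
  have OT : O \in comps T by move: OM; rewrite inE => /andP[/setD1P[]].
  apply: (comps_eq OT (mem_comps rT) vO).
  exact: component_step (component_refl _ _) (missed v vS vs) rT vT.
case: star => st.
  have xT : 0 < #|T :\: S|.
    rewrite card_gt0; apply/set0Pn; exists x; move: xr xs; rewrite !in_out => /andP[xS rx] /andP[_ sx].
    rewrite inE xS /=; apply: contraT => xT; case/negP: rC'.
    by apply: component_step (component_step sC sx sT xT) _ xT rT; rewrite edge_sym.
  have := leaf_card_TS st; move: tw tc ci m1 xT; clear.
  move: #|T| #|T :&: S| #|T :\: S| #|inner| #|mixed| => a b c e f; lia.
have eC : component T d = C := component_eq dC.
have Cout v : v \in C -> v \notin S -> v = d.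
  move=> vC vS; apply/eqP; apply: contraT => vd.
  by have := st.2 v; rewrite eC => /(_ vC vd); rewrite (negPf (outside_indep dS vS)).
pose W := ~: S :\ d :\: T; pose R := component T r :&: S; pose X := cover inner.
have Wr v : v \in W -> [/\ v \notin S, v \notin T & v \in component T r].
  move=> /setDP[/setD1P[vd vS] vT]; rewrite inE in vS.
  have vC : v \notin C by apply: contra vd => /Cout->.
  have vs : v \notin out s by apply: contra (vC) => vs; apply: out_s_in_C.
  by split=> //; exact: component_step (component_refl _ _) (missed v vS vs) rT vT.
have cW : #|S| = 1 + #|W| + #|T :\: S|.
  rewrite -card_outside (cardsD1 d (~: S)) inE dS /= -addnA; congr (1 + _).
  rewrite -(cardsID T) addnC; congr (_ + _); apply: eq_card => v; rewrite !inE.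
  by case: eqP => [->|_]; rewrite ?(negPf dT) ?andbF // andbC.
have q : #|nbrs d| <= #|C :&: S| + #|T :&: S|.
  apply: leq_trans (card_setU_le _ _); apply/subset_leq_card/subsetP => v.
  rewrite inE => dv; have vS : v \in S by apply: (subsetP (nbrs_in_S dS)); rewrite inE.
  rewrite in_setU !in_setI vS !andbT orbC; case: (boolP (v \in T)) => //= vT.
  exact: component_step dC dv dT vT.
have innerT : inner \subset comps T.
  by apply/subsetP => O; rewrite inE => /andP[/setD1P[]].
have leX : #|inner| <= #|X|.
  apply: card_cover_ge (comps_sub_trivI innerT) _ => O /(subsetP innerT).
  by case/comps_island.
have XS : X \subset S.
  by apply/bigcupsP => O; rewrite inE => /andP[].
have dTX : (T :&: S) :&: X = set0.
  apply/setP => v; rewrite in_setI in_set0; apply/negbTE/negP => /andP[/setIP[vT _] vX].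
  by have [/negP] := cover_compsP innerT vX.
have XC v : v \in X -> v \notin C.
  by case/bigcupP=> O; rewrite inE => /andP[OT _] vO; have [] := others_notin OT vO.
have dCTX : (C :&: S) :&: ((T :&: S) :|: X) = set0.
  apply/setP => v; rewrite in_setI in_set0; apply/negbTE/negP => /andP[/setIP[vC _]].
  case/setUP=> [/setIP[vT _]|/XC/negP//]; by rewrite (negPf (comps_notin CT vC)) in vT.
have three : #|C :&: S| + (#|T :&: S| + #|X|) = #|(C :&: S) :|: ((T :&: S) :|: X)|.
  by rewrite cardsU dCTX cards0 subn0 cardsU dTX cards0 subn0.
have [W0|/set0Pn[v0 v0W]] := eqVneq W set0.
  have m0 : #|mixed| = 0.
    apply/eqP; rewrite cards_eq0; apply: contraT => /set0Pn[O OM].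
    have [v [vO vS vT vC _]] := mixed_outside OM; have := in_set0 v.
    rewrite -W0 in_setD in_setD1 in_setC vT vS andbT; case: eqP => // e.
    by rewrite e dC in vC.
  have le : #|C :&: S| + (#|T :&: S| + #|X|) <= #|S|.
    by rewrite three; apply: subset_leq_card; rewrite !subUset !subsetIr XS.
  move: cW le q leX tw tc deg3; rewrite W0 m0 cards0; clear.
  move: #|C :&: S| #|T :&: S| #|X| #|nbrs d| #|T| #|inner| #|T :\: S| #|S|.
  by move=> a b c e f g h i; lia.
have dRTCX : R :&: ((C :&: S) :|: ((T :&: S) :|: X)) = set0.
  apply/setP => v; rewrite in_setI in_set0; apply/negbTE/negP => /andP[/setIP[vR _]].
  have vCT := comps_notin (mem_comps rT) vR; case/setUP=> [/setIP[vC _]|/setUP[/setIP[vT _]|vX]].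
  - by case/negP: rC'; rewrite (comps_eq CT (mem_comps rT) vC vR) component_refl.
  - by rewrite vT in vCT.
  (* The component of [r] contains [v0], so it is not inside [S]. *)
  have [v0S _ v0r] := Wr v0 v0W; case/bigcupP: vX => O; rewrite inE => /andP[/setD1P[_ OT] OS] vO.
  case/negP: v0S; apply: (subsetP OS).
  by rewrite (comps_eq OT (mem_comps rT) vO vR).
have le : #|R| + (#|C :&: S| + (#|T :&: S| + #|X|)) <= #|S|.
  rewrite three -[_ + _]subn0 -(cards0 G) -dRTCX -cardsU; apply: subset_leq_card.
  by rewrite !subUset !subsetIr XS.
have : #|W| < #|R :|: (T :&: S)|.
  apply: (rest_bound_singles G1 (s := d)).
  - move=> v /Wr[vS _ _]; by rewrite in_setU !in_setI (negPf vS) !andbF.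
  - move=> v u /Wr[vS vT vr] vu; have uS : u \in S.
      by apply: (subsetP (nbrs_in_S vS)); rewrite inE.
    rewrite in_setU !in_setI uS !andbT orbC; case: (boolP (u \in T)) => //= uT.
    exact: component_step vr vu vT uT.
  - by rewrite in_setU !in_setI (negPf dS) !andbF.
  - by rewrite in_setD in_setD1 eqxx andbF.
  by rewrite card_gt0; apply/set0Pn; exists v0.
move/leq_trans => /(_ _ (card_setU_le _ _)); move: cW le q leX tw tc m1 deg3; clear.
move: #|C :&: S| #|T :&: S| #|X| #|nbrs d| #|T| #|inner| #|T :\: S| #|S| #|W| #|R| #|mixed|.
by move=> a b c e f g h i j k l; lia.
Qed.

Lemma nonadj_d r : r \in S -> r \notin T -> r != s -> r \notin C \/ leaf_star T s d ->
  d \notin out r.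
Proof.
move=> rS rT rs rC; rewrite in_out dS /=; apply: contraT; rewrite negbK => rd.
have dr : d -- r by rewrite edge_sym.
case: rC => [/negP[]|[leaf _]]; first exact: component_step dC dr dT rT.
by rewrite (leaf r dr rT) eqxx in rs.
Qed.

Lemma sub_or_disjoint r : r \in S -> r \notin T -> r != s ->
  r \notin C \/ leaf_star T s d -> out r \subset out s \/ out r :&: out s = set0.
Proof.
move=> rS rT rs rC; have dr := nonadj_d rS rT rs rC.
case: (cross_free r s) => [|sub|cov|[]]; [by left| |right|by right].
  by case/negP: dr; apply: (subsetP sub); rewrite in_out dS.
exact: no_covering.
Qed.

(** Let [O1] be the other components of [G - T] with neighbours in [out s]; they
    lie in [S], and are few by [Hall_out]. The set [T :\: out s] still separates
    the remaining ones, so they are few by 1-toughness. *)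
Lemma T_avoids_out_s : T :&: out s = set0.
Proof.
apply/eqP; apply: contraT => TM0; exfalso.
pose O1 := [set O in others | [exists r in O :&: S, out r :&: out s != set0]].
pose O2 := others :\: O1.
have inO1 O v : O \in O1 -> v \in O -> v \in S /\ out v \subset out s.
  rewrite inE => /andP[OT /exists_inP[r /setIP[rO rS] rs0]] vO.
  have type u : u \in O -> u \in S -> out u \subset out s \/ out u :&: out s = set0.
    move=> uO uS; have [uC uT] := others_notin OT uO.
    by apply: sub_or_disjoint => //; [apply: contraNneq uC => -> | left].
  pose Z := [set u in S | out u \subset out s].
  have rZ : r \in Z.
    by rewrite inE rS /=; case: (type r rO rS) => // e; rewrite e eqxx in rs0.
  suff : v \in Z by rewrite inE => /andP.
  apply: contraT => vZ; have OTT : O \in comps T by case/setD1P: OT.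
  have [u [w [uO uZ wO wZ uw]]] := comps_boundary OTT rO rZ vO vZ.
  move: uZ; rewrite inE => /andP[uS us].
  have [wC wT] := others_notin OT wO.
  case: (boolP (w \in S)) => wS; last first.
    by case/negP: wC; apply: out_s_in_C => //; apply: (subsetP us); rewrite in_out wS.
  have ws0 : out w :&: out s = set0.
    by case: (type w wO wS) => // sub; rewrite inE wS sub in wZ.
  have [p pu] := out_neq0 uS; have [p' p'w] := out_neq0 wS.
  have notdw O' x : O' \in others -> x \in O' -> d \notin out x.
    move=> O'T xO; rewrite in_out dS /=.
    exact: others_nonadj O'T xO dC.
  case: (cross_free u w) => [sub|sub|cov|[_ /negP//]].
  - by have := in_set0 p; rewrite -ws0 inE (subsetP sub) // (subsetP us).
  - by have := in_set0 p'; rewrite -ws0 inE p'w (subsetP us) // (subsetP sub).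
  have : d \in out u :|: out w by rewrite cov inE.
  by rewrite inE (negPf (notdw O u OT uO)) (negPf (notdw O w OT wO)).
have O1o : O1 \subset others by apply/subsetP => O; rewrite inE => /andP[].
have b1 : O1 != set0 -> #|O1| < #|T :&: out s|.
  apply: family_bound => // [O v OO vO|v]; first by have [] := inO1 O v OO vO.
  case/bigcupP=> x /bigcupP[O OO xO] vx; have [xS xs] := inO1 O x OO xO.
  rewrite inE (subsetP xs v vx) andbT; apply: contraT => vT.
  have [xC xT] := others_notin (subsetP O1o O OO) xO.
  have vC := out_s_in_C (subsetP xs v vx) vT.
  move: (others_nonadj (subsetP O1o O OO) xO vC).
  by move: vx; rewrite in_out => /andP[_ ->].
have b2 : O2 != set0 -> #|O2| < #|T :\: out s|.
  rewrite -card_gt0; apply: (rest_bound G1 (s := s)).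
  - apply: (comps_sub_trivI (T := T)); apply: subset_trans (subsetDl _ _) (subD1set _ _).
  - move=> O /setDP[OT OO1]; have OTT : O \in comps T by case/setD1P: OT.
    have [O0 dO outO] := comps_island OTT; split=> //.
      by apply: disjointWr dO; apply: subsetDl.
    move=> u v uO uv; case/orP: (outO u v uO uv) => [-> //|vT].
    rewrite in_setD vT andbT; apply/orP; right; apply: contra OO1 => vs.
    have vS : v \notin S by move: vs; rewrite in_out => /andP[].
    have uS : u \in S by apply: (subsetP (nbrs_in_S vS)); rewrite inE edge_sym.
    rewrite inE OT /=; apply/exists_inP; exists u; first by rewrite inE uO.
    by apply/set0Pn; exists v; rewrite in_setI vs andbT in_out vS.
  - by rewrite in_setD (negPf sT) andbF.
  by apply/negP => /bigcupP[O /setDP[OT _] sO]; have [/negP] := others_notin OT sO.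
have cT := card_T_comps; have cI := cardsID (out s) T.
have cO : #|others| = #|O1| + #|O2|.
  by rewrite -(cardsID O1 others) (setIidPr O1o).
have T2 := tough_gt1 tT.
have [tM0 o2] : #|T :\: out s| = 0 /\ #|O2| = 0.
  have t1 : 0 < #|T :&: out s| by rewrite card_gt0.
  have b1' : #|O1| = 0 \/ #|O1| < #|T :&: out s|.
    by have [->|/b1] := eqVneq O1 set0; [left; rewrite cards0 | right].
  have b2' : #|O2| = 0 \/ #|O2| < #|T :\: out s|.
    by have [->|/b2] := eqVneq O2 set0; [left; rewrite cards0 | right].
  move: cT cI cO T2 t1 b1' b2'; clear.
  by move: #|T| #|others| #|O1| #|O2| #|T :&: _| #|T :\: _| => *; split; lia.
have Ts v : v \in T -> v \in out s.
  move=> vT; apply: contraT => vs; have := in_set0 v.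
  by rewrite -(cards0_eq tM0) in_setD vT vs.
case: star => st.
  have := leaf_card_TS st; rewrite (_ : T :&: S = set0) ?cards0 //.
  apply/setP => v; rewrite in_setI in_set0; apply/negbTE/negP => /andP[/Ts].
  by rewrite in_out => /andP[/negP].
have [v vS nsv] := not_full sS.
have vT : v \notin T by apply: contra nsv => /Ts; rewrite in_out => /andP[].
have vd : v != d by apply: contraNneq nsv => ->.
have vC : v \notin C.
  apply/negP => vC; have := st.2 v; rewrite (component_eq dC) => /(_ vC vd).
  by rewrite (negPf (outside_indep dS vS)).
have := in_set0 (component T v); rewrite -(cards0_eq o2) in_setD in_setD1 mem_comps //.
have -> : component T v != C by apply: contraNneq vC => <-; apply: component_refl.
rewrite !andbT => /negbFE vO1.
by have [vS' _] := inO1 _ v vO1 (component_refl _ _); rewrite vS' in vS.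
Qed.

(** The leaf is [d]: if it were [s], then [T] would contain the other vertices of
    [out s]. *)
Lemma critical_cut : [/\ leaf_star T s d, T :&: out s = set0 &
  forall r, r \in S -> r \notin T -> r != s ->
    d \notin out r /\ (out r \subset out s \/ out r :&: out s = set0)].
Proof.
have T0 := T_avoids_out_s.
have st : leaf_star T s d.
  case: star => // -[leaf _]; have [v vs vd] := card2_other d (out_ge2 sS).
  have := in_set0 v; rewrite -T0 in_setI vs andbT; move: vs; rewrite in_out => /andP[_ sv] vT.
  by rewrite (leaf v sv) ?vT // eqxx in vd.
split=> // r rS rT rs; have rC : r \notin C \/ leaf_star T s d by right.
by split; [apply: nonadj_d | apply: sub_or_disjoint].
Qed.

End CriticalCut.

(** ** All vertices outside [S] have degree two *)

Section BridgeBetween.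
Variables (s d t : G) (Y : {set G}).
Hypotheses (sS : s \in S) (dS : d \notin S) (br : bridge [set t] s d Y).

Lemma bridge_nbr v : d -- v -> v != s -> v != t -> v \in Y.
Proof.
have [_ dY _ _ _] := bridge_ends br.
by move=> dv vs vt; apply: (bridge_step br dY dv vt); rewrite (negPf vs) andbF.
Qed.

Lemma bridge_out_in u v : u \in S -> u \in Y -> v \in out u -> v = t \/ v \in Y.
Proof.
rewrite in_out => uS uY /andP[vS uv]; have [->|vt] := eqVneq v t; [by left|right].
by apply: (bridge_step br uY uv vt); apply: contraNN dS => /andP[/eqP<-].
Qed.

Lemma bridge_out_notin u v : u \in S -> u \notin Y -> u != s -> u != t -> v \in out u ->
  v \notin Y.
Proof.
rewrite in_out => uS uY us ut /andP[vS uv]; apply: contra uY => vY.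
by apply: (bridge_step br vY) => //; rewrite 1?edge_sym // (negPf us) andbF.
Qed.

Lemma bridge_out_s v : v \in out s -> v != d -> v \notin Y.
Proof.
have [sY _ _ st _] := bridge_ends br.
rewrite in_out => /andP[vS sv] vd; apply: contra sY => vY.
by apply: (bridge_step br vY) => //; rewrite 1?edge_sym // (negPf vd).
Qed.

(** Both sides of the bridge satisfy [Hall_out], with too many vertices in all. *)
Lemma bridge_S_absurd : t \in S -> out t \subset out s -> S :&: Y != set0 -> False.
Proof.
move=> t_S ts SY0; have [sY dY tY st dt] := bridge_ends br.
have hA : #|S :\: Y| < #|(~: S :\: Y) :|: [set d]|.
  apply: leq_trans (Hall_out _ _ _) (subset_leq_card _).
  - exact: subsetDl.
  - by apply/set0Pn; exists s; rewrite inE sY.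
  - apply: contraTneq SY0 => e; rewrite -e; apply/negPn/eqP/setP => v.
    by rewrite in_setI in_setD in_set0; case: (v \in Y); rewrite ?andbF.
  apply/subsetP => v /bigcupP[u /setDP[uS uY] vu].
  have vS : v \notin S by move: vu; rewrite in_out => /andP[].
  rewrite in_setU in_set1 in_setD in_setC vS andbT.
  case: (eqVneq v d) => [_|vd]; rewrite ?orbT // orbF.
  have [us|us] := eqVneq u s; first by apply: bridge_out_s; rewrite -?us.
  have [ut|ut] := eqVneq u t; last exact: bridge_out_notin uS uY us ut vu.
  by apply: bridge_out_s => //; apply: (subsetP ts); rewrite -ut.
have hB : #|S :&: Y| < #|~: S :&: Y|.
  apply: leq_trans (Hall_out _ SY0 _) (subset_leq_card _).
  - exact: subsetIl.
  - by apply: contraTneq sS => <-; rewrite inE (negPf sY) andbF.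
  apply/subsetP => v /bigcupP[u /setIP[uS uY] vu].
  have vS : v \notin S by move: vu; rewrite in_out => /andP[].
  rewrite in_setI in_setC vS /=; case: (bridge_out_in uS uY vu) => // e.
  by rewrite e t_S in vS.
have := card_setU_le (~: S :\: Y) [set d]; rewrite cards1.
have := cardsID Y S; have := cardsID Y (~: S); rewrite card_outside; move: hA hB; clear.
move: #|_ :|: _| #|~: S :\: Y| #|~: S :&: Y| #|S :\: Y| #|S :&: Y| #|S|; lia.
Qed.

End BridgeBetween.

Lemma cross_cases s d : s \in S -> d \notin S -> s -- d -> 2 < #|nbrs d| ->
  (exists t Y, bridge [set t] s d Y) \/
  exists T, [/\ tough_set T, s \notin T, leaf_star T s d, T :&: out s = set0 &
    forall r, r \in S -> r \notin T -> r != s ->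
      d \notin out r /\ (out r \subset out s \/ out r :&: out s = set0)].
Proof.
move=> sS dS sd deg3.
case: (edge_cases G1 Gfree Gcrit sd) => [|[T [tT sT dT star]]]; first by left.
by right; exists T; have [] := critical_cut sS dS sd tT sT dT star deg3; split.
Qed.

(** Let [out r] be a proper part of [out s]. If [sd] is a bridge of some [G - t],
    then [Hall_out] fails for the two sides together. Otherwise [r] lies in the
    tough set [T], but has all its neighbours outside [T] in the component of [s],
    against [tough_adj]. *)
Lemma out_not_nested s r d : d \notin S -> 2 < #|nbrs d| -> d -- s -> d -- r ->
  out r \subset out s -> out s \subset out r.
Proof.
move=> dS deg3 ds dr rs; apply: contraT => /subsetPn[q qs qr]; exfalso.
have [sS rS] : s \in S /\ r \in S.
  by split; apply: (subsetP (nbrs_in_S dS)); rewrite inE.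
have sr : r != s by apply: contraNneq qr => ->.
have d_r : d \in out r by rewrite in_out dS edge_sym.
have sd : s -- d by rewrite edge_sym.
have [s3 [ds3 s3s s3r]] := card3_other s r deg3; rewrite inE in ds3.
have s3S : s3 \in S by apply: (subsetP (nbrs_in_S dS)); rewrite inE.
case: (cross_cases sS dS sd deg3) => [[t [Y br]]|[T [tT sT [leaf _] T0 types]]]; last first.
  (* [d] is a leaf at [s] in [G - T]. *)
  have rT : r \in T by apply: contraNT sr => rT; apply/eqP/leaf.
  have inC v : v \in out s -> v \notin T /\ v \in component T s.
    move=> vs; have vT : v \notin T.
      by apply/negP => vT; have := in_set0 v; rewrite -T0 inE vT vs.
    split=> //; move: vs; rewrite in_out => /andP[_ sv].
    exact: component_step (component_refl _ _) sv sT vT.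
  have [v [vT vC rv]] := tough_adj G1 tT rT (mem_comps sT).
  case: (boolP (v \in S)) => vS; last first.
    by case/negP: vC; apply: (inC v _).2; apply: (subsetP rs); rewrite in_out vS.
  have vs : v != s by apply: contraNneq vC => ->; apply: component_refl.
  have [dv type] := types v vS vT vs; have [p pv] := out_neq0 vS.
  case: type => [sub|dis].
    have [pT pC] := inC p (subsetP sub p pv); case/negP: vC.
    apply: component_step pC _ pT vT; rewrite edge_sym.
    by move: pv; rewrite in_out => /andP[].
  case: (cross_free r v) => [sub|sub|cov|[_ /negP//]].
  - by rewrite (subsetP sub) in dv.
  - by have := in_set0 p; rewrite -dis inE pv (subsetP rs) // (subsetP sub).
  have : q \in out r :|: out v by rewrite cov inE; move: qs; rewrite in_out => /andP[].
  by rewrite inE (negPf qr) /= => qv; have := in_set0 q; rewrite -dis inE qv qs.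
have [sY dY tY st dt] := bridge_ends br.
have [rt|rt] := eqVneq r t.
  apply: (bridge_S_absurd sS dS br); rewrite -?rt //.
  by apply/set0Pn; exists s3; rewrite inE s3S (bridge_nbr br) // -rt.
have rY : r \in Y := bridge_nbr br dr sr rt.
have r_dt v : v \in out r -> v = d \/ v = t.
  move=> vr; case: (bridge_out_in dS br rS rY vr) => [->|vY]; first by right.
  left; apply/eqP; apply: contraTT vY => vd.
  exact: (bridge_out_s br (subsetP rs v vr) vd).
have t_r : t \in out r.
  by have [w wr wd] := card2_other d (out_ge2 rS); case: (r_dt w wr) wd => <-; rewrite ?eqxx.
have tS' : t \notin S by move: t_r; rewrite in_out => /andP[].
have s3Y : s3 \in Y by apply: (bridge_nbr br) => //; apply: contraNneq tS' => <-.
have [qd qt] : q != d /\ q != t by split; apply: contraNneq qr => ->.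
have qY : q \notin Y by apply: (bridge_out_s br).
have qS : q \notin S by move: qs; rewrite in_out => /andP[].
pose XD := ~: S :\: Y :\ t.
have qXD : q \in XD by rewrite !inE qt qY qS.
have outXD u v : u \in S -> u \notin Y -> u != s -> v \in out u -> v \in XD.
  move=> uS uY us vu; have ut : u != t by apply: contraNneq tS' => <-.
  have outuY w : w \in out u -> w \notin Y := bridge_out_notin br uS uY us ut.
  have vS : v \notin S by move: vu; rewrite in_out => /andP[].
  rewrite in_setD1 in_setD in_setC vS andbT outuY // andbT.
  apply: contraTneq vu => ->; apply/negP => tu.
  have du : d \notin out u by apply: contraL dY; apply: outuY.
  case: (cross_free u r) => [sub|sub|cov|[dis _]].
  - have [w wu wt] := card2_other t (out_ge2 uS).
    case: (r_dt w (subsetP sub w wu)) => e; last by rewrite e eqxx in wt.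
    by rewrite -e wu in du.
  - by rewrite (subsetP sub) in du.
  - have Yd w : w \in Y -> w \notin S -> w = d.
      move=> wY wS; have : w \in out u :|: out r by rewrite cov inE.
      case/setUP=> [/outuY|/r_dt[//|e]]; first by rewrite wY.
      by rewrite e (negPf tY) in wY.
    have : #|[set r; s3]| < #|outs [set r; s3]|.
      apply: Hall_out; first by rewrite subUset !sub1set rS.
        by apply/set0Pn; exists r; rewrite !inE eqxx.
      apply: contraTneq sS => <-; rewrite !inE negb_or.
      by rewrite eq_sym sr eq_sym s3s.
    rewrite cards2 eq_sym s3r ltnNge (card_le2 (x := d) (y := t)) //.
    apply/subsetP => w /bigcupP[x /set2P[]-> wx]; rewrite !inE.
      by case: (r_dt w wx) => ->; rewrite eqxx ?orbT.
    have wS : w \notin S by move: wx; rewrite in_out => /andP[].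
    case: (bridge_out_in dS br s3S s3Y wx) => [->|wY]; first by rewrite eqxx orbT.
    by rewrite (Yd w wY wS) eqxx.
  by have := in_set0 t; rewrite -dis inE tu t_r.
have hA : #|S :\: Y :\ s| < #|XD|.
  have [->|A0] := eqVneq (S :\: Y :\ s) set0.
    by rewrite cards0 card_gt0; apply/set0Pn; exists q.
  apply: leq_trans (Hall_out _ A0 _) (subset_leq_card _).
  - exact: subset_trans (subD1set _ _) (subsetDl _ _).
  - by apply: contraTneq sS => <-; rewrite !inE eqxx.
  apply/subsetP => v /bigcupP[u /setD1P[us /setDP[uS uY]] vu].
  exact: outXD uS uY us vu.
have hB : #|S :&: Y| < #|(~: S :&: Y) :|: [set t]|.
  apply: leq_trans (Hall_out _ _ _) (subset_leq_card _).
  - exact: subsetIl.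
  - by apply/set0Pn; exists r; rewrite inE rS.
  - by apply: contraTneq sS => <-; rewrite inE (negPf sY) andbF.
  apply/subsetP => v /bigcupP[u /setIP[uS uY] vu].
  have vS : v \notin S by move: vu; rewrite in_out => /andP[].
  rewrite in_setU in_set1 in_setI in_setC vS /=.
  by case: (bridge_out_in dS br uS uY vu) => ->; rewrite ?eqxx ?orbT.
have := card_setU_le (~: S :&: Y) [set t]; rewrite cards1.
have c1 : #|~: S :\: Y| = 1 + #|XD| by rewrite (cardsD1 t) !inE tY tS'.
have c2 : #|S :\: Y| = 1 + #|S :\: Y :\ s| by rewrite (cardsD1 s) !inE sY sS.
have := cardsID Y S; have := cardsID Y (~: S); rewrite card_outside c1 c2.
move: hA hB; clear.
move: #|_ :|: _| #|XD| #|~: S :&: Y| #|S :\: Y :\ s| #|S :&: Y| #|S|; lia.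
Qed.

(** If [N(s)] is covered by two other neighbourhoods at [d], some [r] nested in
    [s] shares a neighbour of degree three with it. *)
Lemma out_not_covered s s2 s3 d : d \notin S -> d -- s -> d -- s2 -> d -- s3 ->
  s2 != s -> s3 != s -> s2 != s3 -> 2 < #|out s| -> ~~ (out s \subset out s2 :|: out s3).
Proof.
move=> dS ds ds2 ds3 s2s s3s s23 out3; apply/negP => cov.
have inS v : d -- v -> v \in S by move=> dv; apply: (subsetP (nbrs_in_S dS)); rewrite inE.
have [sS s2S s3S] : [/\ s \in S, s2 \in S & s3 \in S] by split; apply: inS.
have deg3 : 2 < #|nbrs d|.
  by apply: (card_gt2 (x := s) (y := s2) (z := s3)); rewrite ?inE // eq_sym.
have sd : s -- d by rewrite edge_sym.
case: (cross_cases sS dS sd deg3) => [[t [Y br]]|[T [tT sT [leaf _] T0 types]]]; last first.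
  have inC v : v \in out s -> [/\ v \notin S, s -- v, v \notin T & v \in component T s].
    move=> vs; have vT : v \notin T.
      by apply/negP => vT; have := in_set0 v; rewrite -T0 inE vT vs.
    move: vs; rewrite in_out => /andP[vS sv]; split=> //.
    exact: component_step (component_refl _ _) sv sT vT.
  (* Otherwise all vertices of [out s] are isolated by [s |: T], which makes too
     many components. *)
  have [r [d1 [rS rT rs d1s rd1]]] : exists r d1,
      [/\ r \in S, r \notin T, r != s, d1 \in out s & r -- d1].
    suff /exists_inP[r /setDP[rS rT] /andP[rs /exists_inP[d1 d1s rd1]]] :
        [exists r in S :\: T, (r != s) && [exists d1 in out s, r -- d1]] by exists r, d1.
    apply: contraT => /exists_inPn none.
    have nb v u : v \in out s -> v -- u -> u \in s |: T.
      move=> vs vu; have [vS _ _ _] := inC v vs; rewrite !inE.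
      apply: contraT; rewrite negb_or => /andP[us uT].
      have uS : u \in S by apply: (subsetP (nbrs_in_S vS)); rewrite inE.
      have /none : u \in S :\: T by rewrite inE uT.
      by rewrite us /= => /exists_inPn/(_ v vs); rewrite edge_sym vu.
    pose single := [set [set v] | v in out s]; pose others := comps T :\ component T s.
    have disj F v : F \in others -> v \in F -> v \notin component T s.
      move=> /setD1P[FC FT] vF; apply: contra FC => vC.
      by rewrite (comps_eq FT (mem_comps sT) vF vC).
    have dis : single :&: others = set0.
      apply/setP => F; rewrite in_setI in_set0; apply/negbTE/negP.
      case/andP=> /imsetP[v vs ->] /disj/(_ (set11 v)).
      by have [_ _ _ ->] := inC v vs.
    have cP : #|single :|: others| = #|out s| + #|T|.-1.
      rewrite cardsU dis cards0 subn0 card_imset; last exact: set1_inj.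
      by rewrite -(tough_card G1 tT) (cardsD1 (component T s) (comps T)) mem_comps.
    have : #|single :|: others| <= #|comps (s |: T)|.
      apply: card_islands.
        apply: trivIsetI_of => A B v /setUP[/imsetP[a aS ->]|AP] /setUP[/imsetP[b bS ->]|BP].
        - by move=> /set1P-> /set1P->.
        - move=> /set1P-> /(disj B _ BP); by have [_ _ _ ->] := inC a aS.
        - move=> /(disj A _ AP) vA /set1P vb; move: vA; rewrite vb.
          by have [_ _ _ ->] := inC b bS.
        - by move: AP BP => /setD1P[_ AT] /setD1P[_ BT]; apply: (comps_eq AT BT).
      move=> F /setUP[/imsetP[v vs ->]|FO].
        have [vS sv vT _] := inC v vs; split; first by apply/set0Pn; exists v; rewrite inE.
          by rewrite disjoints1 !inE negb_or vT eq_sym (edge_neq sv).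
        by move=> u w /set1P-> vw; rewrite (nb v w vs vw) orbT.
      have sF : s \notin F by apply/negP => /(disj F s FO); rewrite component_refl.
      have FT : F \in comps T by case/setD1P: FO.
      have [F0 dF outF] := comps_island FT; split=> //.
        by rewrite -setI_eq0 setIUr setU_eq0 !setI_eq0 dF disjoint_sym disjoints1 sF.
      by move=> u v uF uv; rewrite !inE orbCA (outF u v uF uv) orbT.
    have T2 := tough_gt1 tT; have cT : #|s |: T| = #|T| + 1 by rewrite cardsU1 sT addnC.
    have : 1 < #|comps (s |: T)| -> #|comps (s |: T)| <= #|s |: T| by apply: G1.
    rewrite cT; move: cP T2 out3; clear.
    move: #|single :|: others| #|comps (s |: T)| #|out s| #|T|; lia.
  have [d1S sd1 _ _] := inC d1 d1s.
  have [dr [sub|dis]] := types r rS rT rs; last first.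
    by have := in_set0 d1; rewrite -dis inE d1s in_out d1S rd1.
  have neq u : d -- u -> r != u.
    by move=> du; apply: contraNneq dr => ->; rewrite in_out dS edge_sym.
  have deg u : u != s -> d -- u -> u -- d1 -> 2 < #|nbrs d1|.
    move=> us du ud1; apply: (card_gt2 (x := r) (y := s) (z := u));
      rewrite ?inE ?[d1 -- _]edge_sym ?neq //.
    by rewrite eq_sym.
  have deg31 : 2 < #|nbrs d1|.
    have := subsetP cov d1 d1s; rewrite inE !in_out d1S /=.
    by case/orP; apply: deg.
  case/negP: dr; apply: (subsetP (out_not_nested (d := d1) d1S deg31 _ _ sub)).
  - by rewrite edge_sym.
  - by rewrite edge_sym.
  by rewrite in_out dS.
have [sY dY tY st dt] := bridge_ends br.
have case_t u v : d -- u -> d -- v -> v != s -> v != u -> u = t ->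
    out s \subset out u :|: out v -> False.
  move=> du dv vs vu ut cov'; have vY : v \in Y.
    by apply: (bridge_nbr br dv vs); rewrite -ut.
  have uS := inS u du; have vS := inS v dv; have dou : d \in out u by rewrite in_out dS edge_sym.
  have sub : out s \subset out u.
    apply/subsetP => x xs; case/setUP: (subsetP cov' x xs) => // xv.
    have [->//|xd] := eqVneq x d; have := bridge_out_s br xs xd.
    case: (bridge_out_in dS br vS vY xv) => [e|->//].
    by move: xs; rewrite in_out e -ut uS.
  apply: (bridge_S_absurd sS dS br); rewrite -?ut //.
    exact: out_not_nested dS deg3 du ds sub.
  by apply/set0Pn; exists v; rewrite inE vS.
have [e2|n2] := eqVneq s2 t; first by apply: (case_t s2 s3) => //; rewrite eq_sym.
have [e3|n3] := eqVneq s3 t; first by apply: (case_t s3 s2) => //; rewrite setUC.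
have [s2Y s3Y] : s2 \in Y /\ s3 \in Y by split; apply: (bridge_nbr br).
move: out3; rewrite ltnNge (card_le2 (x := d) (y := t)) //.
apply/subsetP => v vs; rewrite !inE; have [//|vd] := eqVneq v d.
have vY := bridge_out_s br vs vd; case/setUP: (subsetP cov v vs) => vi.
  by case: (bridge_out_in dS br s2S s2Y vi) => [->|]; rewrite ?eqxx // (negPf vY).
by case: (bridge_out_in dS br s3S s3Y vi) => [->|]; rewrite ?eqxx // (negPf vY).
Qed.

(** Three neighbourhoods sharing [d] are pairwise equal or covering by
    [cross_free] and [out_not_nested], against [out_not_covered]. *)
Lemma degree2 d : d \notin S -> #|nbrs d| = 2.
Proof.
move=> dS; apply/eqP; rewrite eqn_leq nbrs_ge2 // andbT leqNgt; apply/negP => deg3.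
have [s1 s1d] : exists s1, s1 \in nbrs d by apply/card_gt0P; apply: leq_trans deg3.
have [s2 s2d s21] := card2_other s1 (ltnW deg3).
have [s3 [s3d s31 s32]] := card3_other s1 s2 deg3; rewrite !inE in s1d s2d s3d.
have s12 : s1 != s2 by rewrite eq_sym.
have s13 : s1 != s3 by rewrite eq_sym.
have s23 : s2 != s3 by rewrite eq_sym.
have inS v : d -- v -> v \in S by move=> dv; apply: (subsetP (nbrs_in_S dS)); rewrite inE.
have dout v : d -- v -> d \in out v by move=> dv; rewrite in_out dS edge_sym.
have nested u v : d -- u -> d -- v -> out u \subset out v -> out u = out v.
  move=> du dv sub; apply/eqP; rewrite eqEsubset sub.
  exact: out_not_nested dS deg3 dv du sub.
have neq u v w : d -- u -> d -- v -> d -- w -> u != v -> u != w -> v != w ->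
    out u <> out v.
  move=> du dv dw uv uw vw e; have uS := inS u du; have vS := inS v dv.
  have : #|[set u; v]| < #|outs [set u; v]|.
    apply: Hall_out; first by rewrite subUset !sub1set uS.
      by apply/set0Pn; exists u; rewrite !inE eqxx.
    by apply: contraTneq S3 => <-; rewrite cards2; case: (_ != _).
  have sub : outs [set u; v] \subset out v.
    by apply/bigcupsP => z /set2P[]->; rewrite ?e.
  move/leq_trans/(_ (subset_leq_card sub)); rewrite cards2 uv => out3.
  have /negP[] : ~~ (out v \subset out u :|: out w).
    by apply: (out_not_covered dS dv du dw _ _ _ out3); rewrite // eq_sym.
  by rewrite e subsetUl.
have cover u v w : d -- u -> d -- v -> d -- w -> u != v -> u != w -> v != w ->
    out u :|: out v = ~: S.
  move=> du dv dw uv uw vw; case: (cross_free u v) => [sub|sub|//|[dis _]].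
  - by case: (neq u v w du dv dw uv uw vw); apply: nested.
  - by case: (neq u v w du dv dw uv uw vw); apply/esym/nested.
  by have := in_set0 d; rewrite -dis inE !dout.
have sub1 : out s1 \subset out s2 :|: out s3.
  rewrite (cover s2 s3 s1) //; apply/subsetP => v; rewrite in_out inE => /andP[//].
have [out3|out2] := ltnP 2 #|out s1|.
  by case/negP: (out_not_covered dS s1d s2d s3d s21 s31 s23 out3).
have [x x1 xd] := card2_other d (out_ge2 (inS s1 s1d)).
have e1 : out s1 = [set d; x].
  apply/esym/eqP; rewrite eqEcard subUset !sub1set dout // x1 cards2 eq_sym xd.
  exact: out2.
case/setUP: (subsetP sub1 x x1) => xi.
  apply: (neq s1 s2 s3) => //; apply: nested => //.
  by rewrite e1 subUset !sub1set dout.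
apply: (neq s1 s3 s2) => //; apply: nested => //.
by rewrite e1 subUset !sub1set dout.
Qed.

(** Double counting of the edges between [S] and its complement. *)
Lemma card_out s : s \in S -> #|out s| = 2.
Proof.
move=> sS; apply/eqP; rewrite eqn_leq out_ge2 // andbT leqNgt; apply/negP => out3.
have count : \sum_(u in S) #|out u| = \sum_(d in ~: S) #|nbrs d|.
  transitivity (\sum_(u in S) \sum_(d in ~: S) (u -- d : nat)).
    apply: eq_bigr => u uS; rewrite -sum1_card big_mkcond [RHS]big_mkcond /=.
    by apply: eq_bigr => d _; rewrite in_out inE; case: (d \in S) (u -- d) => -[].
  rewrite exchange_big; apply: eq_bigr => d; rewrite inE => dS.
  rewrite -sum1_card big_mkcond [RHS]big_mkcond /=.
  apply: eq_bigr => u _; rewrite inE edge_sym; case: (boolP (u \in S)) => uS.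
    by case: (d -- u).
  by rewrite (negPf (outside_indep dS uS)).
have e2 : \sum_(d in ~: S) #|nbrs d| = 2 * #|S|.
  rewrite -card_outside -sum1_card big_distrr /=; apply: eq_bigr => d.
  by rewrite inE => /degree2.
have : 2 * #|S| < \sum_(u in S) #|out u|; last by rewrite count e2 ltnn.
rewrite (bigD1 s sS) /= -sum1_card (bigD1 s sS) /= mulnDr -addSn.
apply: leq_add => //; rewrite big_distrr /=; apply: leq_sum => u /andP[uS _].
exact: out_ge2.
Qed.

(** ** The graph is [C_6] *)

(** The edge [uv] would be the chord of a cycle, and the triangle on it has a
    vertex [c] of degree two. *)
Lemma no_chord u v c c1 w c2 : u \in S -> v \in S -> w \in S -> c \notin S ->
  c1 \notin S -> c2 \notin S -> c -- u -> c -- v -> nbrs c \subset [set u; v] ->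
  u -- c1 -> c1 -- w -> w -- c2 -> c2 -- v -> u != w -> v != w -> ~~ (u -- v).
Proof.
move=> uS vS wS cNS c1S c2S cu cv nc uc1 c1w wc2 c2v uw vw; apply/negP => uv.
have neqS x y : x \in S -> y \notin S -> (x == y) = false.
  by move=> xS yS; apply/negbTE; apply: contraNneq yS => <-.
case: (edge_cases G1 Gfree Gcrit uv) => [[t [Y br]]|[T [tT uT vT star]]]; last first.
  have cT : c \in T.
    apply: contraT => cT; case: star => -[leaf _].
      by have := leaf c; rewrite edge_sym cv => /(_ isT cT) e; rewrite e uS in cNS.
    by have := leaf c; rewrite edge_sym cu => /(_ isT cT) e; rewrite e vS in cNS.
  have [z [zT zC cz]] := tough_adj G1 tT cT (mem_comps uT).
  have uC := component_refl T u; have vC := component_step uC uv uT vT.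
  have := subsetP nc z; rewrite !inE cz => /(_ isT)/orP[]/eqP e.
    by rewrite e uC in zC.
  by rewrite e vC in zC.
have [uY vY tY ut vt] := bridge_ends br.
have step x y : x \in Y -> x -- y -> y != t -> x != v \/ y != u -> y \in Y.
  move=> xY xy yt ne; apply: (bridge_step br xY xy yt).
  by apply/negP => /andP[/eqP ex /eqP ey]; case: ne; rewrite ?ex ?ey eqxx.
have et : t = c.
  apply/eqP; apply: contraNT uY => tc.
  have cY : c \in Y.
    apply: step vY _ _ _; rewrite 1?edge_sym 1?eq_sym //; right.
    by rewrite neqS.
  by apply: step cY cu ut _; left; rewrite eq_sym neqS.
have nc' z : c -- z -> z = u \/ z = v.
  by move=> cz; have := subsetP nc z; rewrite !inE cz => /(_ isT)/orP[]/eqP; [left|right].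
have wc : ~~ (c -- w).
  by apply/negP => /nc'[] e; [move: uw|move: vw]; rewrite e eqxx.
case/negP: uY; subst t.
have c2Y : c2 \in Y.
  apply: step vY _ _ _; first by rewrite edge_sym.
    by apply: contraNneq wc => <-; rewrite edge_sym.
  by right; rewrite eq_sym neqS.
have wY : w \in Y.
  apply: step c2Y _ _ _; first by rewrite edge_sym.
    by rewrite neqS.
  by left; rewrite eq_sym neqS.
have c1Y : c1 \in Y.
  apply: step wY _ _ _; first by rewrite edge_sym.
    by apply: contraNneq wc => <-.
  by left; rewrite eq_sym.
apply: step c1Y _ ut _; first by rewrite edge_sym.
by left; rewrite eq_sym neqS.
Qed.

(** Two vertices [s1], [s2] of [S] with a common neighbour [d] cover all of
    [~: S] by [cross_free] and [Hall_out], so [S] has three vertices. *)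
Lemma large_cycle : isomorphic G (cycle_graph 6).
Proof.
have [d dS] : exists d, d \notin S.
  have : 0 < #|~: S| by rewrite card_outside; apply: leq_trans S3.
  by case/card_gt0P=> d; rewrite inE => dS; exists d.
have pair x y z (A : {set G}) : #|A| = 2 -> x \in A -> y \in A -> x != y -> z \in A ->
    z = x \/ z = y.
  move=> A2 xA yA xy zA; have eA : A = [set x; y].
    by apply/esym/eqP; rewrite eqEcard subUset !sub1set xA yA cards2 xy A2.
  by move: zA; rewrite eA => /set2P.
have /cards2P[s1 [s2 [s12 nd]]] : #|nbrs d| == 2 by rewrite degree2.
have [ds1 ds2] : d -- s1 /\ d -- s2.
  by have := set21 s1 s2; have := set22 s1 s2; rewrite -nd !inE.
have inS e v : e \notin S -> e -- v -> v \in S.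
  by move=> eS ev; apply: (subsetP (nbrs_in_S eS)); rewrite inE.
have [s1S s2S] := (inS d s1 dS ds1, inS d s2 dS ds2).
have dout v : d -- v -> d \in out v by move=> dv; rewrite in_out dS edge_sym.
have [x x1 xd] := card2_other d (out_ge2 s1S); have [y y2 yd] := card2_other d (out_ge2 s2S).
have out1 z : z \in out s1 -> z = d \/ z = x.
  by apply: pair; rewrite ?card_out ?dout // eq_sym.
have out2 z : z \in out s2 -> z = d \/ z = y.
  by apply: pair; rewrite ?card_out ?dout // eq_sym.
have xy : x != y.
  apply/eqP => xy; have : #|[set s1; s2]| < #|outs [set s1; s2]|.
    apply: Hall_out; first by rewrite subUset !sub1set s1S.
      by apply/set0Pn; exists s1; rewrite !inE eqxx.
    by apply: contraTneq S3 => <-; rewrite cards2; case: (_ != _).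
  rewrite cards2 s12 ltnNge (card_le2 (x := d) (y := x)) //.
  apply/subsetP => z /bigcupP[u /set2P[]-> zu]; rewrite !inE.
    by case: (out1 z zu) => ->; rewrite eqxx ?orbT.
  by case: (out2 z zu) => ->; rewrite ?xy eqxx ?orbT.
have x2 : x \notin out s2.
  by apply/negP => /out2[] e; [move: xd|move: xy]; rewrite e eqxx.
have y1 : y \notin out s1.
  by apply/negP => /out1[] e; [move: yd|move: xy]; rewrite e eqxx.
have eD : ~: S = [set d; x; y].
  have sub : out s1 :|: out s2 \subset [set d; x; y].
    apply/subsetP => z; rewrite !in_setU !in_set1.
    by case/orP=> [/out1|/out2] [] ->; rewrite eqxx ?orbT.
  have dD : [set d; x; y] \subset ~: S.
    rewrite !subUset !sub1set !inE dS.
    by move: x1 y2; rewrite !in_out => /andP[-> _] /andP[-> _].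
  case: (cross_free s1 s2) => [sub12|sub21|cov|[dis _]].
  - by rewrite (subsetP sub12) in x2.
  - by rewrite (subsetP sub21) in y1.
  - by apply/eqP; rewrite eqEsubset dD -{1}cov sub.
  by have := in_set0 d; rewrite -dis inE !dout.
have cS3 : #|S| = 3.
  rewrite -card_outside eD -setUA !cardsU1 cards1 !inE negb_or.
  by rewrite ![d == _]eq_sym xd yd xy.
move: (x1) (y2); rewrite !in_out => /andP[xS s1x] /andP[yS s2y].
move: x2 y1; rewrite !in_out xS yS /= => ns2x ns1y.
have [s3 [s3S s31 s32]] := card3_other s1 s2 S3.
have eS v : v \in S -> [\/ v = s1, v = s2 | v = s3].
  have eqS : S = [set s1; s2; s3].
    apply/esym/eqP; rewrite eqEcard !subUset !sub1set s1S s2S s3S cS3.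
    rewrite -setUA !cardsU1 cards1 !inE negb_or s12.
    by rewrite ![_ == s3]eq_sym s31 s32.
  by rewrite {1}eqS !inE => /orP[/orP[]|]/eqP; [constructor 1|constructor 2|constructor 3].
have xs3 : x -- s3.
  have [v vx vs1] : exists2 v, v \in nbrs x & v != s1 by apply: card2_other; rewrite degree2.
  rewrite inE in vx; case: (eS v (inS x v xS vx)) => e; rewrite -?e //.
    by rewrite e eqxx in vs1.
  by rewrite -e edge_sym vx in ns2x.
have ys3 : y -- s3.
  have [v vy vs2] : exists2 v, v \in nbrs y & v != s2 by apply: card2_other; rewrite degree2.
  rewrite inE in vy; case: (eS v (inS y v yS vy)) => e; rewrite -?e //.
    by rewrite -e edge_sym vy in ns1y.
  by rewrite e eqxx in vs2.
have nds3 : ~~ (d -- s3).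
  apply/negP => ds3; have : s3 \in nbrs d by rewrite inE.
  by rewrite nd !inE (negPf s31) (negPf s32).
have sub2 e u v : e \notin S -> e -- u -> e -- v -> u != v -> nbrs e \subset [set u; v].
  move=> eNS eu ev uv; apply/subsetP => z ze; rewrite !inE.
  have [ue ve] : u \in nbrs e /\ v \in nbrs e by rewrite !inE.
  by case: (pair u v z (nbrs e) (degree2 eNS) ue ve uv ze) => ->; rewrite eqxx ?orbT.
have [xs1 ys2] : x -- s1 /\ y -- s2 by rewrite !(edge_sym _ s1) !(edge_sym _ s2).
have [s1d s2d] : s1 -- d /\ s2 -- d by rewrite ![_ -- d]edge_sym.
have [s3x s3y] : s3 -- x /\ s3 -- y by rewrite ![s3 -- _]edge_sym.
have s13 : s1 != s3 by rewrite eq_sym.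
have s23 : s2 != s3 by rewrite eq_sym.
have s21 : s2 != s1 by rewrite eq_sym.
have n12 : ~~ (s1 -- s2).
  by apply: (no_chord (c := d) (c1 := x) (w := s3) (c2 := y)) => //; rewrite nd.
have n13 : ~~ (s1 -- s3).
  by apply: (no_chord (c := x) (c1 := d) (w := s2) (c2 := y)) => //; apply: sub2.
have n23 : ~~ (s2 -- s3).
  by apply: (no_chord (c := y) (c1 := d) (w := s1) (c2 := x)) => //; apply: sub2.
have ind := outside_indep.
pose c := [:: s1; d; s2; y; s3; x].
have neqS u v : u \in S -> v \notin S -> u != v by move=> uS; apply: contraNneq => <-.
have neqS' u v : u \notin S -> v \in S -> u != v by move=> uS vS; rewrite eq_sym neqS.
apply: (isomorphic_cycle (x0 := s1) (c := c)) => //.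
- rewrite uniq_pairwise /= ?andbT; do ?(apply/andP; split=> //);
    try by [apply: neqS | apply: neqS' | rewrite eq_sym].
- move=> v; rewrite !inE; case: (boolP (v \in S)) => [/eS[]->|vS]; rewrite ?eqxx ?orbT //.
  have : v \in ~: S by rewrite inE.
  by rewrite eD !inE => /orP[/orP[]|]->; rewrite ?orbT.
move=> [|[|[|[|[|[|i]]]]]] [|[|[|[|[|[|j]]]]]] //= _ _; apply/negbTE => //;
  try by [apply: ind]; rewrite edge_sym //.
Qed.

End LargeToughSet.

(** * From the definitions to the combinatorial hypotheses *)

Section Interface.
Implicit Type G H : sgraph.

(** Components are those of the induced subgraph on the complement of [S], read in
    [G] itself. *)
Lemma connect_induced G (S : {set G}) (u v : del_vertices S) :
  connect (@edge (del_vertices S)) u v = (val v \in component S (val u)).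
Proof.
have outS (w : del_vertices S) : val w \notin S by have := valP w; rewrite inE.
apply/idP/idP => [/connectP[p]|].
  elim: p u => [|w p IH] u /=; first by move=> _ ->; apply: component_refl.
  case/andP=> uw pw vE; have wu : val w \in component S (val u).
    exact: component_step (component_refl _ _) uw (outS u) (outS w).
  by rewrite -(component_eq wu); apply: IH.
pose Z := [set val w | w in [set w : del_vertices S | connect (@edge (del_vertices S)) u w]].
move=> vu; suff /subsetP/(_ _ vu)/imsetP[w] : component S (val u) \subset Z.
  by rewrite inE => uw /val_inj->.
apply: component_min => [|a b /imsetP[w]].
  by apply: imset_f; rewrite inE connect0.
rewrite inE => uw -> wb _ bS; have bS' : b \in ~: S by rewrite inE.
apply/imsetP; exists (Sub b bS'); last by [].
by rewrite inE; apply: connect_trans uw (connect1 _).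
Qed.

Lemma omega_del_vertices G (S : {set G}) : omega (del_vertices S) = #|comps S|.
Proof.
pose H := del_vertices S; have outS (w : H) : val w \notin S by have := valP w; rewrite inE.
have csym : connect_sym (@edge H) := sym_connect_sym (@edge_sym H).
pose f (u : H) := component S (val u).
have fE u v : (f u == f v) = connect (@edge H) u v.
  rewrite connect_induced; apply/eqP/idP => [e|vu]; last by rewrite /f (component_eq vu).
  by rewrite -/(f u) e component_refl.
have -> : comps S = f @: [set r | r \in roots (@edge H)].
  apply/setP => C; apply/imsetP/imsetP => [[u]|[r _ ->]].
    rewrite inE => uS ->; have uS' : u \in ~: S by rewrite inE.
    exists (root (@edge H) (Sub u uS')); first by rewrite inE; apply: roots_root.
    by apply/eqP; rewrite -[component S u]/(f (Sub u uS')) fE connect_root.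
  by exists (val r); rewrite ?inE ?outS.
rewrite card_in_imset; first by apply: eq_card => r; rewrite !inE andbT.
move=> r r'; rewrite !inE => /eqP er /eqP er' /eqP; rewrite fE => rr'.
by rewrite -er -er'; apply/eqP; rewrite root_connect.
Qed.

Lemma induced_copy G H (h : H -> G) : injective h ->
  (forall a b, h a -- h b = a -- b) -> exists A : {set G}, isomorphic (induced A) H.
Proof.
move=> inj hE; exists [set h a | a in predT].
have inv (u : induced [set h a | a in predT]) : exists a, h a == val u.
  by case: u => u /= /imsetP[a _ ->]; exists a.
pose f u := xchoose (inv u); have fK u : h (f u) = val u by apply/eqP/(xchooseP (inv u)).
exists f; split; last by move=> u v; rewrite -hE !fK.
exists (fun a => Sub (h a) (imset_f h (isT : a \in predT))) => [u|a].
  by apply: val_inj; rewrite /= fK.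
by apply: inj; rewrite fK.
Qed.

Lemma induced_free_K1P4 G :
  induced_free (disjoint_union (complete_graph 1) (path_graph 4)) G -> K1P4_free G.
Proof.
move=> free p q r t z pq qr rt pr pt qt zp zq zr zt; apply: free.
have [qp rq tr] : [/\ q -- p, r -- q & t -- r] by rewrite ![q -- p]edge_sym [r -- q]edge_sym [t -- r]edge_sym.
have sym (u v : G) : ~~ (u -- v) -> ~~ (v -- u) by rewrite edge_sym.
have neq (u v w : G) : u -- w -> ~~ (v -- w) -> u != v.
  by move=> uw; apply: contraNneq => <-.
pose h (a : disjoint_union (complete_graph 1) (path_graph 4)) : G :=
  match a with inl _ => z | inr i => nth z [:: p; q; r; t] i end.
have uc : uniq [:: z; p; q; r; t].
  rewrite uniq_pairwise /= !andbT; do ?(apply/andP; split).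
  - by rewrite eq_sym; apply: neq pq zq.
  - by rewrite eq_sym; apply: neq qp zp.
  - by rewrite eq_sym; apply: neq rq zq.
  - by rewrite eq_sym; apply: neq tr zr.
  - exact: edge_neq.
  - by rewrite eq_sym; apply: neq rt pt.
  - by apply: neq pq (sym _ _ qt).
  - exact: edge_neq.
  - by apply: neq qp (sym _ _ pt).
  - exact: edge_neq.
have uc4 : uniq [:: p; q; r; t] by case/andP: uc.
apply: (induced_copy (h := h)).
  have zh i : i < 4 -> nth z [:: p; q; r; t] i != z.
    move=> i4; case/andP: uc => zc _; apply: contraNneq zc => <-.
    exact: mem_nth.
  case=> [i|[i i4]] [j|[j j4]] /=.
  - by rewrite !ord1.
  - by move/esym/eqP; rewrite (negPf (zh j j4)).
  - by move/eqP; rewrite (negPf (zh i i4)).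
  by move/eqP; rewrite nth_uniq // => /eqP ij; congr inr; apply: val_inj.
case=> [i|[i i4]] [j|[j j4]].
- by rewrite (ord1 i) (ord1 j) !edge_irr.
- by rewrite [RHS]/edge /=; move: j j4; do 4?[case=> [_|]] => //=; apply/negbTE.
- by rewrite [RHS]/edge /= edge_sym; move: i i4; do 4?[case=> [_|]] => //=; apply/negbTE.
rewrite [RHS]/edge /=.
by move: i j i4 j4; do 4?[case=> [|]] => //; do 4?[case=> [|]] => //= _ _;
  rewrite ?edge_irr //; apply/negbTE => //; apply: sym.
Qed.

Lemma one_toughP G : one_tough G \/ exists S : {set G}, 1 < #|comps S| /\ #|S| < #|comps S|.
Proof.
case: (boolP [forall S : {set G}, (1 < #|comps S|) ==> (#|comps S| <= #|S|)]).
  by move=> /forallP all; left => S S1; have := all S; rewrite S1.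
rewrite negb_forall => /existsP[S]; rewrite negb_imply -ltnNge => /andP[S1 S2].
by right; exists S.
Qed.

Lemma tough_set_card G (S : {set G}) : tough_set S -> 2 < #|G|.
Proof.
case/andP=> S2 SC; have /card_gt0P[C CS] : 0 < #|comps S| by apply: leq_trans SC; apply: ltnW.
have [v vC] := comps_neq0 CS; have vS := comps_notin CS vC.
have : #|v |: S| <= #|G| by apply: max_card.
by rewrite cardsU1 vS; apply: leq_trans.
Qed.

(** A cut violating 1-toughness of [G - xy] must separate [x] from [y]: any other
    component is an island of [G] too. *)
Lemma critical_bridge G (x y : G) : one_tough G -> 2 < #|G| -> x -- y ->
  ~ one_tough (del_edge x y) ->
  exists T Y, bridge T x y Y /\ (#|T| = 1 \/ tough_set T).
Proof.
move=> G1 G3 xy ntough.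
have [S [S1 S2]] : exists S : {set G},
    1 < #|@comps (del_edge x y) S| /\ #|S| < #|@comps (del_edge x y) S|.
  by case: (one_toughP (del_edge x y)).
pose P : {set {set G}} := @comps (del_edge x y) S; rewrite -/P in S1 S2.
pose Y : {set G} := @component (del_edge x y) S y.
have Pmem (u : G) : u \notin S -> (@component (del_edge x y) S u : {set G}) \in P.
  exact: (@mem_comps (del_edge x y)).
have PE (F : {set G}) (u : G) : F \in P -> u \in F ->
    u \notin S /\ F = @component (del_edge x y) S u.
  exact: (@compsP (del_edge x y)).
have tP : trivIset P := @comps_trivI (del_edge x y) S.
have F0 (F : {set G}) : F \in P -> F != set0.
  by move=> FP; have [] := @comps_island (del_edge x y) S F FP.
have dF (F : {set G}) : F \in P -> [disjoint F & S].
  by move=> FP; have [] := @comps_island (del_edge x y) S F FP.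
have step (F : {set G}) (u v : G) : F \in P -> u \in F -> u -- v ->
    [\/ v \in F, v \in S, u = x /\ v = y | u = y /\ v = x].
  move=> FP uF uv; have [_ _ out] := @comps_island (del_edge x y) S F FP.
  have [e|ne] := eqVneq [set u; v] [set x; y]; last first.
    have uv' : @edge (del_edge x y) u v by rewrite {1}/edge /= uv ne.
    by case/orP: (out u v uF uv'); [constructor 1|constructor 2].
  move: (edge_neq uv) (set21 u v) (set22 u v); rewrite e => uv' /set2P[] eu /set2P[] ev.
  - by rewrite eu ev eqxx in uv'.
  - by constructor 3.
  - by constructor 4.
  - by rewrite eu ev eqxx in uv'.
have isl (F : {set G}) : F \in P -> (x \in F -> (y \in F) || (y \in S)) ->
    (y \in F -> (x \in F) || (x \in S)) -> @island G S F.
  move=> FP hx hy; split; [exact: F0|exact: dF|] => u v uF uv.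
  case: (step F u v FP uF uv) => [->|->|[eu ev]|[eu ev]]; rewrite ?orbT //.
    by rewrite ev hx // -eu.
  by rewrite ev hy // -eu.
have notall : ~ (forall F, F \in P -> @island G S F).
  move=> all; have le := card_islands tP all.
  by have := G1 S (leq_trans S1 le); rewrite leqNgt (leq_trans S2 le).
have [xS yS xY] : [/\ x \notin S, y \notin S & x \notin Y].
  have memS (F : {set G}) u : F \in P -> u \in S -> u \notin F.
    by move=> FP uS; rewrite (disjointFl (dF F FP) uS).
  split; apply/negP => h; apply: notall => F FP; apply: isl => // uF.
  - by rewrite (negPf (memS F x FP h)) in uF.
  - by rewrite h orbT.
  - by rewrite h orbT.
  - by rewrite (negPf (memS F y FP h)) in uF.
  - have [xS ->] := PE F x FP uF; apply/orP; left.
    by rewrite (@component_sym (del_edge x y)).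
  - by have [yS ->] := PE F y FP uF; rewrite [x \in _]h.
have yY : y \in Y := @component_refl (del_edge x y) S y.
have YP : Y \in P := Pmem y yS.
have leave (u v : G) : u \in Y -> v \notin Y -> u -- v -> v \in S \/ (u = y /\ v = x).
  move=> uY vY uv; case: (step Y u v YP uY uv) => [vY'|vS|[_ ev]|]; [|by left| |by right].
    by rewrite vY' in vY.
  by rewrite ev yY in vY.
have br : bridge S x y Y.
  by split=> //; [rewrite in_setU negb_or xY xS|exact: dF].
have [S0|] := posnP #|S|.
  (* [xy] is a bridge of [G], hence also of [G - t] for any other vertex [t]. *)
  have [t [_ tx ty]] : exists t, [/\ t \in [set: G], t != x & t != y].
    by apply: card3_other; rewrite cardsT.
  exists [set t], (Y :\ t); split; last by left; rewrite cards1.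
  split.
  - by rewrite in_setU in_setD1 negb_or (negPf xY) andbF in_set1 eq_sym.
  - by rewrite in_setD1 eq_sym ty.
  - by rewrite disjoint_sym disjoints1 in_setD1 eqxx.
  move=> u v /setD1P[_ uY] vYt uv; have [->|vt] := eqVneq v t; first by left; rewrite in_set1.
  have vY : v \notin Y by apply: contra vYt => vY; rewrite in_setD1 vt.
  case: (leave u v uY vY uv) => [vS|]; last by right.
  by rewrite (cards0_eq S0) in_set0 in vS.
(* At most the components of [x] and [y] are not islands of [G]; they are merged
   into the rest. *)
rewrite leq_eqVlt => /orP[/eqP e1|S2']; exists S, Y; split=> //; [by left|right].
apply/andP; split=> //; pose X : {set G} := @component (del_edge x y) S x.
have XP : X \in P := Pmem x xS.
pose Q := P :\ Y :\ X; have QP : Q \subset P := subset_trans (subD1set _ _) (subD1set _ _).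
have notQ (F : {set G}) : F \in Q -> x \notin F /\ y \notin F.
  move=> /setD1P[FX /setD1P[FY FP]]; split.
    by apply: contra FX => xF; have [_ ->] := PE F x FP xF.
  by apply: contra FY => yF; have [_ ->] := PE F y FP yF.
have cQ : #|S| <= #|Q|.+1.
  have cP : #|P| <= #|Q| + 2.
    apply: leq_trans (card_leD1 P Y) _; rewrite -[2]/(1 + 1) addnA leq_add2r.
    exact: card_leD1.
  by move: (leq_trans S2 cP); rewrite addn2.
apply: leq_trans cQ _; apply: (card_islands_rest (s := x)) => //.
- exact: sub_trivIset QP tP.
- move=> F FQ; have [xF yF] := notQ F FQ; apply: isl (subsetP QP F FQ) _ _.
    by rewrite (negPf xF).
  by rewrite (negPf yF).
by apply/negP => /bigcupP[F /notQ[/negP xF _]].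
Qed.

End Interface.

From mathcomp Require Import all_order all_algebra.
From mathcomp Require Import all_classical all_reals.
Import Order.TTheory GRing.Theory Num.Theory.

(** * Toughness one *)

Lemma toughP (R : realType) (t : R) (G : sgraph) : tough t G <->
  forall S : {set G}, 1 < #|comps S| -> (t * #|comps S|%:R <= #|S|%:R)%R.
Proof.
by split=> tG S; move: (tG S); rewrite /vertex_cut /disconnected omega_del_vertices.
Qed.

Lemma tough1P (R : realType) (G : sgraph) : tough (1%R : R) G <-> one_tough G.
Proof.
split=> [/toughP tG S S1|G1].
  by move: (tG S S1); rewrite mul1r ler_nat.
by apply/toughP => S S1; rewrite mul1r ler_nat; apply: G1.
Qed.

(** If no set is tough, then [#|S| >= #|comps S| + 1] for all cuts, and
    [1 + 1 / #|G|] also bounds the ratios from below. *)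
Lemma toughness1_tough_set (R : realType) (G : sgraph) : toughness R G = (1%R : R)%:E ->
  one_tough G /\ exists S : {set G}, tough_set S.
Proof.
move=> tG1; have ncG : ~~ is_complete G.
  by apply/negP => cG; move: tG1; rewrite /toughness cG.
have [t [et _ tG maxt]] := toughness_max R ncG.
have e1 : t = 1%R by move: et; rewrite tG1 => -[].
have G1 : one_tough G by apply/(tough1P R); rewrite -e1.
split=> //; case: (boolP [exists S : {set G}, tough_set S]) => [/existsP//|].
rewrite negb_exists => /forallP nS; exfalso.
pose n : R := (#|G|.+1%:R)%R; have n0 : (0 < n)%R by rewrite ltr0n.
have : (1 + n^-1 <= t)%R; last first.
  by rewrite e1 -lerBrDl subrr invr_le0 leNgt n0.
apply: maxt.
  by rewrite addr_ge0 // invr_ge0 ltW.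
apply/toughP => S S1; have cG : #|comps S| <= #|G|.
  exact: leq_trans (leq_imset_card _ _) (max_card _).
have lt : #|comps S| < #|S|.
  rewrite ltnNge; apply: contra (nS S) => le; rewrite /tough_set le andbT.
  exact: leq_trans S1 (G1 S S1).
apply: (le_trans (y := (#|comps S|.+1%:R)%R)); last by rewrite ler_nat.
rewrite mulrDl mul1r -natr1 lerD2l.
rewrite mulrC ler_pdivrMr // mul1r ler_nat.
exact: leq_trans cG (leqnSn _).
Qed.

Lemma minimally_tough_critical (R : realType) (G : sgraph) :
  minimally_tough (1%R : R) G ->
  [/\ one_tough G, edges_critical G & exists S : {set G}, tough_set S].
Proof.
move=> [_ /toughness1_tough_set[G1 [S tS]] del]; split=> //; last by exists S.
move=> x y xy; apply: critical_bridge => //; first exact: tough_set_card tS.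
move=> /(tough1P R) tG'; have := del x y xy.
case: (boolP (is_complete (del_edge x y))) => [c|nc].
  by rewrite /toughness c.
have [t [-> _ _ maxt]] := toughness_max R nc.
by rewrite lte_fin ltNge maxt.
Qed.

Theorem theorem1p6 (R : realType) (G : sgraph) :
  minimally_tough (1%R : R) G ->
  induced_free (disjoint_union (complete_graph 1) (path_graph 4)) G ->
  isomorphic G (cycle_graph 4) \/ isomorphic G (cycle_graph 5) \/
  isomorphic G (cycle_graph 6).
Proof.
move=> /minimally_tough_critical[G1 Gcrit [S0 tS0]] /induced_free_K1P4 Gfree.
have [S [tS maxS]] : exists S : {set G}, max_tough S.
  by case: (@arg_maxnP _ S0 (@tough_set G) (fun S => #|S|) tS0) => S tS maxS; exists S.
have [S3|S2] := ltnP 2 #|S|.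
  by right; right; apply: (large_cycle G1 Gfree Gcrit (conj tS maxS) S3).
apply: (small_cycle G1 Gfree Gcrit _ tS) => T tT.
by apply/eqP; rewrite eqn_leq (leq_trans (maxS T tT) S2) tough_gt1.
Qed.
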